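(* Let $n\ge1$, let $\Omega\subset\mathbb{R}^n$ be a domain and let $A\in\mathscr{A}(\Omega)$. Then $A\in\mathscr{A}_{\rm wusc}(\Omega)$ if and only if for every $u\in C^1(\Omega)$, $$|Du|_{d_A}^2(x)=\langle A(x)\nabla u(x),\nabla u(x)\rangle\qquad\text{for almost every }x\in\Omega.$$
   Context: A domain is a connected open set. $\mathscr{A}(\Omega)$ is the set of all measurable maps $A=(a_{ij}):\Omega\to\mathbb{R}^{n\times n}$ for which there is a continuous function $\lambda:\Omega\to[1,\infty)$ with $\frac{1}{\lambda(x)}|\xi|^2\le\langle A(x)\xi,\xi\rangle\le\lambda(x)|\xi|^2$ for almost every $x\in\Omega$ and all $\xi\in\mathbb{R}^n$. The intrinsic distance is $d_A(x,y)=\sup\{u(x)-u(y)\}$, the supremum being over all $u\in C(\Omega)\cap W^{1,2}_{\mathrm{loc}}(\Omega)$ with $\langle A(z)\nabla u(z),\nabla u(z)\rangle\le1$ for almost every $z\in\Omega$. For a set $K$, $\mathrm{Lip}_{d_A}(u,K)=\sup_{x,y\in K,\,x\ne y}\frac{|u(y)-u(x)|}{d_A(x,y)}$, and the local Lipschitz constant is $|Du|_{d_A}(x)=\lim_{r\to0}\mathrm{Lip}_{d_A}(u,B(x,r))$. A function $f:\Omega\to\mathbb{R}$ is weak upper semicontinuous at $x\in\Omega$ if there is a set $E$ of Lebesgue measure zero with $f(x)\ge\limsup_{(\Omega\setminus E)\ni y\to x}f(y)$. $\mathscr{A}_{\rm wusc}(\Omega)$ is the set of all $A\in\mathscr{A}(\Omega)$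 such that for every $\xi\in S^{n-1}$ the function $\langle A(\cdot)\xi,\xi\rangle$ is weak upper semicontinuous at almost every $x\in\Omega$. $C^1(\Omega)$ is the set of functions with continuous gradient on $\Omega$. *)

(* Defs.v *)
From HB Require Import structures.
From mathcomp Require Import all_boot all_order all_algebra.
From mathcomp Require Import all_classical all_reals all_analysis.

Set Implicit Arguments.
Unset Strict Implicit.
Unset Printing Implicit Defensive.

Import Order.TTheory GRing.Theory Num.Theory.
Import numFieldNormedType.Exports.

Local Open Scope classical_set_scope.
Local Open Scope ring_scope.

(* R^n is 'rV[R]_n.  The library's norm on it is the sup norm (same topology),
   hence the explicit Euclidean norm and balls below.  Functions and maps
   defined on a set Omega are represented by total functions of which only the
   values on Omega are used. *)

(* Lebesgue measure on R^n, in three steps: the n-fold product of the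
   one-dimensional Lebesgue measure, as a measure on the product sigma-algebra
   of n.-tuple R; the outer measure it induces, transported to row vectors; the
   Caratheodory restriction of the latter, whose measurable sets are the
   Lebesgue measurable ones. *)

Section tuple_cons.
Context {d : measure_display} {T : measurableType d} {R : realType} {n : nat}.
Variable m1 : {sigma_finite_measure set T -> \bar R}.
Variable m : {sigma_finite_measure set (n.-tuple T) -> \bar R}.

Definition tcons (p : T * n.-tuple T) : n.+1.-tuple T := [tuple of p.1 :: p.2].

Lemma measurable_tcons : measurable_fun [set: T * n.-tuple T] tcons.
Proof. exact: measurable_cons. Qed.

Definition tuple_step : set (n.+1.-tuple T) -> \bar R :=
  pushforward (m1 \x m)%E tcons.

HB.instance Definition _ := Measure.copy tuple_step
  (measure_function_pushforward__canonical__measure_function_Measure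
     (m1 \x m)%E measurable_tcons).
(* The library's sigma-finite instance on m1 \x m is masked by the one it
   declares for subprobabilities, so sigma-finiteness is proved directly. *)
Let tuple_step_sigma_finite : sigma_finite setT tuple_step.
Proof.
have /sigma_finiteP[F [TF ndF Foo]] := sigma_finiteT m1.
have /sigma_finiteP[G [TG ndG Goo]] := sigma_finiteT m.
have mthead : measurable_fun [set: n.+1.-tuple T] (@thead n T).
  exact: measurable_tnth.
have mbehead := @measurable_behead d T n.
exists (fun k => (@thead n T) @^-1` F k `&`
                 (fun t : n.+1.-tuple T => [tuple of behead t]) @^-1` G k).
  apply/esym/seteqP; split=> // t _.
  have : (\bigcup_k F k) (thead t) by rewrite -TF.
  have : (\bigcup_k G k) [tuple of behead t] by rewrite -TG.
  move=> [j _ Gj] [i _ Fi]; exists (maxn i j) => //; split.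
    by move: Fi; exact: (subsetPset _ _ (ndF _ _ (leq_maxl i j))).
  by move: Gj; exact: (subsetPset _ _ (ndG _ _ (leq_maxr i j))).
move=> k; have [mF Fk] := Foo k; have [mG Gk] := Goo k; split.
  apply: measurableI; rewrite -[X in measurable X]setTI.
    exact: mthead.
  exact: mbehead.
rewrite /tuple_step /pushforward.
rewrite (_ : tcons @^-1` _ = F k `*` G k); last first.
  apply/seteqP; split=> -[x t] /=; rewrite theadE (_ : [tuple of _] = t)//;
    exact: val_inj.
by rewrite product_measure1E// lte_mul_pinfty// ge0_fin_numE.
Qed.
HB.instance Definition _ := Measure_isSigmaFinite.Build _ _ _ tuple_step tuple_step_sigma_finite.
End tuple_cons.
Fixpoint lebesgue_tuple (R : realType) (n : nat) :
    {sigma_finite_measure set (n.-tuple (measurableTypeR R)) -> \bar R} :=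
  match n with
  | 0 => \d_[tuple]
  | n'.+1 => tuple_step (@lebesgue_measure R) (lebesgue_tuple R n')
  end.

Section lebesgue_rV.
Context {R : realType} {n : nat}.

Definition lebesgue_outer (A : set 'rV[R]_n) : \bar R :=
  ((lebesgue_tuple R n)^*)%mu [set t | A (\row_i tnth t i)].

Let lebesgue_outer0 : lebesgue_outer set0 = 0%E.
Proof. exact: outer_measure0. Qed.

Let lebesgue_outer_ge0 A : (0 <= lebesgue_outer A)%E.
Proof. exact: outer_measure_ge0. Qed.

Let le_lebesgue_outer :
  {homo lebesgue_outer : A B / A `<=` B >-> (A <= B)%E}.
Proof. by move=> A B AB; apply: le_outer_measure => t; exact: AB. Qed.

Let lebesgue_outer_sigma_subadditive : sigma_subadditive lebesgue_outer.
Proof. by move=> F; exact: outer_measure_sigma_subadditive. Qed.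

HB.instance Definition _ := isOuterMeasure.Build R _ lebesgue_outer
  lebesgue_outer0 lebesgue_outer_ge0 le_lebesgue_outer
  lebesgue_outer_sigma_subadditive.

Definition lebesgue_outer_measure : {outer_measure set 'rV[R]_n -> \bar R} :=
  lebesgue_outer.

Definition lebesgue_rV :
    {measure set (caratheodory_type lebesgue_outer_measure) -> \bar R} :=
  [the measure _ _ of
    OuterMeasure.sort lebesgue_outer_measure :
      set (caratheodory_type lebesgue_outer_measure) -> \bar R].

End lebesgue_rV.

Section euclidean.
Context {R : realType} {n : nat}.
Implicit Types x y xi : 'rV[R]_n.

Definition dotp x y : R := \sum_(i < n) x ord0 i * y ord0 i.

Definition enorm x : R := Num.sqrt (dotp x x).

Definition eball x (r : R) : set 'rV[R]_n := [set y | enorm (y - x) < r].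

(* <M xi, xi>; row vectors stand for column vectors, so M xi is xi *m M^T *)
Definition qform (M : 'M[R]_n) xi : R := dotp (xi *m M^T) xi.

Definition partial (i : 'I_n) (f : 'rV[R]_n -> R) (x : 'rV[R]_n) : R :=
  'D_(delta_mx 0 i) f x.

Definition grad (f : 'rV[R]_n -> R) (x : 'rV[R]_n) : 'rV[R]_n :=
  \row_(i < n) partial i f x.

End euclidean.

Section sobolev.
Context {R : realType} {n : nat}.
Implicit Types (Omega K : set 'rV[R]_n) (u f phi : 'rV[R]_n -> R).

Definition domain Omega : Prop := open Omega /\ connected Omega.

Definition C1 Omega u : Prop :=
  (forall x, Omega x -> differentiable u x) /\
  {within Omega, continuous (grad u)}.

Fixpoint Ck (k : nat) f : Prop :=
  if k is k'.+1 then
    (forall x, differentiable f x) /\ (forall i, Ck k' (partial i f))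
  else continuous f.

Definition test_function Omega phi : Prop :=
  (forall k, Ck k phi) /\
  exists K, [/\ compact K, K `<=` Omega & forall x, ~ K x -> phi x = 0].

Definition L2loc Omega f : Prop :=
  measurable_fun (Omega : set (caratheodory_type lebesgue_outer_measure)) f /\
  forall K, compact K -> K `<=` Omega ->
    (\int[lebesgue_rV]_(x in K) (f x ^+ 2)%:E < +oo)%E.

(* u is in W^{1,2}_loc(Omega) and g is (a representative of) its weak gradient *)
Definition W12loc_grad Omega u (g : 'rV[R]_n -> 'rV[R]_n) : Prop :=
  [/\ L2loc Omega u,
      forall i, L2loc Omega (fun x => g x ord0 i) &
      forall phi i, test_function Omega phi ->
        (\int[lebesgue_rV]_(x in Omega) (u x * partial i phi x)%:E =
         - \int[lebesgue_rV]_(x in Omega) (g x ord0 i * phi x)%:E)%E].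

End sobolev.

Section intrinsic.
Context {R : realType} {n : nat}.
Implicit Types (Omega K : set 'rV[R]_n) (A : 'rV[R]_n -> 'M[R]_n)
  (u : 'rV[R]_n -> R).

Definition scrA Omega A : Prop :=
  (forall i j, measurable_fun
     (Omega : set (caratheodory_type lebesgue_outer_measure))
     (fun x => A x i j)) /\
  exists lambda : 'rV[R]_n -> R,
    [/\ {within Omega, continuous lambda},
        forall x, Omega x -> 1 <= lambda x &
        {ae lebesgue_rV, forall x, Omega x -> forall xi : 'rV[R]_n,
           (lambda x)^-1 * enorm xi ^+ 2 <= qform (A x) xi /\
           qform (A x) xi <= lambda x * enorm xi ^+ 2}].

Definition intrinsic_competitor Omega A u : Prop :=
  {within Omega, continuous u} /\
  exists g, W12loc_grad Omega u g /\
    {ae lebesgue_rV, forall z, Omega z -> qform (A z) (g z) <= 1}.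

Definition intrinsic_dist Omega A (x y : 'rV[R]_n) : \bar R :=
  ereal_sup [set (u x - u y)%:E | u in intrinsic_competitor Omega A].

Definition Lip (d : 'rV[R]_n -> 'rV[R]_n -> \bar R) u K : \bar R :=
  ereal_sup [set q | exists x y,
    [/\ K x, K y, x <> y & q = (`|u y - u x|%:E / d x y)%E]].

(* |Du|_d(x); for x in an open set Omega, eball x r is contained in Omega as
   soon as r is small, so only values of u and d on Omega matter. *)
Definition local_lip (d : 'rV[R]_n -> 'rV[R]_n -> \bar R) u
    (x : 'rV[R]_n) : \bar R :=
  lim (Lip d u (eball x r) @[r --> 0^'+]).

Definition weak_usc_at Omega (f : 'rV[R]_n -> R) (x : 'rV[R]_n) : Prop :=
  exists2 E : set 'rV[R]_n, lebesgue_rV.-negligible E &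
    (limf_esup (fun y => (f y)%:E) (within (Omega `\` E) x^') <= (f x)%:E)%E.

Definition scrA_wusc Omega A : Prop :=
  scrA Omega A /\
  forall xi : 'rV[R]_n, enorm xi = 1 ->
    {ae lebesgue_rV, forall x, Omega x ->
       weak_usc_at Omega (fun y => qform (A y) xi) x}.

End intrinsic.

(* Main.v *)
From HB Require Import structures.
From mathcomp Require Import all_boot all_order all_algebra.
From mathcomp Require Import all_classical all_reals all_analysis.
From mathcomp Require Import ring lra zify.
From mathcomp Require Import measurable_realfun.
Require Import Defs.

(** Write q_x for the quadratic form of A(x), d for the intrinsic distance and
    |Du| for the local Lipschitz constant of u with respect to d, and call
    sqrt (q_x(xi)) the A-length of xi at x.  Both implications compare |Du|(x)
    with the A-length of grad u x at x, which it is for constant coefficients.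

    Upper bound (local_lip_upper).  Let p = grad u x.  Semicontinuity gives
    q_y(p) <= q_x(p) + e for almost every y near x, so the linear function of
    gradient p, cut off near x and divided by about sqrt (q_x(p)), competes in
    the definition of d (intrinsic_dist_ge_linear).  Hence d(y, z) is at least
    |<p, y - z>| / sqrt (q_x(p)) up to small errors, whereas u changes by
    <p, y - z> up to small errors because it is C1.  Weak upper semicontinuity
    is given for each direction almost everywhere; countably many directions
    and ellipticity yield it for the direction grad u x, which depends on x
    (wusc_all).

    Lower bound (local_lip_lower).  This one holds at almost every x without
    semicontinuity, because A is approximately continuous almost everywhere
    (ae_approx_cont): arbitrarily small dyadic cubes around x contain only a
    small proportion of points y where A(y) is far from A(x).  Let xi be the
    image of p under the symmetric part of A(x).  A competitor v with gradient
    g satisfies q_y(g) <= 1, so Cauchy-Schwarz gives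
    <g, xi> <= sqrt (q_x(p)), nearly, at the good points of the cube, and
    ellipticity bounds <g, xi> at the bad ones.  Averaging v against a bump
    much smaller than the cube and moving the bump in the direction xi, one
    finds that v increases by at most tau sqrt (q_x(p)), nearly, along tau xi
    (mollify_MVT, competitor_increment).  The bound does not depend on v, so it
    bounds d (dense_point_dist).  But u increases by about
    <p, tau xi> = tau q_x(p), so the quotient is nearly sqrt (q_x(p)).

    Semicontinuity together with the two bounds gives the formula for |Du|.
    Conversely, the formula for the linear function of gradient xi says that
    q_y(xi) is almost everywhere the square of a local Lipschitz constant, and
    these are upper semicontinuous: a ball around x on which the Lipschitz
    constant is nearly |Du|(x) contains balls around the points near x
    (local_lip_usc, weak_usc_of_local_lip).

    Lebesgue measure comes from an outer measure on row vectors.  What the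
    proof uses of it comes from product measure: the volume of boxes,
    translation invariance, which gives integration by parts
    (integral_partial0), and outer regularity, which gives the density theorem
    along dyadic cubes (ae_weak_density). *)

Import Order.TTheory GRing.Theory Num.Theory.
Import numFieldNormedType.Exports.
Set Implicit Arguments.
Unset Strict Implicit.
Unset Printing Implicit Defensive.

Local Open Scope classical_set_scope.
Local Open Scope ring_scope.

(** * Lebesgue measure: boxes and translations *)

Lemma lebesgue_tuple_rect (R : realType) (n : nat)
    (A : 'I_n -> set (measurableTypeR R)) :
  (forall i, measurable (A i)) ->
  lebesgue_tuple R n [set t | forall i, A i (tnth t i)] =
  (\prod_(i < n) lebesgue_measure (A i))%E.
Proof.
elim: n A => [A mA|n IH A mA].
  rewrite big_ord0 /= diracE mem_set//=.
  by case.
rewrite big_ord_recl -IH//= /tuple_step /pushforward.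
rewrite -product_measure1E//; last first.
  rewrite (_ : [set _ | _] = \bigcap_i (fun t : n.-tuple _ => tnth t i) @^-1` A (lift ord0 i)).
    apply: fin_bigcap_measurable => // i _.
    rewrite -[X in measurable X]setTI; exact: measurable_tnth.
  by apply/seteqP; split => t /= h i => [_|]; exact: h.
congr (product_measure1 _ _ _); apply/seteqP; split=> -[x t] /=.
  move=> h; split; first exact: (h ord0).
  by move=> i; have := h (lift ord0 i); rewrite tnthS.
move=> [h0 h] i; case: (unliftP ord0 i) => [j ->|->] //.
by rewrite tnthS.
Qed.

(** Pushing Lebesgue measure forward by a translation gives a measure with the
    right values on intervals, so uniqueness of Lebesgue measure applies. *)
Lemma lebesgue_measure_shift (R : realType) (a : R) (B : set (measurableTypeR R)) :
  measurable B ->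
  lebesgue_measure ((fun x : measurableTypeR R => (x + a : measurableTypeR R)) @^-1` B) = lebesgue_measure B.
Proof.
pose f : measurableTypeR R -> measurableTypeR R := fun x => x + a.
rewrite -[X in _ -> lebesgue_measure X = _]/(f @^-1` B).
have mf : measurable_fun [set: measurableTypeR R] f.
  by apply: measurable_funD; [exact: measurable_id|exact: measurable_cst].
pose m' : {measure set (measurableTypeR R) -> \bar R} :=
  measure_function_pushforward__canonical__measure_function_Measure
    (@lebesgue_measure R) mf.
move=> mB; apply/esym.
rewrite (@lebesgue_measure_unique R m')// => _ [[p q] _ <-].
rewrite /= /pushforward.
have -> : f @^-1` `]p, q] = `]p - a, q - a]%classic.
  apply/seteqP; split => x; rewrite /= /f !in_itv /= ltrBlDr lerBrDr //.
rewrite !lebesgue_measure_itv/= !lte_fin ltrD2r.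
by rewrite -!EFinB opprB addrA subrK.
Qed.

Section tuple_shift.
Context {R : realType}.

Definition tshift n (h : 'I_n -> R) (t : n.-tuple (measurableTypeR R)) :
  n.-tuple (measurableTypeR R) := [tuple (tnth t i + h i : measurableTypeR R) | i < n].

Lemma measurable_tshift n (h : 'I_n -> R) :
  measurable_fun [set: n.-tuple (measurableTypeR R)] (tshift h).
Proof.
apply/measurable_fun_tnthP => i.
rewrite (_ : _ \o _ = (fun t : n.-tuple (measurableTypeR R) =>
   (tnth t i + h i : measurableTypeR R))); last first.
  by apply/funext => t /=; rewrite tnth_mktuple.
apply: measurable_funD; first exact: measurable_tnth.
exact: measurable_cst.
Qed.

(** Induction on the dimension: the shifted product measure and the product
    measure agree on measurable rectangles, which determine them. *)
Lemma lebesgue_tuple_shift n (h : 'I_n -> R) (B : set (n.-tuple (measurableTypeR R))) :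
  measurable B -> lebesgue_tuple R n (tshift h @^-1` B) = lebesgue_tuple R n B.
Proof.
elim: n h B => [h B mB|n IH h B mB].
  suff -> : tshift h @^-1` B = B by [].
  by apply/seteqP; split => t /=; have -> : tshift h t = t by apply: eq_from_tnth; case.
pose h' (i : 'I_n) := h (lift ord0 i).
pose S (p : measurableTypeR R * n.-tuple (measurableTypeR R)) :=
  ((p.1 + h ord0 : measurableTypeR R), tshift h' p.2).
have mS : measurable_fun setT S.
  apply/measurable_fun_pairP; split => /=.
    by apply: measurable_funD; [exact: measurable_fst|exact: measurable_cst].
  apply: (@measurableT_comp _ _ _ _ _ _ (tshift h') _ snd) => //.
  exact: measurable_tshift.
pose m' := measure_function_pushforward__canonical__measure_function_Measure
  (@lebesgue_measure R \x lebesgue_tuple R n)%E mS.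
rewrite /= /tuple_step /pushforward -[_ @^-1` (_ @^-1` _)]comp_preimage.
have -> : tshift h \o tcons = tcons \o S.
  apply/funext => -[x t]; apply: eq_from_tnth => i /=.
  rewrite tnth_mktuple; case: (unliftP ord0 i) => [j ->|->] //.
  by rewrite !tnthS tnth_mktuple.
rewrite comp_preimage.
apply/esym; apply: (@product_measure_unique _ _ _ _ _ _ _ m'); last first.
  by rewrite -[X in measurable X]setTI; exact: measurable_tcons.
move=> A C mA mC; rewrite /m' /= /pushforward.
have -> : S @^-1` (A `*` C) =
  ((fun x : measurableTypeR R => (x + h ord0 : measurableTypeR R)) @^-1` A) `*`
   (tshift h' @^-1` C) by apply/seteqP; split => -[].
rewrite product_measure1E ?IH //.
  by congr (_ * _)%E; exact: lebesgue_measure_shift.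
  rewrite -[X in measurable X]setTI.
  by apply: measurable_funD => //; exact: measurable_id.
by rewrite -[X in measurable X]setTI; exact: measurable_tshift.
Qed.
End tuple_shift.

Section rV_measure.
Context {R : realType} {n : nat}.
Notation X := (caratheodory_type (@lebesgue_outer_measure R n)).
Notation mu := (@lebesgue_rV R n).
Notation rowt := (fun t : n.-tuple (measurableTypeR R) => \row_i tnth t i : 'rV[R]_n).

(** The outer measure is an infimum over covers by measurable sets, and covers
    can be translated at no cost; hence the invariance holds for all sets. *)
Lemma lebesgue_outer_shift (h : 'rV[R]_n) (B : set 'rV[R]_n) :
  lebesgue_outer ((fun x : 'rV[R]_n => x + h)%R @^-1` B) = lebesgue_outer B.
Proof.
suff le (k : 'rV[R]_n) (C : set 'rV[R]_n) :
    (lebesgue_outer ((fun x : 'rV[R]_n => x + k)%R @^-1` C) <= lebesgue_outer C)%E.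
  apply/eqP; rewrite eq_le le /=.
  have := le (- h) ((fun x : 'rV[R]_n => x + h)%R @^-1` B).
  rewrite -comp_preimage (_ : _ \o _ = id) //.
  by apply/funext => x /=; rewrite subrK.
rewrite /lebesgue_outer /mu_ext.
apply: ereal_inf_le_tmp => _ [F [mF CF] <-].
exists (fun i => tshift (fun j => k ord0 j) @^-1` F i).
  split; first by move=> i; rewrite -[X in measurable X]setTI; exact: measurable_tshift.
  move=> t /= Ct; apply: (CF (tshift (fun j => k ord0 j) t)).
  rewrite /=; move: Ct; congr (C _).
  by apply/rowP => i; rewrite !mxE tnth_mktuple.
by apply: eq_eseriesr => i _; rewrite lebesgue_tuple_shift.
Qed.

(** Gives Caratheodory measurability of all concrete sets below (open sets,
    boxes, dyadic cubes): the product sigma-algebra is contained in that of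
    Caratheodory. *)
Lemma measurable_rV_tuple (B : set 'rV[R]_n) :
  measurable (rowt @^-1` B) -> measurable (B : set X).
Proof.
move=> mB; suff: caratheodory_measurable (@lebesgue_outer R n) B by [].
have H : caratheodory_measurable ((lebesgue_tuple R n)^*)%mu (rowt @^-1` B).
  apply: (@sub_caratheodory _ _ R (lebesgue_tuple R n)).
  by apply: sub_sigma_algebra; exact: mB.
by move=> Y; exact: (H (rowt @^-1` Y)).
Qed.

Lemma lebesgue_rV_tuple (B : set 'rV[R]_n) :
  measurable (rowt @^-1` B) -> mu B = lebesgue_tuple R n (rowt @^-1` B).
Proof. by move=> mB; apply: measurable_mu_extE. Qed.

Lemma rowtK (x : 'rV[R]_n) : rowt [tuple x ord0 i | i < n] = x.
Proof. by apply/rowP => i; rewrite mxE tnth_mktuple. Qed.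

Definition rect (A : 'I_n -> set R) := [set x : 'rV[R]_n | forall i, A i (x ord0 i)].

Lemma measurable_tuple_rect (A : 'I_n -> set (measurableTypeR R)) :
  (forall i, measurable (A i)) -> measurable (rowt @^-1` (rect A)).
Proof.
move=> mA; rewrite (_ : _ @^-1` _ =
   \bigcap_i (fun t : n.-tuple _ => tnth t i) @^-1` A i).
  apply: fin_bigcap_measurable => // i _.
  rewrite -[X in measurable X]setTI; exact: measurable_tnth.
apply/seteqP; split => t /= h i; first by have := h i; rewrite mxE.
by rewrite mxE; exact: h.
Qed.

Lemma measurable_rect (A : 'I_n -> set (measurableTypeR R)) :
  (forall i, measurable (A i)) -> measurable (rect A : set X).
Proof. by move=> mA; apply: measurable_rV_tuple; exact: measurable_tuple_rect. Qed.

Lemma lebesgue_rV_rect (A : 'I_n -> set (measurableTypeR R)) :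
  (forall i, measurable (A i)) ->
  mu (rect A) = (\prod_(i < n) lebesgue_measure (A i))%E.
Proof.
move=> mA; rewrite lebesgue_rV_tuple; last exact: measurable_tuple_rect.
rewrite -lebesgue_tuple_rect//; congr (lebesgue_tuple _ _ _).
apply/seteqP; split => t /= h i; first by have := h i; rewrite mxE.
by rewrite mxE; exact: h.
Qed.

End rV_measure.

(** * Sets regular with respect to a family of open sets *)

Section sandwich.
Context d (T : measurableType d) (R : realType) (m : {measure set T -> \bar R}).
Variable O : set (set T).

(** Regularity of B with respect to a family O of open sets, written
    symmetrically in B and its complement: V stands for the complement of a
    closed subset of B. The symmetry makes closure under complement immediate.
    *)
Definition sandwiched (B : set T) := forall e : R, 0 < e ->
  exists U V, [/\ O U, O V, B `<=` U, ~` B `<=` V & (m (U `&` V) < e%:E)%E].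

Hypothesis mfin : (m setT < +oo)%E.
Hypothesis Om : O `<=` measurable.
Hypothesis O0 : O set0.
Hypothesis OT : O setT.
Hypothesis OU : forall F : (set T)^nat, (forall k, O (F k)) -> O (\bigcup_k F k).
Hypothesis OI : forall A B, O A -> O B -> O (A `&` B).

(** For a countable union the outer sets are united, but the complements of
    the inner closed sets may only be intersected finitely often; the
    intersection stops at a rank k after which the union of the U i hardly
    grows in measure. Such a k exists by continuity from above, which is where
    finiteness of m is used. *)
Lemma sigma_algebra_sandwiched : sigma_algebra setT sandwiched.
Proof.
split.
- move=> e e0; exists set0, setT; split => //.
  by rewrite set0I measure0 lte_fin.
- move=> A gA e e0; have [U [V [oU oV AU AV UV]]] := gA e e0.
  exists V, U; split => //; first by rewrite setTD.
    by rewrite setTD setCK.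
  by rewrite setIC.
move=> F gF e e0.
have /choice[UV hUV] : forall i, exists UV : set T * set T,
  [/\ O UV.1, O UV.2, F i `<=` UV.1, ~` F i `<=` UV.2 &
    (m (UV.1 `&` UV.2) < ((e / 2) / (2 ^ i.+1)%:R)%:E)%E].
  move=> i; have [] := gF i ((e / 2) / (2 ^ i.+1)%:R).
    by rewrite !divr_gt0// ltr0n expn_gt0.
  by move=> U [V ?]; exists (U, V).
pose U i := (UV i).1; pose V i := (UV i).2.
pose W n := (\bigcup_i U i) `\` \bigcup_(i < n) U i.
have mU i : measurable (U i) by apply: Om; have [] := hUV i.
have mV i : measurable (V i) by apply: Om; have [] := hUV i.
have mUU : measurable (\bigcup_i U i) by exact: bigcupT_measurable.
have mW n : measurable (W n).
  by apply: measurableD => //; exact: bigcup_measurable.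
have W0 : \bigcap_n W n = set0.
  rewrite -subset0 => x Wx; have [[i _ Uix] _] := Wx 0%N I.
  have [_] := Wx i.+1 I; apply; exists i => //=.
have W_cvg : m (W k) @[k --> \oo] --> m (\bigcap_n W n).
  apply: nonincreasing_cvg_mu => //.
  - by rewrite (le_lt_trans _ mfin)// le_measure// ?inE.
  - by rewrite W0.
  - move=> i j ij; apply/subsetPset => x [Ux nU]; split => //.
    by apply: contra_not nU => -[k /= ki Ukx]; exists k => //=; exact: leq_trans ki ij.
have [k Wk] : exists k, (m (W k) < (e / 2)%:E)%E.
  have nb : nbhs (m (\bigcap_n W n)) [set x : \bar R | (x < (e / 2)%:E)%E].
    apply: open_nbhs_nbhs; split; first exact: open_ereal_lt_ereal.
    by rewrite /= W0 measure0 lte_fin divr_gt0.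
  have [k _ /(_ k (leqnn k)) Wk] := W_cvg _ nb.
  by exists k.
have oV j : O (\bigcap_(i < j) V i).
  elim: j => [|j IH]; first by rewrite bigcap_mkord big_ord0.
  rewrite bigcap_mkord big_ord_recr /= -bigcap_mkord.
  by apply: OI => //; have [] := hUV j.
exists (\bigcup_i U i), (\bigcap_(i < k) V i); split.
- by apply: OU => i; have [] := hUV i.
- exact: oV.
- by move=> x [i _ Fx]; exists i => //; have [_ _ + _ _] := hUV i; exact.
- move=> x nF i /= ik; have [_ _ _ + _] := hUV i; apply => Fi.
  by apply: nF; exists i.
apply: (@le_lt_trans _ _ (m (W k `|` \bigcup_i (U i `&` V i)))).
  apply: le_measure; rewrite ?inE.
  - apply: measurableI => //; exact: Om.
  - apply: measurableU => //.
    by apply: bigcupT_measurable => i; exact: measurableI.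
  move=> x [Ux Vx]; have [[i /= ik Uix]|nU] := pselect ((\bigcup_(i < k) U i) x).
    by right; exists i => //; split => //; exact: Vx.
  by left.
apply: (le_lt_trans (measureU2 _ _ _)) => //.
  by apply: bigcupT_measurable => i; exact: measurableI.
rewrite [e]splitr EFinD; apply: lte_leD => //.
  rewrite ge0_fin_numE// (le_lt_trans _ mfin)// le_measure ?inE//.
  by apply: bigcupT_measurable => i; exact: measurableI.
have mUVi i : measurable (U i `&` V i) by exact: measurableI.
apply: (le_trans (measure_sigma_subadditive _ _ (bigcupT_measurable _ mUVi) (@subset_refl _ _))) => //.
apply: (le_trans _ (epsilon_trick0 xpredT _)); last by rewrite divr_ge0// ltW.
apply: lee_nneseries => // i _; have [_ _ _ _ /ltW] := hUV i; exact.
Qed.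

End sandwich.

(** * Dyadic cubes *)

Section dyadic.
Context {R : realType} {n : nat}.
Notation X := (caratheodory_type (@lebesgue_outer_measure R n)).
Notation mu := (@lebesgue_rV R n).
Notation rowt := (fun t : n.-tuple (measurableTypeR R) => \row_i tnth t i : 'rV[R]_n).

Lemma norm_coord (x : 'rV[R]_n) i : `|x ord0 i| <= `|x|.
Proof.
rewrite /Num.norm/= mx_normrE.
exact: (le_trans _ (le_bigmax _ (fun ij => `|x ij.1 ij.2|) (ord0, i))).
Qed.

Lemma norm_rV_le (x : 'rV[R]_n) e : 0 <= e ->
  (forall i, `|x ord0 i| <= e) -> `|x| <= e.
Proof.
move=> e0 xe; rewrite {1}/Num.norm/= mx_normrE.
by apply: bigmax_le => // -[i j] _ /=; rewrite ord1.
Qed.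

Lemma norm_rV_lt (x : 'rV[R]_n) e : 0 < e ->
  (forall i, `|x ord0 i| < e) -> `|x| < e.
Proof.
move=> e0 xe; rewrite {1}/Num.norm/= mx_normrE.
by apply: bigmax_lt => // -[i j] _ /=; rewrite ord1.
Qed.

Definition dyadic_index (k : nat) (x : 'rV[R]_n) : 'rV[int]_n :=
  \row_i Num.floor (2 ^+ k * x ord0 i).

(** The cubes are half-open, so that those of a given level partition the
    space and every point has exactly one index per level. *)
Definition dyadic_cube k (m : 'rV[int]_n) := [set x | dyadic_index k x = m].

Lemma dyadic_cubeE k m : dyadic_cube k m =
  rect (fun i => `[(m ord0 i)%:~R / 2 ^+ k, ((m ord0 i)%:~R + 1) / 2 ^+ k[%classic).
Proof.
have k0 : 0 < (2 : R) ^+ k by rewrite exprn_gt0.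
apply/seteqP; split => x.
  move=> <- i; rewrite mxE /= in_itv /= ler_pdivrMr// ltr_pdivlMr// mulrC.
  by have := floor_itv (x ord0 i * 2 ^+ k); rewrite intrD1.
move=> h; apply/rowP => i; rewrite mxE; apply: floor_def.
by have := h i; rewrite /= in_itv /= ler_pdivrMr// ltr_pdivlMr// mulrC intrD1.
Qed.

Lemma dyadic_cube_dist k m x y : dyadic_cube k m x -> dyadic_cube k m y ->
  `|x - y| < (2 ^+ k)^-1.
Proof.
rewrite dyadic_cubeE => hx hy; apply: norm_rV_lt => [|i].
  by rewrite invr_gt0 exprn_gt0.
have := hx i; have := hy i; rewrite /= !in_itv/= !mxE mulrDl mul1r.
by move=> /andP[a b] /andP[c d]; rewrite ltr_norml; apply/andP; split; lra.
Qed.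

Lemma measurable_tuple_cube k m : measurable (rowt @^-1` dyadic_cube k m).
Proof. by rewrite dyadic_cubeE; apply: measurable_tuple_rect. Qed.

Lemma measurable_cube k m : measurable (dyadic_cube k m : set X).
Proof. exact: measurable_rV_tuple (measurable_tuple_cube k m). Qed.

Lemma lebesgue_dyadic_cube k m : mu (dyadic_cube k m) = (((2 ^+ k)^-1) ^+ n)%:E.
Proof.
have k0 : 0 < (2 : R) ^+ k by rewrite exprn_gt0.
rewrite dyadic_cubeE lebesgue_rV_rect//.
rewrite (eq_bigr (fun=> ((2 ^+ k)^-1)%:E)); last first.
  move=> i _; rewrite lebesgue_measure_itv/= lte_fin ltr_pM2r ?invr_gt0// ltrDl ltr01.
  by rewrite -EFinB -mulrBl addrAC subrr add0r mul1r.
by rewrite prodEFin prodr_const card_ord.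
Qed.

Lemma dyadic_cubeS k x y : dyadic_index k.+1 x = dyadic_index k.+1 y ->
  dyadic_index k x = dyadic_index k y.
Proof.
move=> xy; apply/rowP => i; rewrite !mxE.
have := congr1 (fun m : 'rV[int]_n => m ord0 i) xy; rewrite !mxE => {}xy.
apply: floor_def.
have /andP[a b] := floor_itv (2 ^+ k * y ord0 i).
rewrite -(ler_pM2l (_ : 0 < 2 :> R))// -(ltr_pM2l (_ : 0 < 2 :> R))//.
rewrite mulrA -exprS.
set f := Num.floor _ in a b *.
have -> : 2 * f%:~R = (2 * f)%:~R :> R by rewrite intrM.
have -> : 2 * (f + 1)%:~R = (2 * (f + 1))%:~R :> R by rewrite intrM.
rewrite -floor_ge_int -floor_lt_int xy floor_ge_int floor_lt_int.
rewrite !intrM exprS -mulrA ler_pM2l// ltr_pM2l//.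
by rewrite a b.
Qed.

Definition dyadic_inner k (U : set 'rV[R]_n) :=
  [set x | dyadic_cube k (dyadic_index k x) `<=` U].

Lemma dyadic_innerE k U : dyadic_inner k U =
  \bigcup_m (if `[< dyadic_cube k m `<=` U >] then dyadic_cube k m else set0).
Proof.
apply/seteqP; split => x.
  by move=> h; exists (dyadic_index k x) => //; rewrite asboolT.
by move=> [m _]; case: asboolP => // h xm; rewrite /dyadic_inner /= xm.
Qed.

Lemma dyadic_inner_sub k U : dyadic_inner k U `<=` U.
Proof. by move=> x; apply. Qed.

Lemma dyadic_innerS k U : dyadic_inner k U `<=` dyadic_inner k.+1 U.
Proof. by move=> x h y yx; apply: h; exact: dyadic_cubeS. Qed.

Lemma pow2_archi (e : R) : 0 < e -> exists k0, forall k, (k0 <= k)%N -> (2 ^+ k)^-1 < e.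
Proof.
move=> e0; exists (Num.bound e^-1) => k hk.
rewrite -[e]invrK ltf_pV2 ?posrE ?invr_gt0 ?exprn_gt0//.
apply: (@lt_le_trans _ _ k%:R).
  apply: (lt_le_trans (archi_boundP _)); first by rewrite ltW// invr_gt0.
  by rewrite ler_nat.
by rewrite -natrX ler_nat ltnW// ltn_expl.
Qed.

(** The levels may start at any k0, since the inner unions increase with the
    level; cube_density_null uses this to see only small cubes. *)
Lemma open_dyadic U : open U -> forall k0, U = \bigcup_k dyadic_inner (k0 + k) U.
Proof.
move=> oU k0; apply/seteqP; split; last by move=> x [k _]; exact: dyadic_inner_sub.
move=> x Ux.
have /nbhs_ballP[e /= e0 he] := open_nbhs_nbhs (conj oU Ux).
have [k hk] := pow2_archi e0.
exists k => // y; rewrite /= => yx; apply: he.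
rewrite mx_norm_ball /ball_ /=.
apply: lt_trans (hk (k0 + k)%N (leq_addl _ _)).
exact: (@dyadic_cube_dist _ (dyadic_index (k0 + k) x)).
Qed.

Lemma open_measurable_tuple U : open U -> measurable (rowt @^-1` U).
Proof.
move=> oU; rewrite (open_dyadic oU 0) preimage_bigcup.
apply: bigcupT_measurable => k; rewrite dyadic_innerE preimage_bigcup.
apply: countable_bigcupT_measurable => [|m]; first exact: countableP.
by case: asboolP => _; [exact: measurable_tuple_cube|rewrite preimage_set0].
Qed.

Lemma open_measurable_rV U : open U -> measurable (U : set X).
Proof. by move=> oU; apply: measurable_rV_tuple; exact: open_measurable_tuple. Qed.

Lemma closed_measurable_rV U : closed U -> measurable (U : set X).
Proof.
by move=> cU; rewrite -[U]setCK; apply: measurableC; apply: open_measurable_rV;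
  rewrite openC.
Qed.

End dyadic.

(** * Outer regularity of Lebesgue measure *)

Section outer_regularity.
Context {R : realType} {n : nat}.
Notation X := (caratheodory_type (@lebesgue_outer_measure R n)).
Notation mu := (@lebesgue_rV R n).
Notation rowt := (fun t : n.-tuple (measurableTypeR R) => \row_i tnth t i : 'rV[R]_n).

Definition box (r : R) : set 'rV[R]_n := [set x | `|x| < r].

Lemma open_box r : open (box r).
Proof. exact: (open_comp (fun x _ => @norm_continuous _ _ x) (@open_lt _ r)). Qed.

Lemma lebesgue_box_lty r : (mu (box r) < +oo)%E.
Proof.
have mI (i : 'I_n) : measurable (`[- r, r]%classic : set (measurableTypeR R)) by [].
apply: (@le_lt_trans _ _ (mu (rect (fun=> `[- r, r]%classic)))).
  apply: le_outer_measure => x xr i /=; rewrite in_itv /= -ler_norml ltW//.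
  exact: le_lt_trans (norm_coord _ _) xr.
rewrite lebesgue_rV_rect//.
rewrite (eq_bigr (fun=> (if - r < r then r + r else 0)%:E)) => [|i _].
  by rewrite prodEFin ltry.
rewrite lebesgue_measure_itv/= lte_fin; case: ifP => // _.
by rewrite -EFinB opprK.
Qed.

(** Sets with the sandwich property form a sigma-algebra containing the half
    spaces: the complement of the half space where a coordinate exceeds a lies
    in the open half spaces bounded by a + 1/(k+1), and the slabs between have
    empty intersection. *)
Lemma sandwiched_tuple (D : set (n.-tuple (measurableTypeR R)))
    (mD : measurable D) (B : set (n.-tuple (measurableTypeR R))) :
  (lebesgue_tuple R n D < +oo)%E -> measurable B ->
  sandwiched (mrestr (lebesgue_tuple R n) mD) [set rowt @^-1` U | U in open] B.
Proof.
move=> Dfin mB.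
set O := [set _ | _ in _]; set m := mrestr _ _.
have mfin : (m setT < +oo)%E by rewrite /m /mrestr setTI.
have Om : O `<=` measurable by move=> _ [U oU <-]; exact: open_measurable_tuple.
have O0 : O set0 by exists set0 => //; exact: open0.
have OT : O setT by exists setT => //; exact: openT.
have OU (F : (set _)^nat) : (forall k, O (F k)) -> O (\bigcup_k F k).
  move=> oF; have /choice[U hU] : forall k, exists U : set 'rV[R]_n,
    open U /\ rowt @^-1` U = F k.
    by move=> k; have [U ? ?] := oF k; exists U.
  exists (\bigcup_k U k).
    by apply: bigcup_open => i _; have [] := hU i.
  by rewrite preimage_bigcup; apply: eq_bigcupr => i _; have [] := hU i.
have OI A C : O A -> O C -> O (A `&` C).
  move=> [U oU <-] [V oV <-]; exists (U `&` V) => //; exact: openI.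
have sO := sigma_algebra_sandwiched mfin Om O0 OT OU OI.
suff : <<s \big[setU/set0]_(i < n) preimage_set_system setT
   (fun t : n.-tuple (measurableTypeR R) => tnth t i) measurable >> `<=` sandwiched m O by exact.
apply: smallest_sub => //.
rewrite -bigcup_seq => A [i _ [C mC <-]].
have sI : sigma_algebra setT (image_set_system setT (fun t : n.-tuple (measurableTypeR R) => tnth t i)
   (sandwiched m O)) by exact: sigma_algebra_image.
suff : measurable `<=` (image_set_system setT (fun t : n.-tuple (measurableTypeR R) => tnth t i)
   (sandwiched m O)) by apply.
rewrite [X in X `<=` _](RGenOInfty.measurableE R); apply: smallest_sub => // _ [a ->].
rewrite /image_set_system /= setTI.
have mf : m setT \is a fin_num by rewrite ge0_fin_numE.
pose U := (fun x : 'rV[R]_n => x ord0 i) @^-1` `]a, +oo[.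
pose V k := (fun x : 'rV[R]_n => x ord0 i) @^-1` `]-oo, (a + k.+1%:R^-1)[.
have oU : open U.
  by apply: open_comp => [x _|]; [exact: coord_continuous|exact: interval_open].
have oV k : open (V k).
  by apply: open_comp => [x _|]; [exact: coord_continuous|exact: interval_open].
pose D' k := rowt @^-1` (U `&` V k).
have mD' k : measurable (D' k) by apply: open_measurable_tuple; exact: openI.
have D'0 : \bigcap_k D' k = set0.
  rewrite -subset0 => t h; have [] := h 0%N I; rewrite /U /= !mxE in_itv /= andbT => at_ _.
  have [k _ /(_ k (leqnn _))/=] := near_infty_natSinv_lt (PosNum (etrans (subr_gt0 _ _) at_)).
  have [_] := h k I; rewrite /V /= !mxE in_itv /= -ltrBlDl => lt1 lt2.
  by have := lt_trans lt1 lt2; rewrite ltxx.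
have D'_cvg : m (D' k) @[k --> \oo] --> m (\bigcap_k D' k).
  apply: nonincreasing_cvg_mu => //.
  - by rewrite (le_lt_trans _ mfin)// le_measure// ?inE.
  - by rewrite D'0.
  - move=> j k jk; apply/subsetPset => x [Ux]; split => //.
    move: b; rewrite /V /= !mxE !in_itv /= => /lt_le_trans; apply.
    by rewrite lerD2l lef_pV2 ?posrE// ler_nat.
move=> e e0.
have nb : nbhs (m (\bigcap_k D' k)) [set x : \bar R | (x < e%:E)%E].
  apply: open_nbhs_nbhs; split; first exact: open_ereal_lt_ereal.
  by rewrite /= D'0 /m /mrestr set0I measure0 lte_fin.
have [k _ /(_ k (leqnn k)) Wk] := D'_cvg _ nb.
exists (rowt @^-1` U), (rowt @^-1` V k); split => //.
- by exists U.
- by exists (V k).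
- by move=> t; rewrite /U /= !mxE.
- move=> t; rewrite /V /= !mxE !in_itv /= andbT => /negP; rewrite -leNgt => h.
  by rewrite (le_lt_trans h)// ltrDl invr_gt0.
Qed.

(** N is covered by measurable sets of nearly the same total measure, and
    their union is then enclosed in an open set. Everything happens in a box,
    where Lebesgue measure is finite. *)
Lemma lebesgue_outer_regular (r : R) (N : set 'rV[R]_n) (e : R) :
  N `<=` box r -> 0 < e ->
  exists U, [/\ open U, N `<=` U & (mu U <= mu N + e%:E)%E].
Proof.
move=> Nr e0.
have e20 : 0 < e / 2 by rewrite divr_gt0.
have Nfin : mu N \is a fin_num.
  rewrite ge0_fin_numE ?outer_measure_ge0//.
  exact: le_lt_trans (le_outer_measure _ _ _ Nr) (lebesgue_box_lty r).
have /ereal_inf_lt[_ [F [mF NF] <-] Fe] : (mu N < mu N + (e / 2)%:E)%E.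
  by rewrite lteDl// lte_fin.
set B := \bigcup_k F k in NF.
have mB : measurable B by exact: bigcupT_measurable.
have mD : measurable (rowt @^-1` (box r)) by apply: open_measurable_tuple; exact: open_box.
have Dfin : (lebesgue_tuple R n (rowt @^-1` (box r)) < +oo)%E.
  by rewrite -lebesgue_rV_tuple//; exact: lebesgue_box_lty.
have [_ [_ [[U oU <-] [V oV <-] BU BV UV]]] := sandwiched_tuple mD Dfin mB e20.
exists (U `&` box r); split; first by apply: openI => //; exact: open_box.
  move=> x Nx; split; last exact: Nr.
  by rewrite -(rowtK x); apply: BU; apply: NF; rewrite /= rowtK.
have mUb : measurable (rowt @^-1` (U `&` box r)).
  by apply: open_measurable_tuple; apply: openI => //; exact: open_box.
have mUV : measurable (rowt @^-1` (U `&` V `&` box r)).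
  apply: open_measurable_tuple; apply: openI; last exact: open_box.
  exact: openI.
rewrite lebesgue_rV_tuple//.
apply: (@le_trans _ _ (lebesgue_tuple R n (B `|` (rowt @^-1` (U `&` V `&` box r))))).
  apply: le_measure; rewrite ?inE//; first exact: measurableU.
  move=> t [Ut bt]; have [Bt|nBt] := pselect (B t); [by left|right].
  by split => //; split => //; exact: BV.
apply: le_trans (measureU2 _ _ _) _ => //.
rewrite [e]splitr EFinD addeA; apply: leeD; last first.
  by move: UV; rewrite /mrestr => /ltW.
apply: le_trans (ltW Fe).
exact: measure_sigma_subadditive.
Qed.

End outer_regularity.

(** * Density points *)

Section density.
Context {R : realType} {n : nat}.
Notation X := (caratheodory_type (@lebesgue_outer_measure R n)).
Notation mu := (@lebesgue_rV R n).

(** An open set U containing N is exhausted by cubes, and N fills at most the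
    proportion c of each, so mu N <= c * mu U. Taking U nearly as small as N
    gives mu N <= c * mu N, hence mu N = 0. *)
Lemma cube_density_null (r c : R) (k0 : nat) (N : set X) :
  measurable N -> N `<=` box r -> 0 <= c -> c < 1 ->
  (forall k m, (k0 <= k)%N ->
     (mu (dyadic_cube k m `&` N) <= c%:E * mu (dyadic_cube k m))%E) ->
  mu N = 0%E.
Proof.
move=> mN Nr c0 c1 Nc.
have Nfin : mu N \is a fin_num.
  rewrite ge0_fin_numE ?outer_measure_ge0//.
  exact: le_lt_trans (le_outer_measure _ _ _ Nr) (lebesgue_box_lty r).
suff NU U : open U -> N `<=` U -> (mu N <= c%:E * mu U)%E.
  have Nce e : 0 < e -> (mu N <= c%:E * (mu N + e%:E))%E.
    move=> e0; have [U [oU NsU Ue]] := lebesgue_outer_regular Nr e0.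
    by apply: le_trans (NU _ oU NsU) _; rewrite lee_wpmul2l// lee_fin.
  move: Nce; rewrite -(fineK Nfin) => Nce.
  have {}Nce e : 0 < e -> fine (mu N) <= c * (fine (mu N) + e).
    by move=> /Nce; rewrite -EFinD -EFinM lee_fin.
  have x0 : 0 <= fine (mu N) by rewrite fine_ge0// outer_measure_ge0.
  congr (_%:E); apply/eqP; rewrite eq_le x0 andbT leNgt; apply/negP => xpos.
  have e0 : 0 < (1 - c) * fine (mu N) / 2 by rewrite divr_gt0// mulr_gt0// subr_gt0.
  have := Nce _ e0.
  have : c * ((1 - c) * fine (mu N) / 2) < 1 * ((1 - c) * fine (mu N) / 2).
    by rewrite ltr_pM2r.
  nra.
move=> oU NsU.
pose Q k (j : nat) : set X :=
  if (pickle_inv j : option 'rV[int]_n) is Some m then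
    if `[< dyadic_cube k m `<=` U >] then dyadic_cube k m else set0
  else set0.
have mQ k j : measurable (Q k j).
  rewrite /Q; case: pickle_inv => // m; case: asboolP => // _; exact: measurable_cube.
have tQ k : trivIset setT (Q k).
  apply/trivIsetP => i j _ _ ij; rewrite -subset0 => x []; rewrite /Q.
  have := @pickle_invK 'rV[int]_n i; have := @pickle_invK 'rV[int]_n j.
  case: pickle_inv => [a|//]; case: pickle_inv => [b|//] /= bj ai.
  case: asboolP => // _ xa; case: asboolP => // _ xb.
  by move: ij => /eqP; apply; rewrite -bj -ai -xa -xb.
have QE k : \bigcup_j Q k j = dyadic_inner k U.
  rewrite dyadic_innerE; apply/seteqP; split => x.
    by move=> [j _]; rewrite /Q; case: pickle_inv => // m xm; exists m.
  by move=> [m _ xm]; exists (pickle m) => //; rewrite /Q pickleK_inv.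
have mI k : measurable (dyadic_inner k U : set X).
  by rewrite -QE; exact: bigcupT_measurable.
have NI k : (k0 <= k)%N -> (mu (N `&` dyadic_inner k U) <= c%:E * mu U)%E.
  move=> k0k; apply: (@le_trans _ _ (c%:E * mu (dyadic_inner k U))%E); last first.
    by rewrite lee_wpmul2l// le_outer_measure//; exact: dyadic_inner_sub.
  rewrite -QE setI_bigcupr measure_semi_bigcup//; last 3 first.
  - by move=> j; exact: measurableI.
  - exact: trivIset_setIl.
  - by apply: bigcupT_measurable => j; exact: measurableI.
  rewrite measure_semi_bigcup//; last exact: bigcupT_measurable.
  rewrite -nneseriesZl//.
  apply: lee_nneseries => // j _.
  rewrite /Q; case: pickle_inv => [m|]; last by rewrite setI0 measure0 mule0.
  case: asboolP => _; last by rewrite setI0 measure0 mule0.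
  by rewrite setIC; exact: Nc.
have NE : N = \bigcup_k (N `&` dyadic_inner (k0 + k) U).
  by rewrite -setI_bigcupr -open_dyadic// setIidl.
have mNI k : measurable (N `&` dyadic_inner (k0 + k) U : set X) by exact: measurableI.
have : mu (N `&` dyadic_inner (k0 + k) U) @[k --> \oo] --> mu N.
  rewrite {2}NE; apply: nondecreasing_cvg_mu => //; first exact: bigcupT_measurable.
  apply/nondecreasing_seqP => k; apply/subsetPset; apply: setIS.
  by rewrite addnS; exact: dyadic_innerS.
move/cvg_lim => <-//; apply: lime_le.
  apply: ereal_nondecreasing_is_cvgn; apply/nondecreasing_seqP => k.
  apply: le_outer_measure; apply: setIS; rewrite addnS; exact: dyadic_innerS.
by apply: nearW => k; apply: NI; exact: leq_addr.
Qed.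

(** A form of the Lebesgue density theorem: almost every point of E lies in
    arbitrarily small dyadic cubes that E fills up to a proportion eta. For
    fixed eta = 1/(j+1) and starting level k0, the points of E that fail meet
    every cube of level at least k0 in a proportion at most 1 - eta, so
    cube_density_null applies. *)
Lemma ae_weak_density (E : set X) : measurable E ->
  mu.-negligible [set x | E x /\ ~ (forall eta : R, 0 < eta -> forall k0,
     exists2 k, (k0 <= k)%N & (mu (dyadic_cube k (dyadic_index k x) `\` E) <=
        eta%:E * mu (dyadic_cube k (dyadic_index k x)))%E)].
Proof.
move=> mE.
pose bad (j k : nat) (m : 'rV[int]_n) :=
  ((j.+1%:R^-1)%:E * mu (dyadic_cube k m) < mu (dyadic_cube k m `\` E))%E.
pose N (j k0 r : nat) : set X := E `&` box r%:R `&`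
  \bigcap_(k in [set k | (k0 <= k)%N]) (\bigcup_m (if bad j k m then dyadic_cube k m else set0)).
apply: (@negligibleS _ _ _ mu (\bigcup_j \bigcup_k0 \bigcup_r N j k0 r)).
  move=> x [Ex] /existsNP[eta] /not_implyP[eta0] /existsNP[k0 hk].
  have [j _ /(_ j (leqnn _))/= hj] := near_infty_natSinv_lt (PosNum eta0).
  exists j => //; exists k0 => //; exists (Num.bound `|x|) => //.
  split; first by split => //; rewrite /box /=; exact: archi_boundP.
  move=> k /= k0k; exists (dyadic_index k x) => //.
  case: ifPn => //; rewrite /bad -leNgt => h; exfalso; apply: hk.
  exists k => //; apply: le_trans h _.
  by rewrite lee_wpmul2r ?measure_ge0// lee_fin ltW.
apply: negligible_bigcup => j; apply: negligible_bigcup => k0; apply: negligible_bigcup => r.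
have mbox : measurable (box r%:R : set X) by apply: open_measurable_rV; exact: open_box.
have mN : measurable (N j k0 r).
  apply: measurableI; first exact: measurableI.
  apply: bigcap_measurable => [|k _]; first by exists k0 => /=.
  apply: countable_bigcupT_measurable.
    exact: countableP.
  by move=> m; case: ifP => // _; exact: measurable_cube.
apply/negligibleP => //.
have j01 : (j.+1%:R^-1 : R) <= 1 by rewrite invf_le1// ler1n.
apply: (@cube_density_null r%:R (1 - j.+1%:R^-1) k0) => //.
- by move=> x [[]].
- by rewrite subr_ge0.
move=> k m k0k.
have mC := @measurable_cube R n k m.
have Cfin : mu (dyadic_cube k m) \is a fin_num by rewrite lebesgue_dyadic_cube.
have [[x [xm [_ xN]]]|h] := pselect (exists x, (dyadic_cube k m `&` N j k0 r) x); last first.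
  rewrite (_ : _ `&` _ = set0) ?measure0; last first.
    by rewrite -subset0 => x Nx; apply: h; exists x.
  by rewrite mule_ge0 ?measure_ge0// lee_fin subr_ge0.
have {xN} bm : bad j k m.
  by have [m' _] := xN _ k0k; case: ifP => // bm' xm'; rewrite -xm xm'.
apply: (@le_trans _ _ (mu (dyadic_cube k m `&` E))).
  by apply: le_outer_measure => y [? [[]]].
have CE : (mu (dyadic_cube k m) = mu (dyadic_cube k m `\` E) + mu (dyadic_cube k m `&` E))%E.
  exact: measureDI.
move: bm Cfin; rewrite /bad CE.
have : (0 <= mu (dyadic_cube k m `&` E))%E by exact: measure_ge0.
have : (0 <= mu (dyadic_cube k m `\` E))%E by exact: measure_ge0.
case: (mu (dyadic_cube k m `&` E)) => [a| |]//; case: (mu (dyadic_cube k m `\` E)) => [b| |]//.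
move=> /fine_ge0/= b0 /fine_ge0 /= a0.
rewrite -EFinD -!EFinM lte_fin lee_fin => /ltW h _.
by rewrite mulrBl mul1r addrAC lerDr subr_ge0.
Qed.

End density.

(** * Scalar product, gradients and the mean value theorem *)

Section calculus.
Context {R : realType} {n : nat}.
Implicit Types (x y z v a b : 'rV[R]_n) (f g u : 'rV[R]_n -> R).

Lemma dotpC a b : dotp a b = dotp b a.
Proof. by apply: eq_bigr => i _; rewrite mulrC. Qed.

Lemma dotpDl a b v : dotp (a + b) v = dotp a v + dotp b v.
Proof. by rewrite -big_split; apply: eq_bigr => i _; rewrite mxE mulrDl. Qed.

Lemma dotpZl (c : R) a v : dotp (c *: a) v = c * dotp a v.
Proof. by rewrite mulr_sumr; apply: eq_bigr => i _; rewrite mxE mulrA. Qed.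

Lemma dotpDr a b v : dotp v (a + b) = dotp v a + dotp v b.
Proof. by rewrite dotpC dotpDl !(dotpC _ v). Qed.

Lemma dotpZr (c : R) a v : dotp v (c *: a) = c * dotp v a.
Proof. by rewrite dotpC dotpZl (dotpC a). Qed.

Lemma dotpNl a v : dotp (- a) v = - dotp a v.
Proof. by rewrite -scaleN1r dotpZl mulN1r. Qed.

Lemma dotpNr a v : dotp v (- a) = - dotp v a.
Proof. by rewrite dotpC dotpNl dotpC. Qed.

Lemma dotpBl a b v : dotp (a - b) v = dotp a v - dotp b v.
Proof. by rewrite dotpDl dotpNl. Qed.

Lemma dotp0l v : dotp 0 v = 0.
Proof. by rewrite -(scale0r 0) dotpZl mul0r. Qed.

Lemma dotp_delta (i : 'I_n) a : dotp a (delta_mx 0 i) = a ord0 i.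
Proof.
rewrite /dotp (bigD1 i)//= mxE !eqxx mulr1 big1 ?addr0// => j ji.
by rewrite mxE (negbTE ji) andbF mulr0.
Qed.

Lemma normr_dotp_le a b : `|dotp a b| <= n%:R * (`|a| * `|b|).
Proof.
apply: (le_trans (ler_norm_sum _ _ _)).
rewrite -[n in n%:R]card_ord -sum1_card natr_sum mulr_suml; apply: ler_sum => i _.
by rewrite mul1r normrM ler_pM// norm_coord.
Qed.

Lemma grad_coord f x (i : 'I_n) : grad f x ord0 i = partial i f x.
Proof. by rewrite mxE. Qed.

Lemma derive_dotp f x v : differentiable f x -> 'D_v f x = dotp (grad f x) v.
Proof.
move=> df; rewrite deriveE// [in LHS](row_sum_delta v) linear_sum /dotp.
apply: eq_bigr => i _; rewrite linearZ/= mxE /partial -deriveE//.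
by rewrite mulrC.
Qed.

Lemma is_derive_line f x v (t : R) : derivable f (x + t *: v) v ->
  is_derive t 1 (fun s => f (x + s *: v)) ('D_v f (x + t *: v)).
Proof.
have E : (fun h : R => h^-1 *: (((fun s => f (x + s *: v)) \o shift t) (h *: 1) - f (x + t *: v))) =
  (fun h : R => h^-1 *: ((f \o shift (x + t *: v)) (h *: v) - f (x + t *: v))).
  apply/funext => h /=; congr (_ *: (f _ - _)).
  by rewrite scalerDl addrCA -[h%:A]/(h * 1) mulr1.
move=> df; apply: DeriveDef; first by rewrite /derivable E.
by rewrite /derive E.
Qed.

Lemma MVT_rV f x y :
  (forall t : R, 0 <= t <= 1 -> differentiable f (x + t *: (y - x))) ->
  exists2 t : R, 0 <= t <= 1 &
    f y - f x = dotp (grad f (x + t *: (y - x))) (y - x).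
Proof.
move=> df; pose F (s : R) := f (x + s *: (y - x)).
have dF (s : R) : s \in `[0, 1] -> is_derive s 1 F (dotp (grad f (x + s *: (y - x))) (y - x)).
  rewrite in_itv/= => /df dfs; rewrite -derive_dotp//.
  by apply: is_derive_line; exact: diff_derivable.
pose D (s : R) := dotp (grad f (x + s *: (y - x))) (y - x).
have H1 (s : R) : s \in `]0, 1[ -> is_derive s 1 F (D s).
  by move=> s01; apply: dF; exact: subset_itv_oo_cc.
have H2 : {within `[0, 1], continuous F}.
  by apply: derivable_within_continuous => s s01; have [] := dF _ s01.
have [t t01] := MVT_segment ler01 H1 H2.
rewrite /F scale1r scale0r addr0 subr0 mulr1 addrCA subrr addr0 => E.
  by exists t => //; rewrite in_itv/= in t01.
Qed.

Lemma line_near x y (t r : R) c : 0 <= t <= 1 -> `|x - c| < r -> `|y - c| < r ->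
  `|x + t *: (y - x) - c| < r.
Proof.
move=> /andP[t0 t1] xr yr.
have -> : x + t *: (y - x) - c = (1 - t) *: (x - c) + t *: (y - c).
  by apply/rowP => i; rewrite !mxE; ring.
apply: (le_lt_trans (ler_normD _ _)); rewrite !normrZ (ger0_norm t0).
rewrite [`|1 - t|]ger0_norm ?subr_ge0//.
have [->|tn0] := eqVneq t 0; first by rewrite subr0 mul1r mul0r addr0.
have tp : 0 < t by rewrite lt_neqAle eq_sym tn0.
have h1 : (1 - t) * `|x - c| <= (1 - t) * r by rewrite ler_wpM2l ?subr_ge0// ltW.
have h2 : t * `|y - c| < t * r by rewrite ltr_pM2l.
lra.
Qed.

Lemma open_ball_norm (Omega : set 'rV[R]_n) x : open Omega -> Omega x ->
  exists2 r : R, 0 < r & forall y, `|y - x| < r -> Omega y.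
Proof.
move=> oO Ox; have /nbhs_ballP[r /= r0 hr] := open_nbhs_nbhs (conj oO Ox).
by exists r => // y yr; apply: hr; rewrite mx_norm_ball /ball_/= distrC.
Qed.

(** Continuity of the gradient makes u strictly differentiable: the mean value
    theorem on the segment from z to y, with both end points moving. *)
Lemma C1_strict (Omega : set 'rV[R]_n) u x (e : R) : open Omega -> C1 Omega u ->
  Omega x -> 0 < e ->
  exists2 r : R, 0 < r & forall y z, `|y - x| < r -> `|z - x| < r ->
    `|u y - u z - dotp (grad u x) (y - z)| <= e * `|y - z|.
Proof.
move=> oO [du cu] Ox e0.
have [r1 r10 hr1] := open_ball_norm oO Ox.
have e'0 : 0 < e / n.+1%:R by rewrite divr_gt0.
have : grad u z @[z --> x] --> grad u x.
  by move: cu; rewrite continuous_open_subspace// => /(_ x); rewrite inE; exact.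
move=> /cvgrPdist_lt /(_ _ e'0) /nbhs_ballP[r2 /= r20 hr2].
exists (Num.min r1 r2); first by rewrite lt_min r10.
move=> y z; rewrite !lt_min => /andP[y1 y2] /andP[z1 z2].
have dul t : 0 <= t <= 1 -> differentiable u (z + t *: (y - z)).
  by move=> t01; apply: du; apply: hr1; exact: line_near.
have [t t01 ->] := MVT_rV dul.
rewrite -dotpBl; apply: (le_trans (normr_dotp_le _ _)).
have /hr2/= /ltW : ball x r2 (z + t *: (y - z)).
  by rewrite mx_norm_ball /ball_/= distrC line_near.
rewrite distrC => h; rewrite mulrA ler_wpM2r//.
apply: (le_trans (ler_wpM2l _ h)) => //.
by rewrite mulrCA ler_piMr ?ltW// ltr_pdivrMr// mul1r ltr_nat.
Qed.

End calculus.

(** * Smooth bump functions supported in cubes *)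

Section bump1.
Context {R : realType}.

(** The flat function exp (- 1/w). The factor w ^- k is there because each
    derivation produces such a factor. *)
Definition theta (k : nat) (w : R) : R :=
  if 0 < w then w^-1 ^+ k * expR (- w^-1) else 0.

Lemma theta_ge0 k w : 0 <= theta k w.
Proof.
rewrite /theta; case: ifPn => // w0.
by rewrite mulr_ge0 ?expR_ge0// exprn_ge0// invr_ge0 ltW.
Qed.

Lemma theta0_gt0 (w : R) : 0 < w -> 0 < theta 0 w.
Proof. by move=> w0; rewrite /theta w0 mulr_gt0 ?expR_gt0// expr0. Qed.

Lemma theta_mulr k w : w * theta k.+1 w = theta k w.
Proof.
rewrite /theta; case: ifPn => [w0|_]; last by rewrite mulr0.
by rewrite mulrA exprS mulrA divff ?mul1r// gt_eqF.
Qed.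

(** One term of the exponential series at 1/w. Vanishing to second order at 0
    is what makes theta k differentiable there. *)
Lemma theta_le_sqr k w : theta k w <= k.+2`!%:R * w ^+ 2.
Proof.
rewrite /theta; case: ifPn => [w0|_]; last by rewrite mulr_ge0// sqr_ge0.
have iw0 : 0 <= w^-1 by rewrite invr_ge0 ltW.
rewrite expRN -ler_pdivlMr ?invr_gt0 ?expR_gt0// invrK.
have h : w^-1 ^+ k.+2 <= k.+2`!%:R * expR w^-1.
  rewrite -ler_pdivrMl ?ltr0n ?fact_gt0// mulrC.
  by apply: (le_trans _ (expR_ge1Dxn k.+1 iw0)); rewrite lerDr.
have : w ^+ 2 * w^-1 ^+ k.+2 <= w ^+ 2 * (k.+2`!%:R * expR w^-1).
  by rewrite ler_wpM2l// sqr_ge0.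
rewrite -[k.+2]addn2 exprD mulrCA -exprMn divff ?gt_eqF// expr1n mulr1.
by rewrite mulrA (mulrC (w ^+ 2)).
Qed.

Lemma is_derive0_quadratic (f : R -> R) (a C : R) :
  (forall y, `|f y| <= C * (y - a) ^+ 2) -> is_derive a 1 f 0.
Proof.
move=> fC.
have fa : f a = 0.
  by apply/eqP; rewrite -normr_le0 (le_trans (fC a))// subrr expr0n mulr0.
have C0 : 0 <= C.
  by have := fC (a + 1); rewrite addrAC subrr add0r expr1n mulr1; apply: le_trans.
have cv : (fun h : R => h^-1 *: ((f \o shift a) (h *: 1) - f a)) @ 0^' --> (0 : R).
  apply/cvgr0Pnorm_le => e e0; near=> h.
  have h0 : h != 0 by near: h; exact: nbhs_dnbhs_neq.
  rewrite /= fa subr0 normrZ normfV.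
  rewrite ler_pdivrMl ?normr_gt0// (le_trans (fC _))//.
  rewrite addrK -[h%:A]/(h * 1) mulr1 -(real_normK (num_real h)) expr2 mulrCA ler_wpM2l//.
  have : `|h| < e / (C + 1).
    by near: h; apply: dnbhs0_lt; rewrite divr_gt0// ltr_wpDl.
  rewrite ltr_pdivlMr ?ltr_wpDl// => /ltW; apply: le_trans.
  by rewrite mulrC ler_wpM2l// lerDl.
apply: DeriveDef; first by apply/cvg_ex; exists 0.
exact/cvg_lim.
Unshelve. all: by end_near. Qed.

Lemma is_derive_theta k (w : R) :
  is_derive w 1 (theta k) (theta k.+2 w - k%:R * theta k.+1 w).
Proof.
case: (ltgtP w 0) => w0.
- have -> : theta k.+2 w - k%:R * theta k.+1 w = 0.
    by rewrite /theta ltNge ltW//= mulr0 subr0.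
  apply: (@near_eq_is_derive _ _ _ (cst 0)).
    near=> y; rewrite /theta ltNge; suff -> : y <= 0 by [].
    by apply: ltW; near: y; exact: (open_nbhs_nbhs (conj (@open_lt R 0) w0)).
- have wn0 : w != 0 by rewrite gt_eqF.
  have d1 : is_derive w 1 (fun y : R => y^-1) (- w ^- 2 *: 1).
    by apply: is_deriveV => //; exact: is_derive_id.
  have d2 := is_deriveX k d1.
  have d3 : is_derive w 1 (fun y : R => - y^-1) (- (- w ^- 2 *: 1)) by exact: is_deriveN.
  have d4 := @is_derive1_comp _ expR (fun y : R => - y^-1) w _ _ (is_derive_expR _) d3.
  have d5 := is_deriveM d2 d4.
  have d6 : is_derive w 1 (fun y : R => y^-1 ^+ k * expR (- y^-1))
      (theta k.+2 w - k%:R * theta k.+1 w).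
    have -> : (fun y : R => y^-1 ^+ k * expR (- y^-1)) =
      ((fun y : R => y^-1) ^+ k * (expR \o (fun y : R => - y^-1)))%R.
      by apply/funext => y; rewrite [RHS]/GRing.mul/= exprfctE.
    apply: (is_derive_eq d5).
    rewrite /theta w0 /= -!exprVn /GRing.scale/= !mulr1.
    set i := w^-1; set E := expR _.
    rewrite exprfctE -/i; clear.
    by case: k => [|k] /=; rewrite ?mul0r ?exprS ?expr0 ?expr1; ring.
  apply: near_eq_is_derive d6.
  near=> y; rewrite /theta; suff -> : 0 < y by [].
  by near: y; exact: (open_nbhs_nbhs (conj (@open_gt R 0) w0)).
- have -> : theta k.+2 w - k%:R * theta k.+1 w = 0.
    by rewrite /theta w0 ltxx mulr0 subr0.
  rewrite w0; apply: (@is_derive0_quadratic _ _ k.+2`!%:R) => y.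
  by rewrite subr0 ger0_norm ?theta_ge0//; exact: theta_le_sqr.
Unshelve. all: by end_near. Qed.

(** Functions of this shape are stable under derivation: theta_mulr turns
    theta k into W times theta k.+1, so the two terms of the product rule can
    be brought to a common index. *)
Definition bump1 (k : nat) (W P : {poly R}) (x : R) : R := theta k W.[x] * P.[x].

Lemma is_derive_bump1 k (W P : {poly R}) (x : R) : is_derive x 1 (bump1 k W P)
  (bump1 k.+2 W (W^`() * P * (1 - k%:R *: W) + W ^+ 2 * P^`()) x).
Proof.
have dW : is_derive x 1 (horner W) W^`().[x].
  by apply: DeriveDef; [exact: derivable_horner|rewrite derivE derive1E].
have dP : is_derive x 1 (horner P) P^`().[x].
  by apply: DeriveDef; [exact: derivable_horner|rewrite derivE derive1E].
have d1 := @is_derive1_comp _ (theta k) (horner W) x _ _ (is_derive_theta k _) dW.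
have d2 := is_deriveM d1 dP.
have -> : bump1 k W P = ((theta k \o horner W) * horner P)%R by apply/funext.
apply: (is_derive_eq d2).
rewrite /bump1 !hornerE /GRing.scale/=.
rewrite -[theta k W.[x]]theta_mulr -[theta k.+1 W.[x]]theta_mulr.
ring.
Qed.

(** Smoothness is encoded by membership in a class of functions stable under
    derivation. Such classes pass to products over the coordinates, and Ck k
    then follows by a single induction on k. *)
Definition derivative_closed (S : set (R -> R)) := forall f, S f ->
  exists2 g, S g & forall x : R, is_derive x 1 f (g x).

Lemma derivative_closed_bump1 (W : {poly R}) : derivative_closed [set f | exists k P, f = bump1 k W P].
Proof.
move=> _ [k [P ->]].
exists (bump1 k.+2 W (W^`() * P * (1 - k%:R *: W) + W ^+ 2 * P^`())).
  by do 2 eexists.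
by move=> x; exact: is_derive_bump1.
Qed.

End bump1.

Section product.
Context {R : realType} {n : nat}.

Definition coord_prod (F : 'I_n -> R -> R) (x : 'rV[R]_n) : R := \prod_(i < n) F i (x ord0 i).

Lemma differentiable_coord_prod (F : 'I_n -> R -> R) (x : 'rV[R]_n) :
  (forall i, differentiable (F i) (x ord0 i)) -> differentiable (coord_prod F) x.
Proof.
move=> dF.
have -> : coord_prod F = (\prod_(i < n) (fun y : 'rV[R]_n => F i (y ord0 i)))%R.
  apply/funext => y; rewrite /coord_prod.
  elim/big_ind2 : _ => // f1 g1 f2 g2.
  by move=> -> ->.
elim/big_ind : _ => //.
- by move=> f g df dg; exact: differentiableM.
- move=> i _.
  apply: (@differentiable_comp _ _ _ _ (fun y : 'rV[R]_n => y ord0 i) (F i)) => //.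
  exact: differentiable_coord.
Qed.

Lemma partial_coord_prod (F : 'I_n -> R -> R) (i : 'I_n) (g : R -> R) (x : 'rV[R]_n) :
  is_derive (x ord0 i) 1 (F i) (g (x ord0 i)) -> differentiable (coord_prod F) x ->
  partial i (coord_prod F) x = coord_prod (fun j => if j == i then g else F j) x.
Proof.
move=> dF df; rewrite /partial.
have := @is_derive_line _ _ (coord_prod F) x (delta_mx 0 i) 0.
have dd : derivable (coord_prod F) x (delta_mx 0 i) by exact: diff_derivable.
rewrite scale0r addr0 => /(_ dd) [_ <-].
pose c := \prod_(j < n | j != i) F j (x ord0 j).
have -> : (fun s : R => coord_prod F (x + s *: delta_mx 0 i)) =
   (fun s : R => F i (s + x ord0 i) * c).
  apply/funext => s; rewrite /coord_prod (bigD1 i)//= !mxE !eqxx mulr1 addrC; congr (_ * _).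
  apply: eq_bigr => j ji; rewrite !mxE (negbTE ji) andbF mulr0 addr0 //.
have d1 : is_derive (0 : R) 1 (shift (x ord0 i)) 1 by exact: is_derive_shift.
have d2 : is_derive (0 : R) 1 (F i \o shift (x ord0 i)) (g (x ord0 i) * 1).
  by apply: is_derive1_comp; rewrite /= add0r.
have d3 : is_derive (0 : R) 1 ((F i \o shift (x ord0 i)) * cst c)%R
    (c * g (x ord0 i)).
  have d0 := @is_derive_cst R R R c 0 1.
  have d4 := is_deriveM d2 d0.
  apply: (is_derive_eq d4); rewrite /=.
  by rewrite scaler0 add0r mulr1.
have -> : (fun s : R => F i (s + x ord0 i) * c) = ((F i \o shift (x ord0 i)) * cst c)%R.
  by apply/funext.
rewrite derive_val /coord_prod (bigD1 i)//= eqxx mulrC; congr (_ * _).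
by apply: eq_bigr => j /negbTE ->.
Qed.

(** A partial derivative of a product over coordinates is again one, with one
    factor replaced by its derivative; the induction therefore runs over all
    families F at once. *)
Lemma Ck_coord_prod (S : 'I_n -> set (R -> R)) (F : 'I_n -> R -> R) k :
  (forall i, derivative_closed (S i)) -> (forall i, S i (F i)) -> Ck k (coord_prod F).
Proof.
move=> hS; elim: k F => [|k IH] F SF.
- move=> x; apply: differentiable_continuous; apply: differentiable_coord_prod => i.
  have [g _ dg] := hS i _ (SF i); apply/derivable1_diffP.
  by have [] := dg (x ord0 i).
- have dF x : differentiable (coord_prod F) x.
    apply: differentiable_coord_prod => i.
    have [g _ dg] := hS i _ (SF i); apply/derivable1_diffP.
    by have [] := dg (x ord0 i).
  split => // i; have [g Sg dg] := hS i _ (SF i).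
  have -> : partial i (coord_prod F) = coord_prod (fun j => if j == i then g else F j).
    by apply/funext => x; exact: partial_coord_prod.
  by apply: IH => j; case: eqP => [->|].
Qed.

End product.

Section bump.
Context {R : realType} {n : nat}.

Definition bump_poly (c rho : R) : {poly R} := 1 - ((rho^-1)%:P * ('X - c%:P)) ^+ 2.

(** A product over coordinates rather than a radial function: the support is
    then a cube and fits into dyadic cubes. *)
Definition bump (c : 'rV[R]_n) (rho : R) : 'rV[R]_n -> R :=
  coord_prod (fun i => bump1 0 (bump_poly (c ord0 i) rho) 1).

Lemma bump_polyE (c rho x : R) : (bump_poly c rho).[x] = 1 - ((x - c) / rho) ^+ 2.
Proof. by rewrite /bump_poly !hornerE mulrC. Qed.

Lemma bumpE c rho x : bump c rho x = \prod_(i < n) theta 0 (1 - ((x ord0 i - c ord0 i) / rho) ^+ 2).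
Proof. by apply: eq_bigr => i _; rewrite /bump1 bump_polyE hornerE mulr1. Qed.

Lemma Ck_bump k c rho : Ck k (bump c rho).
Proof.
apply: (@Ck_coord_prod _ _ (fun i => [set f | exists k P, f = bump1 k (bump_poly (c ord0 i) rho) P])) => i.
  exact: derivative_closed_bump1.
by exists 0%N, 1.
Qed.

Lemma bump_ge0 c rho x : 0 <= bump c rho x.
Proof. by rewrite bumpE; apply: prodr_ge0 => i _; exact: theta_ge0. Qed.

Lemma theta0_le1 (w : R) : theta 0 w <= 1.
Proof.
rewrite /theta; case: ifPn => // w0.
by rewrite expr0 mul1r expR_le1 oppr_le0 invr_ge0 ltW.
Qed.

Lemma theta0_mono (v w : R) : v <= w -> theta 0 v <= theta 0 w.
Proof.
move=> vw; rewrite {1}/theta; case: ifPn => v0; last exact: theta_ge0.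
have w0 := lt_le_trans v0 vw.
by rewrite /theta w0 !expr0 !mul1r ler_expR lerN2 lef_pV2.
Qed.

Lemma bump_le1 c rho x : bump c rho x <= 1.
Proof.
by rewrite bumpE; apply: prodr_ile1 => i _; rewrite theta_ge0 theta0_le1.
Qed.

Lemma bump_out c rho x : 0 < rho -> rho <= `|x - c| -> bump c rho x = 0.
Proof.
move=> r0; rewrite leNgt => /negP h; rewrite bumpE.
have [i hi] : exists i, rho <= `|x ord0 i - c ord0 i|.
  apply: contrapT => /forallNP hn; apply: h; apply: norm_rV_lt => // i.
  by rewrite !mxE ltNge; apply/negP/hn.
have q1 : 1 <= `|(x ord0 i - c ord0 i) / rho|.
  by rewrite normrM normfV (gtr0_norm r0) ler_pdivlMr// mul1r.
rewrite (bigD1 i)//= /theta subr_gt0 -real_normK ?num_real// ltNge.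
by rewrite exprn_ege1// mul0r.
Qed.

Lemma bump_lb c rho x : 0 < rho -> `|x - c| <= rho / 2 ->
  theta 0 (3 / 4) ^+ n <= bump c rho x.
Proof.
move=> r0 xc; rewrite bumpE -[n in _ ^+ n]card_ord -prodr_const.
apply: ler_prod => i _; rewrite theta_ge0 theta0_mono//.
have q1 : `|(x ord0 i - c ord0 i) / rho| <= 2^-1.
  rewrite normrM normfV (gtr0_norm r0) ler_pdivrMr// mulrC.
  by have := norm_coord (x - c) i; rewrite !mxE => /le_trans; apply.
have q0 : 0 <= `|(x ord0 i - c ord0 i) / rho| by [].
rewrite -[X in _ <= 1 - X]real_normK ?num_real//.
nra.
Qed.

Lemma bump_center c rho : bump c rho c = theta 0 1 ^+ n.
Proof.
rewrite bumpE (eq_bigr (fun=> theta 0 1)) => [|i _].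
  by rewrite prodr_const card_ord.
by rewrite subrr mul0r expr0n subr0.
Qed.

Lemma closed_cube (c : 'rV[R]_n) (rho : R) : closed [set y : 'rV[R]_n | `|y - c| <= rho].
Proof.
have -> : [set y : 'rV[R]_n | `|y - c| <= rho] =
  (fun y : 'rV[R]_n => `|y - c|) @^-1` [set t | t <= rho] by [].
apply: preimage_closed; last exact: closed_le.
move=> y _; apply: continuous_comp; last exact: norm_continuous.
have : differentiable (fun y : 'rV[R]_n => y - c) y by exact: differentiableB.
exact: differentiable_continuous.
Qed.

Lemma compact_cube (c : 'rV[R]_n) (rho : R) : compact [set y : 'rV[R]_n | `|y - c| <= rho].
Proof.
apply: bounded_closed_compact; last exact: closed_cube.
exists (rho + `|c|); split; first exact: num_real.
move=> M hM y /= yc; rewrite -[y](subrK c) (le_trans (ler_normD _ _))//.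
by apply: le_trans (ltW hM); rewrite lerD2r.
Qed.

Lemma bump_le_center c rho x : bump c rho x <= bump c rho c.
Proof.
rewrite !bumpE; apply: ler_prod => i _; rewrite theta_ge0 theta0_mono//.
by rewrite subrr mul0r expr0n subr0 gerBl sqr_ge0.
Qed.

Lemma bump_center_gt0 c rho : 0 < bump c rho c.
Proof.
by rewrite bump_center exprn_gt0// theta0_gt0.
Qed.

End bump.

(** * Integration by parts and weak gradients *)

Section integration.
Context {R : realType} {n : nat}.
Notation X := (caratheodory_type (@lebesgue_outer_measure R n)).
Notation mu := (@lebesgue_rV R n).
Implicit Types (f g u v phi : 'rV[R]_n -> R) (x y z zeta : 'rV[R]_n).

Lemma measurable_shift (h : 'rV[R]_n) (A : set X) : measurable A ->
  measurable ((fun x : 'rV[R]_n => x + h) @^-1` A : set X).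
Proof.
move=> mA; suff: caratheodory_measurable (@lebesgue_outer R n)
    ((fun x : 'rV[R]_n => x + h) @^-1` A) by [].
move=> Y; have := mA ((fun x => x - h) @^-1` Y).
have E B : lebesgue_outer ((fun x : 'rV[R]_n => x - h) @^-1` B) = lebesgue_outer B.
  by rewrite lebesgue_outer_shift.
move=> H; rewrite -(E Y) -(E (Y `&` _)) -(E (Y `&` ~` _)).
have EA B : (fun x : 'rV[R]_n => x - h) @^-1` ((fun x : 'rV[R]_n => x + h) @^-1` B) = B.
  by apply/seteqP; split => x /=; rewrite subrK.
by rewrite !preimage_setI preimage_setC !EA; exact: H.
Qed.

Lemma measurable_fun_shift (h : 'rV[R]_n) :
  measurable_fun (setT : set X) ((fun x => x + h) : X -> X).
Proof. by move=> _ A mA; rewrite setTI; exact: measurable_shift. Qed.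

Lemma integral_shift (h : 'rV[R]_n) (f : X -> R) : measurable_fun setT f ->
  mu.-integrable setT (fun x => (f (x + h))%:E) ->
  (\int[mu]_x (f (x + h)%R)%:E = \int[mu]_x (f x)%:E)%E.
Proof.
move=> mf fi.
have E (A : set X) : measurable A -> A `<=` setT ->
    mu A = pushforward mu ((fun x => x + h) : X -> X) A.
  by move=> mA _; rewrite /pushforward; apply/esym; exact: lebesgue_outer_shift.
pose m' := measure_function_pushforward__canonical__measure_function_Measure
  mu (measurable_fun_shift h).
have mf' : measurable_fun setT (EFin \o f) by exact/measurable_EFinP.
transitivity (\int[m']_x (f x)%:E)%E.
  by rewrite (@integral_pushforward _ _ _ _ _ _ (measurable_fun_shift h) mu setT _ mf' fi).
by apply/esym; apply: eq_measure_integral.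
Qed.

Lemma open_continuous_measurable (U : set X) f : open (U : set 'rV[R]_n) ->
  {within U, continuous f} -> measurable_fun U f.
Proof.
move=> oU; rewrite continuous_open_subspace// continuous_inP// => cf.
apply: (measurability _ (RGenOInfty.measurableE R)) => _ [_ [a ->] <-].
by apply: open_measurable_rV; apply: cf; exact: interval_open.
Qed.

Lemma compact_measurable_rV (K : set X) : compact (K : set 'rV[R]_n) -> measurable K.
Proof.
move=> cK; apply: closed_measurable_rV; apply: compact_closed => //.
Qed.

Lemma compact_sub_box (K : set 'rV[R]_n) : compact K -> exists2 r : R, 0 < r & K `<=` box r.
Proof.
move=> /compact_bounded[M [_ hM]]; exists (`|M| + 2); first by rewrite ltr_wpDl.
move=> x Kx; apply: (@le_lt_trans _ _ (`|M| + 1)); last by rewrite ltrD2l ltr1n.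
by apply: (hM (`|M| + 1)) => //; rewrite ltr_pwDr// ler_norm.
Qed.

Lemma compact_measure_lty (K : set 'rV[R]_n) : compact K -> (mu K < +oo)%E.
Proof.
move=> /compact_sub_box[r _ Kr].
exact: le_lt_trans (le_outer_measure _ _ _ Kr) (lebesgue_box_lty r).
Qed.

Lemma measurable_box r : measurable (box r : set X).
Proof. by apply: open_measurable_rV; exact: open_box. Qed.

Lemma continuous_bounded_on_compact (U K : set 'rV[R]_n) f : open U ->
  {within U, continuous f} -> compact K -> K `<=` U ->
  exists2 M : R, 0 <= M & forall x, K x -> `|f x| <= M.
Proof.
move=> oU cf cK KU.
have : compact (f @` K).
  apply: continuous_compact => //; exact: continuous_subspaceW cf.
move=> /compact_bounded[M [_ hM]]; exists (`|M| + 1); first by rewrite addr_ge0.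
move=> x Kx; apply: (hM (`|M| + 1)); first by rewrite ltr_pwDr// ler_norm.
by exists x.
Qed.

Lemma continuous_compact_support_bounded (K : set 'rV[R]_n) f : continuous f ->
  compact K -> (forall x, ~ K x -> f x = 0) ->
  exists2 M : R, 0 <= M & forall x, `|f x| <= M.
Proof.
move=> cf cK f0.
have [|M M0 hM] := @continuous_bounded_on_compact setT K f openT _ cK (@subsetT _ _).
  exact: continuous_subspaceT.
exists M => // x; have [/hM//|/f0 ->] := pselect (K x); by rewrite normr0.
Qed.

Lemma continuous_measurable_rV f (D : set X) : measurable D -> continuous f -> measurable_fun D f.
Proof.
move=> mD cf; apply: (@measurable_funS _ _ _ _ setT) => //.
apply: open_continuous_measurable; first exact: openT.
exact: continuous_subspaceT.
Qed.

Lemma Rintegral_support (D B : set X) f : B `<=` D -> (forall x, D x -> ~ B x -> f x = 0) ->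
  \int[mu]_(x in D) f x = \int[mu]_(x in B) f x.
Proof.
move=> BD f0; rewrite [LHS]Rintegral_mkcond [RHS]Rintegral_mkcond.
congr (Rintegral _ _ _); apply/funext => x; rewrite /patch.
have [xB|xB] := boolP (x \in B).
  by rewrite mem_set//; apply: BD; exact: set_mem.
case: ifPn => // xD; apply: f0; first exact: set_mem.
by move=> /mem_set; apply/negP.
Qed.

Lemma integral_support (D B : set X) (f : X -> \bar R) : B `<=` D ->
  (forall x, D x -> ~ B x -> f x = 0%E) ->
  (\int[mu]_(x in D) f x = \int[mu]_(x in B) f x)%E.
Proof.
move=> BD f0; rewrite [LHS]integral_mkcond [RHS]integral_mkcond.
congr (integral _ _ _); apply/funext => x; rewrite /patch.
have [xB|xB] := boolP (x \in B).
  by rewrite mem_set//; apply: BD; exact: set_mem.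
case: ifPn => // xD; apply: f0; first exact: set_mem.
by move=> /mem_set; apply/negP.
Qed.

Lemma integrable_compact_support (K : set X) f : continuous f -> compact (K : set 'rV[R]_n) ->
  (forall x, ~ K x -> f x = 0) -> mu.-integrable setT (EFin \o (f : X -> R)).
Proof.
move=> cf cK f0; have [M M0 hM] := continuous_compact_support_bounded cf cK f0.
have mK := compact_measurable_rV cK.
have : mu.-integrable K (EFin \o (f : X -> R)).
  apply: measurable_bounded_integrable => //.
  - exact: compact_measure_lty.
  - exact: continuous_measurable_rV.
  - exists M; split; first exact: num_real.
    by move=> M' /ltW MM' x _; exact: le_trans (hM x) MM'.
move=> /(integrable_mkcond _ mK); apply: eq_integrable => // x _ /=.
rewrite /patch; case: ifPn => // xK; rewrite f0//.
by move=> /mem_set; apply/negP.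
Qed.

Lemma differentiable_continuousT f : (forall x, differentiable f x) -> continuous f.
Proof. by move=> df x; exact: differentiable_continuous. Qed.

Lemma continuous_rV_shift h : continuous (fun y : 'rV[R]_n => y + h).
Proof.
move=> y; apply: differentiable_continuous.
exact: differentiableD.
Qed.

Lemma partial_support (K : set 'rV[R]_n) f i : closed K -> (forall x, ~ K x -> f x = 0) ->
  forall x, ~ K x -> partial i f x = 0.
Proof.
move=> cK f0 x nKx; rewrite /partial (@near_eq_derive _ _ _ f (cst 0)) ?derive_cst//.
have oK : open (~` K) by rewrite openC.
by near=> y; apply: f0; near: y; exact: open_nbhs_nbhs (conj oK nKx).
Unshelve. all: by end_near. Qed.

Lemma continuous_derive f zeta :
  (forall x, differentiable f x) -> (forall i, continuous (partial i f)) ->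
  continuous ('D_zeta f).
Proof.
move=> df cf.
have -> : 'D_zeta f = (fun x => \sum_(i < n) partial i f x * zeta ord0 i).
  apply/funext => x; rewrite derive_dotp//.
  by apply: eq_bigr => i _; rewrite grad_coord.
apply: continuous_big => [|i _ x]; first exact: add_continuous.
by apply: continuousM; [exact: cf|exact: cst_continuous].
Qed.

Lemma derive_support (K : set 'rV[R]_n) f zeta : (forall x, differentiable f x) ->
  closed K -> (forall x, ~ K x -> f x = 0) -> forall x, ~ K x -> 'D_zeta f x = 0.
Proof.
move=> df cK f0 x Kx; rewrite derive_dotp// /dotp big1// => i _.
by rewrite grad_coord (partial_support i cK f0)// mul0r.
Qed.

Lemma continuous_partials_bounded (K : set 'rV[R]_n) f zeta :
  (forall x, differentiable f x) -> (forall i, continuous (partial i f)) ->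
  compact K -> (forall x, ~ K x -> f x = 0) ->
  exists2 M : R, 0 <= M & forall x, `|'D_zeta f x| <= M.
Proof.
move=> df cf cK f0; apply: (continuous_compact_support_bounded _ cK).
  exact: continuous_derive.
have cKc : closed K by apply: compact_closed.
exact: derive_support.
Qed.

(** Differentiation under the integral sign; the derivative of the integrand
    is dominated by M1 * |v|, which is integrable. *)
Lemma is_derive_mollify (B : set X) v phi (M0 M1 : R) z zeta (a : R) :
  measurable B -> mu.-integrable B (EFin \o (v : X -> R)) ->
  (forall x, differentiable phi x) ->
  (forall x, `|phi x| <= M0) -> (forall x, `|'D_zeta phi x| <= M1) ->
  is_derive a 1 (fun t : R => \int[mu]_(y in B) (v y * phi (y - z + t *: zeta)))
    (\int[mu]_(y in B) (v y * 'D_zeta phi (y - z + a *: zeta))).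
Proof.
move=> mB vi dphi hM0 hM1.
have M10 : 0 <= M1 by exact: le_trans (hM1 0).
pose F (t : R) (y : X) : R := v y * phi (y - z + t *: zeta).
have cF t : continuous (fun y : 'rV[R]_n => phi (y - z + t *: zeta)).
  have -> : (fun y : 'rV[R]_n => phi (y - z + t *: zeta)) = phi \o (fun y => y + (- z + t *: zeta)).
    by apply/funext => y /=; rewrite addrA.
  move=> y; apply: continuous_comp; first exact: continuous_rV_shift.
  exact: differentiable_continuousT.
have intF t : mu.-integrable B (EFin \o F t).
  have := @integrableMl _ _ _ mu B mB (EFin \o (v : X -> R)) (fun y => phi (y - z + t *: zeta)) vi.
  apply; first exact: continuous_measurable_rV.
  exists M0; split; first exact: num_real.
  by move=> M' /ltW MM' x _; exact: le_trans (hM0 _) MM'.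
have dF (t : R) y : is_derive t 1 (F ^~ y) (v y * 'D_zeta phi (y - z + t *: zeta)).
  have d1 : is_derive t 1 (fun s => phi (y - z + s *: zeta)) ('D_zeta phi (y - z + t *: zeta)).
    by apply: is_derive_line; exact: diff_derivable.
  have d2 := is_deriveZ (v y) d1.
  have -> : F ^~ y = v y \*: (fun s : R => phi (y - z + s *: zeta)) by apply/funext.
  exact: d2.
have intG : mu.-integrable B (EFin \o (fun y : X => `|v y| * M1)).
  rewrite (_ : EFin \o _ = (fun y : X => (M1%:E * (abse \o (EFin \o (v : X -> R))) y)%E)).
    by apply: integrableZl => //; exact: integrable_abse.
  by apply/funext => y; rewrite /= mulrC EFinM.
have Ia : `](a - 1), (a + 1)[%classic a by rewrite /= in_itv /= ltrBlDr ltrDl ltr01.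
have E1 : forall (t : R) y, partial1of2 F t y = v y * 'D_zeta phi (y - z + t *: zeta).
  by move=> t y; rewrite partial1of2E; have [_ ->] := dF t y.
have H1 : forall (t : R) y, `](a - 1), (a + 1)[%classic t -> B y -> derivable (F ^~ y) t 1.
  by move=> t y _ _; have [] := dF t y.
have H2 : forall (t : R) y, `](a - 1), (a + 1)[%classic t -> B y -> `|partial1of2 F t y| <= `|v y| * M1.
  by move=> t y _ _; rewrite E1 normrM ler_wpM2l.
have H0 : forall y : X, 0 <= `|v y| * M1 by move=> y; rewrite mulr_ge0.
have D1 := @derivable_under_integral _ _ X mu F B mB a _ _ Ia (fun t _ => intF t) H1 _ H0 intG H2.
have D2 := @differentiation_under_integral _ _ X mu F B mB a _ _ Ia (fun t _ => intF t) H1 _ H0 intG H2.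
apply: DeriveDef; first exact: D1.
rewrite -derive1E; apply: (etrans D2).
by apply: eq_Rintegral => y _; exact: E1.
Qed.

(** By translation invariance the integral of f (y + t e_i) does not depend on
    t, and its derivative at t = 0 is the integral of the partial derivative.
    The integral is taken over a box large enough for all shifts with |t| < 1,
    in order to apply is_derive_mollify with v = 1. *)
Lemma integral_partial0 (K : set 'rV[R]_n) f i :
  (forall x, differentiable f x) -> (forall j, continuous (partial j f)) ->
  compact K -> (forall x, ~ K x -> f x = 0) ->
  \int[mu]_x partial i f x = 0.
Proof.
move=> df cdf cK f0.
have [r r0 Kr] := compact_sub_box cK.
have [M0 M00 hM0] := continuous_compact_support_bounded (differentiable_continuousT df) cK f0.
have [M1 M10 hM1] := continuous_partials_bounded (delta_mx 0 i) df cdf cK f0.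
have mB := measurable_box (r + 1).
have iB : mu.-integrable (box (r + 1) : set X) (EFin \o (cst 1 : X -> R)).
  apply: measurable_bounded_integrable => //; first exact: lebesgue_box_lty.
  exact: bounded_cst.
have D := is_derive_mollify 0 0 mB iB df hM0 hM1.
have Ft (t : R) : `|t| < 1 -> \int[mu]_(y in box (r + 1))
    (cst 1 y * f (y - 0 + t *: delta_mx 0 i)) = \int[mu]_y f y.
  move=> t1.
  transitivity (\int[mu]_y f (y + t *: delta_mx 0 i)).
    apply/esym.
    rewrite (@Rintegral_support setT (box (r + 1))) => [| |y _ nb]; last 2 first.
    - exact: subsetT.
    - apply: f0 => /Kr; rewrite /box /= => h; apply: nb; rewrite /box /=.
      rewrite -[y](addrK (t *: delta_mx 0 i)) (le_lt_trans (ler_normB _ _))//.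
      apply: ltr_leD => //; apply: norm_rV_le => // j; rewrite !mxE normrM.
      by rewrite (le_trans _ (ltW t1))// ler_piMr// normr_nat lern1 leq_b1.
    by apply: eq_Rintegral => y _; rewrite mul1r subr0.
  have cfs : continuous (fun y : 'rV[R]_n => f (y + t *: delta_mx 0 i)).
    move=> y; apply: (@continuous_comp _ _ _ (fun y => y + t *: delta_mx 0 i) f).
      exact: continuous_rV_shift.
    exact: differentiable_continuousT.
  rewrite /Rintegral (@integral_shift (t *: delta_mx 0 i) f)//.
    by apply: continuous_measurable_rV => //; exact: differentiable_continuousT.
  apply: (@integrable_compact_support [set x | `|x - 0| <= r + 1] _ cfs).
    exact: compact_cube.
  move=> y /= nb; apply: f0 => /Kr; rewrite /box /= => h; apply: nb; rewrite subr0.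
  rewrite -[y](addrK (t *: delta_mx 0 i)) (le_trans (ler_normB _ _))//.
  apply: lerD; first exact: ltW.
  apply: norm_rV_le => // j; rewrite !mxE normrM.
  by rewrite (le_trans _ (ltW t1))// ler_piMr// normr_nat lern1 leq_b1.
have D0 : is_derive (0 : R) 1 (fun t : R => \int[mu]_(y in box (r + 1))
    (cst 1 y * f (y - 0 + t *: delta_mx 0 i))) 0.
  apply: (@near_eq_is_derive _ _ _ (cst (\int[mu]_y f y))).
  near=> t; rewrite Ft//.
have : \int[mu]_(y in box (r + 1)) (cst 1 y * 'D_(delta_mx 0 i) f (y - 0 + 0 *: delta_mx 0 i)) = 0.
  by have [_ <-] := D; have [_ ->] := D0.
move=> <-; rewrite (@Rintegral_support setT (box (r + 1))) => [| |y _ nb]; last 2 first.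
- exact: subsetT.
- have cKc : closed K by apply: compact_closed.
  apply: (partial_support i cKc f0) => /Kr h; apply: nb.
  by apply: lt_trans h _; rewrite ltrDl.
by apply: eq_Rintegral => y _; rewrite mul1r subr0 scale0r addr0.
Unshelve. all: by end_near. Qed.

Lemma integral_EFin (D : set X) f : mu.-integrable D (EFin \o (f : X -> R)) ->
  measurable D -> (\int[mu]_(x in D) (f x)%:E = (\int[mu]_(x in D) f x)%R%:E)%E.
Proof. by move=> fi mD; rewrite /Rintegral fineK//; exact: integrable_fin_num. Qed.

Lemma integrable_bounded_compact (K : set X) f (M : R) : compact (K : set 'rV[R]_n) ->
  measurable_fun K f -> (forall x, K x -> `|f x| <= M) ->
  mu.-integrable K (EFin \o (f : X -> R)).
Proof.
move=> cK mf hM; apply: measurable_bounded_integrable.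
- exact: compact_measurable_rV.
- exact: compact_measure_lty.
- exact: mf.
- exists M; split; first exact: num_real.
  by move=> M' /ltW MM' x Kx; exact: le_trans (hM x Kx) MM'.
Qed.

Lemma L2loc_continuous (Omega : set 'rV[R]_n) f : open Omega -> continuous f -> L2loc Omega f.
Proof.
move=> oO cf; split.
  by apply: open_continuous_measurable => //; exact: continuous_subspaceT.
move=> K cK _.
have mK := compact_measurable_rV cK.
have cf2 : continuous (fun x => f x ^+ 2).
  by move=> x; apply: (@continuous_comp _ _ _ f (fun t => t ^+ 2)); [exact: cf|exact: exprn_continuous].
have [M M0 hM] := continuous_bounded_on_compact openT (continuous_subspaceT cf2) cK (@subsetT _ _).
have : mu.-integrable K (EFin \o (fun x : X => f x ^+ 2)).
  apply: (integrable_bounded_compact cK _ hM).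
  exact: continuous_measurable_rV.
by move=> h; rewrite integral_EFin// ltry.
Qed.

(** Integration by parts: the product of w with a test function has compact
    support, so its partial derivatives have integral zero. *)
Lemma W12loc_C1 (Omega : set 'rV[R]_n) w : open Omega ->
  (forall x, differentiable w x) -> (forall i, continuous (partial i w)) ->
  W12loc_grad Omega w (grad w).
Proof.
move=> oO dw cw; split.
- by apply: L2loc_continuous => //; exact: differentiable_continuousT.
- move=> i; have -> : (fun x => grad w x ord0 i) = partial i w.
    by apply/funext => x; rewrite grad_coord.
  exact: L2loc_continuous.
move=> phi i [cphi [K [cK KO phi0]]].
have [dphi cdphi] := (cphi 1%N : Ck 1 phi).
have {}cdphi j : continuous (partial j phi) by exact: cdphi.
have cKc : closed K by apply: compact_closed.
have pphi0 := partial_support i cKc phi0.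
have cwT := differentiable_continuousT dw.
have cphiT := differentiable_continuousT dphi.
have i1 : mu.-integrable setT (EFin \o (fun x : X => w x * partial i phi x)).
  apply: (@integrable_compact_support K _ _ cK).
    by move=> x; apply: continuousM; [exact: cwT|exact: cdphi].
  by move=> x /pphi0 ->; rewrite mulr0.
have i2 : mu.-integrable setT (EFin \o (fun x : X => grad w x ord0 i * phi x)).
  apply: (@integrable_compact_support K _ _ cK).
    move=> x; apply: continuousM; last exact: cphiT.
    have -> : (fun x => grad w x ord0 i) = partial i w.
      by apply/funext => y; rewrite grad_coord.
    exact: cw.
  by move=> x /phi0 ->; rewrite mulr0.
have S1 : (\int[mu]_(x in Omega) (w x * partial i phi x)%:E = (\int[mu]_x (w x * partial i phi x))%:E)%E.
  rewrite -integral_EFin//; apply/esym; apply: integral_support => // x _ nO.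
  by rewrite pphi0 ?mulr0// => /KO.
have S2 : (\int[mu]_(x in Omega) (grad w x ord0 i * phi x)%:E = (\int[mu]_x (grad w x ord0 i * phi x))%:E)%E.
  rewrite -integral_EFin//; apply/esym; apply: integral_support => // x _ nO.
  by rewrite phi0 ?mulr0// => /KO.
rewrite S1 S2 -EFinN; congr (_%:E); apply/eqP; rewrite -subr_eq0 opprK; apply/eqP.
rewrite -RintegralD//.
have df x : differentiable (w * phi)%R x by exact: differentiableM.
have pE j : partial j (w * phi)%R = (fun x => w x * partial j phi x + grad w x ord0 j * phi x).
  apply/funext => x; rewrite /partial deriveM; [|exact: diff_derivable|exact: diff_derivable].
  by rewrite grad_coord /partial; congr (_ + _); rewrite mulrC.
rewrite -pE; apply: (@integral_partial0 K) => //.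
  move=> j; rewrite pE => x; apply: (@continuousD _ _ _
    (fun x => w x * partial j phi x) (fun x => grad w x ord0 j * phi x)); apply: continuousM.
  - exact: cwT.
  - exact: cdphi.
  - have -> : (fun x => grad w x ord0 j) = partial j w.
      by apply/funext => y; rewrite grad_coord.
    exact: cw.
  - exact: cphiT.
by move=> x /phi0 p0; rewrite -[LHS]/(w x * phi x) p0 mulr0.
Qed.

(** Local integrability, from |f| <= 1 + f ^+ 2. *)
Lemma L2loc_integrable (Omega : set 'rV[R]_n) f (K : set X) : open Omega -> L2loc Omega f ->
  compact (K : set 'rV[R]_n) -> K `<=` Omega -> mu.-integrable K (EFin \o (f : X -> R)).
Proof.
move=> oO [mf f2] cK KO.
have mK := compact_measurable_rV cK.
have mO : measurable (Omega : set X) by exact: open_measurable_rV.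
have mfK : measurable_fun K f by exact: measurable_funS mf.
have mf2 : measurable_fun K (fun x => f x ^+ 2) by exact: measurable_funX.
have i2 : mu.-integrable K (EFin \o (fun x : X => f x ^+ 2)).
  apply/integrableP; split; first exact/measurable_EFinP.
  rewrite (eq_integral (fun x : X => (f x ^+ 2)%:E)); first exact: f2.
  by move=> x _ /=; rewrite ger0_norm// sqr_ge0.
have i1 : mu.-integrable K (EFin \o (cst 1 : X -> R)).
  apply: measurable_bounded_integrable => //; first exact: compact_measure_lty.
  exact: bounded_cst.
have i3 := integrableD mK i1 i2.
apply: (le_integrable mK _ _ i3); first exact/measurable_EFinP.
move=> x _ /=; rewrite lee_fin [leRHS]ger0_norm; last by rewrite addr_ge0// sqr_ge0.
rewrite -[f x ^+ 2]real_normK ?num_real//.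
have : 0 <= `|f x| by []. nra.
Qed.

Lemma integrable_bounded_mul (K : set X) f (h : 'rV[R]_n -> R) (M : R) : measurable K ->
  mu.-integrable K (EFin \o (f : X -> R)) -> measurable_fun K h ->
  (forall x, `|h x| <= M) -> mu.-integrable K (EFin \o (fun x : X => f x * h x)).
Proof.
move=> mK fi mh hM; have := integrableMl mK fi mh; apply.
exists M; split; first exact: num_real.
by move=> M' /ltW MM' x _; exact: le_trans (hM _) MM'.
Qed.

Lemma integrable_cst_mul (K : set X) f (c : R) : measurable K ->
  mu.-integrable K (EFin \o (f : X -> R)) -> mu.-integrable K (EFin \o (fun x : X => f x * c)).
Proof.
move=> mK fi; apply: (@integrable_bounded_mul K f (cst c) `|c|) => //.
Qed.

Lemma Rintegral_sum (K : set X) (h : 'I_n -> 'rV[R]_n -> R) : measurable K ->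
  (forall i, mu.-integrable K (EFin \o (h i : X -> R))) ->
  \int[mu]_(x in K) (\sum_(i < n) h i x) = \sum_(i < n) \int[mu]_(x in K) h i x.
Proof.
move=> mK hi; rewrite /Rintegral.
under eq_integral do rewrite -sumEFin.
rewrite (@integral_sum _ _ _ mu K mK _ (fun i => EFin \o (h i : X -> R)))//.
by rewrite -sum_fine// => i _; exact: integrable_fin_num.
Qed.

Lemma weak_directional (Omega : set 'rV[R]_n) u (g : 'rV[R]_n -> 'rV[R]_n) phi (K : set X) zeta : open Omega ->
  W12loc_grad Omega u g -> (forall k, Ck k phi) -> compact (K : set 'rV[R]_n) ->
  K `<=` Omega -> (forall x, ~ K x -> phi x = 0) ->
  \int[mu]_(x in K) (u x * 'D_zeta phi x) = - \int[mu]_(x in K) (dotp (g x) zeta * phi x).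
Proof.
move=> oO [uL gL ug] cphi cK KO phi0.
have [dphi cdphi] := (cphi 1%N : Ck 1 phi).
have {}cdphi j : continuous (partial j phi) by exact: cdphi.
have cphiT := differentiable_continuousT dphi.
have cKc : closed K by apply: compact_closed.
have mK := compact_measurable_rV cK.
have [M0 M00 hM0] := continuous_compact_support_bounded cphiT cK phi0.
have tphi : test_function Omega phi by split => //; exists K.
have pphi0 i := partial_support i cKc phi0.
have i1 i : mu.-integrable K (EFin \o (fun x : X => u x * partial i phi x)).
  have [M1 M10 hM1] := continuous_compact_support_bounded (cdphi i) cK (pphi0 i).
  apply: (integrable_bounded_mul mK (L2loc_integrable oO uL cK KO) _ hM1).
  exact: continuous_measurable_rV.
have i2 i : mu.-integrable K (EFin \o (fun x : X => g x ord0 i * phi x)).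
  apply: (integrable_bounded_mul mK (L2loc_integrable oO (gL i) cK KO) _ hM0).
  exact: continuous_measurable_rV.
have E i : \int[mu]_(x in K) (u x * partial i phi x) = - \int[mu]_(x in K) (g x ord0 i * phi x).
  rewrite -(@Rintegral_support Omega K)//; last by move=> x _ /pphi0 ->; rewrite mulr0.
  rewrite -(@Rintegral_support Omega K)//; last by move=> x _ /phi0 ->; rewrite mulr0.
  by rewrite /Rintegral ug// fineN.
transitivity (\sum_(i < n) (\int[mu]_(x in K) (u x * partial i phi x)) * zeta ord0 i).
  under eq_bigr => i _ do rewrite -RintegralZr//.
  rewrite -Rintegral_sum//; last first.
    by move=> i; apply: (integrable_cst_mul _ mK (i1 i)).
  apply: eq_Rintegral => x _; rewrite derive_dotp// /dotp mulr_sumr.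
  by apply: eq_bigr => i _; rewrite grad_coord mulrA.
under eq_bigr => i _ do rewrite E mulNr -RintegralZr//.
rewrite sumrN -Rintegral_sum//; last first.
  by move=> i; apply: (integrable_cst_mul _ mK (i2 i)).
congr (- _); apply: eq_Rintegral => x _; rewrite /dotp mulr_suml.
by apply: eq_bigr => i _; rewrite mulrAC.
Qed.

End integration.

(** * Quadratic forms of matrices that need not be symmetric *)

Section quadratic.
Context {R : realType} {n : nat}.
Implicit Types (M N : 'M[R]_n) (a b p x y xi : 'rV[R]_n).

(** The bilinear form of the symmetric part of M, which is all that the
    quadratic form of M sees. *)
Definition sform M a b : R := 2^-1 * (dotp (a *m M^T) b + dotp (b *m M^T) a).

Lemma sformC M a b : sform M a b = sform M b a.
Proof. by rewrite /sform addrC. Qed.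

Lemma sformDl M a b p : sform M (a + b) p = sform M a p + sform M b p.
Proof. by rewrite /sform mulmxDl dotpDl dotpDr; ring. Qed.

Lemma sformZl M (c : R) a p : sform M (c *: a) p = c * sform M a p.
Proof. by rewrite /sform -scalemxAl dotpZl dotpZr; ring. Qed.

Lemma sformDr M a b p : sform M p (a + b) = sform M p a + sform M p b.
Proof. by rewrite sformC sformDl !(sformC _ p). Qed.

Lemma sformZr M (c : R) a p : sform M p (c *: a) = c * sform M p a.
Proof. by rewrite sformC sformZl sformC. Qed.

Lemma sformNl M a b : sform M (- a) b = - sform M a b.
Proof. by rewrite -scaleN1r sformZl mulN1r. Qed.

Lemma sformNr M a b : sform M a (- b) = - sform M a b.
Proof. by rewrite sformC sformNl sformC. Qed.

Lemma qform_sform M a : qform M a = sform M a a.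
Proof. by rewrite /sform /qform; field. Qed.

Lemma qformD M a b : qform M (a + b) = qform M a + 2 * sform M a b + qform M b.
Proof. by rewrite !qform_sform sformDl !sformDr (sformC M b a); ring. Qed.

Lemma qformZ M (c : R) a : qform M (c *: a) = c ^+ 2 * qform M a.
Proof. by rewrite !qform_sform sformZl sformZr; ring. Qed.

Lemma qformN M a : qform M (- a) = qform M a.
Proof. by rewrite -scaleN1r qformZ sqrrN expr1n mul1r. Qed.

Lemma qform0 M : qform M 0 = 0.
Proof. by rewrite -(scale0r 0) qformZ expr0n mul0r. Qed.

Lemma qform_subE M a b : qform M a - qform M b = sform M (a + b) (a - b).
Proof.
rewrite !qform_sform sformDl !sformDr !sformNr (sformC M b a); ring.
Qed.

(** The image of p under the symmetric part of M: half the gradient of the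
    quadratic form at p, and the direction in which a function with gradient p
    gains most for its intrinsic length. *)
Definition symapp M p : 'rV[R]_n := 2^-1 *: (p *m M^T + p *m M).

Lemma dotp_mulmxtr M a b : dotp (a *m M) b = dotp (b *m M^T) a.
Proof.
rewrite /dotp.
under eq_bigr => i _ do rewrite mxE mulr_suml.
rewrite exchange_big /=; apply: eq_bigr => i _; rewrite mxE mulr_suml.
by apply: eq_bigr => j _; rewrite mxE; ring.
Qed.

Lemma dotp_symapp M p a : dotp (symapp M p) a = sform M a p.
Proof.
by rewrite /symapp dotpZl dotpDl (dotp_mulmxtr M p a) /sform addrC.
Qed.

(** Cauchy-Schwarz. The form is nonnegative at - S a + A b, which gives the
    inequality after division by A; when A = 0 the vector - (B + 1) a + S b
    forces S = 0. *)
Lemma sform_CS M a b : (forall xi, 0 <= qform M xi) ->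
  sform M a b ^+ 2 <= qform M a * qform M b.
Proof.
move=> q0; set A := qform M a; set B := qform M b; set S := sform M a b.
have h (s t : R) : 0 <= s ^+ 2 * A + 2 * (s * t) * S + t ^+ 2 * B.
  have := q0 (s *: a + t *: b); rewrite qformD !qformZ sformZl sformZr -/S -/A -/B.
  by congr (_ <= _); ring.
have A0 : 0 <= A by exact: q0.
have B0 : 0 <= B by exact: q0.
have [A00|An0] := eqVneq A 0.
  have := h (- (B + 1)) S; rewrite A00 mulr0 add0r mul0r => hS.
  have S2 : 0 <= S ^+ 2 by exact: sqr_ge0.
  nra.
have := h (- S) A; have Ap : 0 < A by rewrite lt_neqAle eq_sym An0.
have -> : (- S) ^+ 2 * A + 2 * (- S * A) * S + A ^+ 2 * B = A * (A * B - S ^+ 2) by ring.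
by rewrite pmulr_rge0// subr_ge0.
Qed.

Lemma sform_le M a b : (forall xi, 0 <= qform M xi) ->
  `|sform M a b| <= Num.sqrt (qform M a) * Num.sqrt (qform M b).
Proof.
move=> q0; rewrite -sqrtrM// -sqrtr_sqr ler_sqrt ?mulr_ge0//.
exact: sform_CS.
Qed.

Lemma qform_lip M (C : R) a b : 0 <= C -> (forall xi, 0 <= qform M xi) ->
  (forall xi, qform M xi <= C * `|xi| ^+ 2) ->
  `|qform M a - qform M b| <= C * `|a + b| * `|a - b|.
Proof.
move=> C0 q0 qC; rewrite qform_subE; apply: (le_trans (sform_le _ _ q0)).
have E x : Num.sqrt (qform M x) <= Num.sqrt C * `|x|.
  by rewrite -[`|x|](ger0_norm (normr_ge0 _)) -sqrtr_sqr -sqrtrM// ler_sqrt ?mulr_ge0// sqr_ge0.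
apply: (le_trans (ler_pM _ _ (E _) (E _))); rewrite ?sqrtr_ge0//.
by rewrite mulrACA -expr2 sqr_sqrtr// mulrA.
Qed.

Lemma qform_entries M N (e : R) a : 0 <= e -> (forall i j, `|M i j - N i j| <= e) ->
  `|qform M a - qform N a| <= n%:R ^+ 2 * e * `|a| ^+ 2.
Proof.
move=> e0 h; rewrite /qform -dotpBl -mulmxBr.
apply: (le_trans (normr_dotp_le _ _)).
have -> : n%:R ^+ 2 * e * `|a| ^+ 2 = n%:R * ((n%:R * e * `|a|) * `|a|) by ring.
rewrite ler_wpM2l// ler_wpM2r//; apply: norm_rV_le => [|i].
  by rewrite !mulr_ge0.
rewrite mxE; apply: (le_trans (ler_norm_sum _ _ _)).
rewrite -[n in n%:R]card_ord -sum1_card natr_sum !mulr_suml; apply: ler_sum => j _.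
by rewrite mul1r normrM mulrC ler_pM// ?norm_coord// !mxE.
Qed.

Lemma dotp_ge0 a : 0 <= dotp a a.
Proof. by apply: sumr_ge0 => i _; rewrite -expr2 sqr_ge0. Qed.

Lemma enorm_sqr a : enorm a ^+ 2 = dotp a a.
Proof. by rewrite sqr_sqrtr// dotp_ge0. Qed.

Lemma norm_le_enorm a : `|a| <= enorm a.
Proof.
apply: norm_rV_le => [|i]; first exact: sqrtr_ge0.
rewrite -sqrtr_sqr ler_sqrt ?dotp_ge0// /dotp (bigD1 i)//= -expr2 lerDl.
by apply: sumr_ge0 => j _; rewrite -expr2 sqr_ge0.
Qed.

Lemma enorm_sqr_le a : enorm a ^+ 2 <= n%:R * `|a| ^+ 2.
Proof.
rewrite enorm_sqr; apply: le_trans (ler_norm _) _.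
by rewrite expr2; exact: normr_dotp_le.
Qed.

Lemma enorm_le a : enorm a <= n%:R * `|a|.
Proof.
have h : 0 <= n%:R * `|a| by rewrite mulr_ge0.
rewrite -[leRHS](ger0_norm h) -sqrtr_sqr ler_sqrt ?sqr_ge0// -enorm_sqr.
apply: (le_trans (enorm_sqr_le _)); rewrite exprMn ler_wpM2r ?sqr_ge0//.
have n2 : (n <= n ^ 2)%N by case: (n) => // k; rewrite -mulnn leq_pmull.
by rewrite -natrX ler_nat.
Qed.

Lemma eball_box x r y : eball x r y -> `|y - x| < r.
Proof. exact: le_lt_trans (norm_le_enorm _). Qed.

Lemma box_eball x r y : `|y - x| < r / n.+1%:R -> eball x r y.
Proof.
rewrite /eball /= ltr_pdivlMr// => h; apply: le_lt_trans (enorm_le _) _.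
by apply: le_lt_trans h; rewrite mulrC ler_wpM2l// ler_nat.
Qed.

End quadratic.

(** * Local Lipschitz constants *)

Section local_lip.
Context {R : realType} {n : nat}.
Implicit Types (d : 'rV[R]_n -> 'rV[R]_n -> \bar R) (u : 'rV[R]_n -> R) (x y z : 'rV[R]_n).

Lemma eball_center x (r : R) : 0 < r -> eball x r x.
Proof.
by move=> r0; apply: box_eball; rewrite subrr normr0 divr_gt0.
Qed.

Lemma le_Lip d u (K L : set 'rV[R]_n) : K `<=` L -> (Lip d u K <= Lip d u L)%E.
Proof.
move=> KL; apply: ereal_sup_le => q [x [y [Kx Ky xy ->]]].
by exists x, y; split => //; exact: KL.
Qed.

(** The Lipschitz constant on a ball increases with the radius. *)
Lemma local_lipE d u x :
  local_lip d u x = ereal_inf [set Lip d u (eball x r) | r in `]0, +oo[ ].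
Proof.
apply/cvg_lim => //; apply: nondecreasing_at_right_cvge => //.
move=> r s _ _ rs; apply: le_Lip => y; rewrite /eball /= => h.
exact: lt_le_trans h rs.
Qed.

Lemma local_lip_le d u x (r : R) : 0 < r -> (local_lip d u x <= Lip d u (eball x r))%E.
Proof.
move=> r0; rewrite local_lipE; apply: ereal_inf_lbound; exists r => //=.
by rewrite in_itv/= r0.
Qed.

Lemma local_lip_ge d u x b : (forall r : R, 0 < r -> (b <= Lip d u (eball x r))%E) ->
  (b <= local_lip d u x)%E.
Proof.
move=> h; rewrite local_lipE; apply: le_ereal_inf_tmp => _ [r /= + <-].
by rewrite in_itv/= andbT; exact: h.
Qed.

(** The ball around x contains small balls around all nearby y; this is the
    upper semicontinuity of the local Lipschitz constant. *)
Lemma local_lip_usc d u x y (r : R) : 0 < r -> `|y - x| < r / n.+1%:R / 2 ->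
  (local_lip d u y <= Lip d u (eball x r))%E.
Proof.
move=> r0 yx; have r'0 : 0 < r / n.+1%:R / 2 by rewrite !divr_gt0.
apply: (le_trans (local_lip_le _ _ _ r'0)); apply: le_Lip => z /eball_box zy.
apply: box_eball; rewrite -(subrK y z) -addrA (le_lt_trans (ler_normD _ _))//.
by rewrite [ltRHS]splitr ltrD.
Qed.

End local_lip.

(** * Competitors and lower bounds for the intrinsic distance *)

Section intrinsic.
Context {R : realType} {n : nat}.
Notation X := (caratheodory_type (@lebesgue_outer_measure R n)).
Notation mu := (@lebesgue_rV R n).
Implicit Types (u v w : 'rV[R]_n -> R) (x y z p : 'rV[R]_n) (Omega : set 'rV[R]_n) (A : 'rV[R]_n -> 'M[R]_n).

Lemma ae_mono (P Q : 'rV[R]_n -> Prop) : {ae mu, forall x, P x} ->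
  (forall x, P x -> Q x) -> {ae mu, forall x, Q x}.
Proof.
move=> hP PQ; apply: (@negligibleS _ _ _ mu (~` P)) hP.
by move=> x nQ Px; apply: nQ; exact: PQ.
Qed.

Lemma ae_and (P Q : 'rV[R]_n -> Prop) : {ae mu, forall x, P x} ->
  {ae mu, forall x, Q x} -> {ae mu, forall x, P x /\ Q x}.
Proof.
move=> hP hQ; have := negligibleU hP hQ.
apply: negligibleS => x /= nPQ.
by apply: contrapT => /not_orP[/contrapT Px /contrapT Qx]; exact: nPQ.
Qed.

Lemma competitor_C1 Omega A w : open Omega -> (forall x, differentiable w x) ->
  (forall i, continuous (partial i w)) ->
  {ae mu, forall z, Omega z -> qform (A z) (grad w z) <= 1} ->
  intrinsic_competitor Omega A w.
Proof.
move=> oO dw cw qw; split.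
  by apply: continuous_subspaceT; exact: differentiable_continuousT.
by exists (grad w); split; [exact: W12loc_C1|exact: qw].
Qed.

Lemma gradN w x : differentiable w x -> grad (- w) x = - grad w x.
Proof. by move=> dw; apply/rowP => i; rewrite !mxE /partial deriveN//; exact: diff_derivable. Qed.

Lemma gradZ (c : R) w x : differentiable w x -> grad (c *: w) x = c *: grad w x.
Proof. by move=> dw; apply/rowP => i; rewrite !mxE /partial deriveZ//; exact: diff_derivable. Qed.

Lemma intrinsic_dist_ge Omega A u x y : intrinsic_competitor Omega A u ->
  ((u x - u y)%:E <= intrinsic_dist Omega A x y)%E.
Proof. by move=> cu; apply: ereal_sup_ubound; exists u. Qed.

Lemma intrinsic_dist_ge0 Omega A x y : open Omega -> (0 <= intrinsic_dist Omega A x y)%E.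
Proof.
move=> oO; apply: (@le_trans _ _ ((0 : R) - 0)%:E); first by rewrite subrr.
apply: (@intrinsic_dist_ge Omega A (cst 0)); apply: (competitor_C1 oO).
- by move=> z; exact: differentiable_cst.
- move=> i; have -> : partial i (cst 0 : 'rV[R]_n -> R) = cst 0.
    by apply/funext => z; rewrite /partial derive_cst.
  by move=> z; exact: cst_continuous.
- apply: aeW => z _; have -> : grad (cst 0 : 'rV[R]_n -> R) z = 0.
    by apply/rowP => i; rewrite !mxE /partial derive_cst.
  by rewrite qform0.
Qed.

(** The absolute value is allowed because - w competes along with w. *)
Lemma C1_competitor_dist Omega A w x y : open Omega -> (forall x, differentiable w x) ->
  (forall i, continuous (partial i w)) ->
  {ae mu, forall z, Omega z -> qform (A z) (grad w z) <= 1} ->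
  (`|w x - w y|%:E <= intrinsic_dist Omega A x y)%E.
Proof.
move=> oO dw cw qw.
have c1 := competitor_C1 oO dw cw qw.
have c2 : intrinsic_competitor Omega A (- w).
  have dNw z : differentiable (- w) z by exact: differentiableN.
  apply: (competitor_C1 oO dNw).
    move=> i; have -> : partial i (- w) = - (partial i w).
      by apply/funext => z; rewrite /partial deriveN//; exact: diff_derivable.
    by move=> z; apply: continuousN; exact: cw.
  apply: (ae_mono qw) => z h Oz; rewrite gradN// qformN; exact: h.
have [h|h] := leP 0 (w x - w y).
  by rewrite ger0_norm//; exact: intrinsic_dist_ge.
have := intrinsic_dist_ge x y c2; rewrite (ltr0_norm h).
by rewrite -[(- w) x]/(- w x) -[(- w) y]/(- w y) -opprD.
Qed.

(** The continuous function lambda is bounded near x; the constant L also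
    absorbs the comparison of the Euclidean norm with the sup norm. *)
Lemma elliptic_local Omega A x : open Omega -> scrA Omega A -> Omega x ->
  exists r L : R, [/\ 0 < r, 1 <= L, forall y, `|y - x| <= r -> Omega y &
    {ae mu, forall y, `|y - x| <= r -> forall xi : 'rV[R]_n,
      L^-1 * `|xi| ^+ 2 <= qform (A y) xi /\ qform (A y) xi <= L * `|xi| ^+ 2}].
Proof.
move=> oO [mA [lam [clam lam1 ellip]]] Ox.
have [r1 r10 hr1] := open_ball_norm oO Ox.
have : lam z @[z --> x] --> lam x.
  by move: clam; rewrite continuous_open_subspace// => /(_ x); rewrite inE; exact.
move=> /cvgrPdist_lt /(_ _ ltr01) /nbhs_ballP[r2 /= r20 hr2].
have lx1 := lam1 _ Ox.
pose L := (lam x + 1) * n.+1%:R.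
have n1 : 1 <= n.+1%:R :> R by rewrite ler1n.
have L1 : 1 <= L by rewrite /L; nra.
exists (Num.min r1 r2 / 2), L.
have m0 : 0 < Num.min r1 r2 by rewrite lt_min r10.
have rO y : `|y - x| <= Num.min r1 r2 / 2 -> `|y - x| < r1 /\ `|y - x| < r2.
  move=> h; have : `|y - x| < Num.min r1 r2 by apply: le_lt_trans h _; lra.
  by rewrite lt_min => /andP.
split => //.
- by rewrite divr_gt0.
- by move=> y /rO[/hr1].
apply: (ae_mono ellip) => y h yx xi.
have [y1 y2] := rO _ yx; have Oy := hr1 _ y1.
have ly : lam y <= lam x + 1.
  have /hr2 /= : ball x r2 y by rewrite mx_norm_ball /ball_/= distrC.
  by rewrite ltr_norml => /andP[]; lra.
have [h1 h2] := h Oy xi; have ly1 := lam1 _ Oy.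
have e0 := sqr_ge0 (enorm xi).
have x0 := sqr_ge0 `|xi|.
split.
  apply: (le_trans _ h1); apply: ler_pM => //.
  - by rewrite invr_ge0; lra.
  - by rewrite lef_pV2 ?posrE; [rewrite /L; nra|lra|lra].
  - by rewrite ler_pXn2r ?nnegrE//; [exact: norm_le_enorm|exact: sqrtr_ge0].
apply: (le_trans h2); apply: (@le_trans _ _ ((lam x + 1) * (n%:R * `|xi| ^+ 2))).
  by apply: ler_pM => //; [lra|exact: enorm_sqr_le].
rewrite /L -mulrA ler_wpM2l//; first lra.
by rewrite ler_wpM2r// ler_nat.
Qed.

Lemma differentiable_dotp p x y : differentiable (fun y => dotp p (y - x)) y.
Proof.
have -> : (fun y => dotp p (y - x)) =
   \sum_(i < n) (fun y : 'rV[R]_n => p ord0 i * (y ord0 i - x ord0 i)).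
  by apply/funext => z; rewrite fct_sumE; apply: eq_bigr => i _; rewrite !mxE.
apply: differentiable_sum => i.
apply: (@differentiableZ _ _ _ (fun y : 'rV[R]_n => y ord0 i - x ord0 i) (p ord0 i)).
by apply: differentiableB => //; exact: differentiable_coord.
Qed.

Lemma differentiable_ridge (f f' : R -> R) p x y : (forall t : R, is_derive t 1 f (f' t)) ->
  differentiable (fun y => f (dotp p (y - x))) y.
Proof.
move=> df; apply: (@differentiable_comp _ _ _ _ (fun y => dotp p (y - x)) f).
  exact: differentiable_dotp.
by apply/derivable1_diffP; have [] := df (dotp p (y - x)).
Qed.

Lemma grad_ridge (f f' : R -> R) p x y : (forall t : R, is_derive t 1 f (f' t)) ->
  grad (fun y => f (dotp p (y - x))) y = f' (dotp p (y - x)) *: p.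
Proof.
move=> df; apply/rowP => i; rewrite !mxE /partial.
have dd : derivable (fun y => f (dotp p (y - x))) y (delta_mx 0 i).
  by apply: diff_derivable; exact: differentiable_ridge df.
have := @is_derive_line _ _ (fun y => f (dotp p (y - x))) y (delta_mx 0 i) 0.
rewrite scale0r addr0 => /(_ dd) [_ <-].
set b := dotp p (y - x).
have -> : (fun s : R => f (dotp p (y + s *: delta_mx 0 i - x))) =
   f \o (id * cst (p ord0 i) + cst b)%R.
  apply/funext => s /=; congr (f _).
  rewrite -[RHS]/(s * p ord0 i + b) addrAC dotpDr dotpZr dotp_delta.
  by rewrite [LHS]addrC.
have d1 : is_derive (0 : R) 1 (id * cst (p ord0 i) + cst b)%R (p ord0 i).
  have d2 := @is_derive_id R R 0 1.
  have d3 := @is_derive_cst R R R (p ord0 i) 0 1.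
  have d4 := @is_derive_cst R R R b 0 1.
  apply: (is_derive_eq (is_deriveD (is_deriveM d2 d3) d4)).
  by rewrite scaler0 add0r addr0 /GRing.scale/= mulr1.
have d5 : is_derive ((id * cst (p ord0 i) + cst b)%R (0 : R)) 1 f (f' b).
  have -> : (id * cst (p ord0 i) + cst b)%R (0 : R) = b; last exact: df.
  by rewrite -[LHS]/(0 * p ord0 i + b) mul0r add0r.
by have [_ ->] := is_derive1_comp d5 d1.
Qed.

Lemma gradM u v x : differentiable u x -> differentiable v x ->
  grad (u * v) x = v x *: grad u x + u x *: grad v x.
Proof.
move=> df dg; apply/rowP => i; rewrite !mxE /partial deriveM; [|exact: diff_derivable..].
by rewrite addrC.
Qed.

Lemma continuous_grad u : (forall i, continuous (partial i u)) -> continuous (grad u).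
Proof.
move=> cu; suff H (x : 'rV[R]_n) : grad u z @[z --> x] --> grad u x by exact: H.
move=> B [P hP PB].
have hk k : \forall z \near x, P ord0 k (partial k u z).
  by have := hP ord0 k; rewrite grad_coord => /(cu k x).
have h := @filter_forall _ _ _ (nbhs x) (nbhs_filter x) hk.
suff : nbhs x (grad u @^-1` B) by [].
by apply: (@filterS _ _ (nbhs_filter x) _ _ _ h) => z {}h; apply: PB => i k; rewrite ord1 grad_coord.
Qed.

Lemma sqrt_qform_triangle (M : 'M[R]_n) p y : (forall xi, 0 <= qform M xi) ->
  Num.sqrt (qform M (p + y)) <= Num.sqrt (qform M p) + Num.sqrt (qform M y).
Proof.
move=> q0; have S0 : 0 <= Num.sqrt (qform M p) + Num.sqrt (qform M y).
  by rewrite addr_ge0 ?sqrtr_ge0.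
rewrite -[leRHS](ger0_norm S0) -sqrtr_sqr ler_sqrt ?sqr_ge0// qformD sqrrD.
rewrite !sqr_sqrtr// lerD2r lerD2l.
have := le_trans (ler_norm _) (sform_le p y q0).
by rewrite -[X in _ -> _ <= X]mulr_natl => h; rewrite ler_pM2l.
Qed.

Lemma sqrt_qformZ (M : 'M[R]_n) (c : R) p :
  Num.sqrt (qform M (c *: p)) = `|c| * Num.sqrt (qform M p).
Proof. by rewrite qformZ sqrtrM ?sqr_ge0// sqrtr_sqr. Qed.

(** The linear function of gradient p must be cut off by a bump G in order to
    compete on all of Omega. Multiplying by G adds the term S * grad G to the
    gradient, so the linear function is first replaced by the wave S = s * sin
    (<p, y - x> / s): its gradient is at most p in size, equals p at x, and S
    itself is bounded by s. For small s the extra term costs at most e. The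
    resulting w has gradient p at x, hence behaves like the linear function
    near x. *)
Lemma intrinsic_dist_ge_linear Omega A x p (r L kappa e : R) : open Omega ->
  0 < r -> 0 <= L -> 0 <= kappa -> 0 < e ->
  {ae mu, forall y, `|y - x| <= r -> (forall xi : 'rV[R]_n, 0 <= qform (A y) xi) /\
     (forall xi : 'rV[R]_n, qform (A y) xi <= L * `|xi| ^+ 2)} ->
  {ae mu, forall y, `|y - x| <= r -> qform (A y) p <= kappa ^+ 2} ->
  exists2 rho : R, 0 < rho & forall y z, `|y - x| < rho -> `|z - x| < rho ->
    ((`|dotp p (y - z)| - e * `|y - z|)%:E <= (kappa + e)%:E * intrinsic_dist Omega A y z)%E.
Proof.
move=> oO r0 L0 k0 e0 hA hp.
pose b0 := bump x r x; have b00 : 0 < b0 by exact: bump_center_gt0.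
pose G := b0^-1 \*: bump x r.
have [db cdb] : (forall y, differentiable (bump x r) y) /\ (forall i, continuous (partial i (bump x r))).
  exact: (@Ck_bump R n 1).
have dG y : differentiable G y by exact: differentiableZ.
have GE y : G y = b0^-1 * bump x r y by [].
have G0 y : 0 <= G y by rewrite GE mulr_ge0 ?bump_ge0// invr_ge0 ltW.
have G1 y : G y <= 1.
  by rewrite GE -[leRHS](mulVf (lt0r_neq0 b00)) ler_wpM2l ?invr_ge0 ?(ltW b00)//; exact: bump_le_center.
have Gx : G x = 1 by rewrite GE mulVf// gt_eqF.
have Gout y : ~ (`|y - x| <= r) -> G y = 0.
  by move=> /negP; rewrite -ltNge => /ltW h; rewrite GE bump_out// mulr0.
have cG i : continuous (partial i G).
  have -> : partial i G = (b0^-1 \*: partial i (bump x r)).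
    by apply/funext => y; rewrite /partial deriveZ//; exact: diff_derivable.
  by move=> y; apply: continuousZr; exact: cdb.
have [MG MG0 hMG] : exists2 M : R, 0 <= M & forall y, `|grad G y| <= M.
  have /choice[M hM] : forall i : 'I_n, exists M : R, 0 <= M /\ forall y, `|partial i G y| <= M.
    move=> i; have [M M0 hM] := continuous_compact_support_bounded (cG i) (@compact_cube R n x r)
       (partial_support i (@closed_cube R n x r) Gout).
    by exists M.
  exists (\sum_i M i); first by apply: sumr_ge0 => i _; have [] := hM i.
  move=> y; apply: norm_rV_le => [|i]; first by apply: sumr_ge0 => i _; have [] := hM i.
  rewrite grad_coord (bigD1 i)//=; have [_ /(_ y) h] := hM i.
  rewrite -[leLHS]addr0 lerD//; apply: sumr_ge0 => j _; by have [] := hM j.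
have sL0 : 0 <= Num.sqrt L by exact: sqrtr_ge0.
(* Chosen so that s times a bound for the A-length of grad G is at most e. *)
pose s := e / (Num.sqrt L * MG + 1).
have D0 : 0 < Num.sqrt L * MG + 1 by rewrite ltr_wpDl// mulr_ge0.
have s0 : 0 < s by rewrite divr_gt0.
have sle : s * (Num.sqrt L * MG) <= e.
  rewrite /s mulrAC ler_pdivrMr// ler_wpM2l ?(ltW e0)// lerDl//.
pose f (t : R) := s * sin (t / s).
have df (t : R) : is_derive t 1 f (cos (t / s)).
  have d1 : is_derive t 1 (fun t : R => t * s^-1) s^-1.
    have d2 := @is_derive_id R R t 1.
    have d3 := @is_derive_cst R R R s^-1 t 1.
    apply: (is_derive_eq (is_deriveM d2 d3)).
    by rewrite scaler0 add0r /GRing.scale/= mulr1.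
  have d4 := @is_derive1_comp _ sin (fun t : R => t * s^-1) t _ _ (is_derive_sin _) d1.
  have d5 := is_deriveZ s d4.
  apply: (is_derive_eq d5).
  by rewrite /GRing.scale/= mulrCA mulfV ?mulr1// gt_eqF.
pose S y := f (dotp p (y - x)).
have dS y : differentiable S y by exact: differentiable_ridge df.
have gS y : grad S y = cos (dotp p (y - x) / s) *: p by exact: grad_ridge df.
pose w := (S * G)%R.
have dw y : differentiable w y by exact: differentiableM.
have gw y : grad w y = (G y * cos (dotp p (y - x) / s)) *: p + S y *: grad G y.
  by rewrite gradM// gS scalerA.
have cw i : continuous (partial i w).
  have -> : partial i w = (fun y => (G y * cos (dotp p (y - x) / s)) * p ord0 i + S y * partial i G y).
    by apply/funext => y; rewrite -grad_coord gw !mxE.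
  have cS : continuous S by exact: differentiable_continuousT.
  have cGT : continuous G by exact: differentiable_continuousT.
  have ccos : continuous (fun y => cos (dotp p (y - x) / s)).
    have cl : continuous (fun y => dotp p (y - x)).
      by move=> y; apply: differentiable_continuous; exact: differentiable_dotp.
    have cc : continuous (fun t : R => cos (t / s)).
      move=> t; apply: continuous_comp; last exact: continuous_cos.
      exact: mulrr_continuous.
    move=> y; apply: (@continuous_comp _ _ _ (fun y => dotp p (y - x)) (fun t => cos (t / s))).
      exact: cl.
    exact: cc.
  move=> y; apply: (@continuousD _ _ _ (fun y => (G y * cos (dotp p (y - x) / s)) * p ord0 i)
      (fun y => S y * partial i G y)).
    apply: (@continuousM _ _ (fun y => G y * cos (dotp p (y - x) / s)) (cst (p ord0 i))).
      by apply: continuousM; [exact: cGT|exact: ccos].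
    exact: cst_continuous.
  by apply: continuousM; [exact: cS|exact: cG].
have ke0 : 0 < kappa + e by rewrite ltr_wpDl.
have Sle y : `|S y| <= s.
  by rewrite /S /f normrM (gtr0_norm s0) ler_piMr ?(ltW s0)// ler_norml sin_geN1 sin_le1.
have gout y : ~ (`|y - x| <= r) -> grad w y = 0.
  move=> nyr; apply/rowP => i; rewrite grad_coord mxE.
  apply: (partial_support i (@closed_cube R n x r) _ nyr) => z nz.
  by rewrite -[w z]/(S z * G z) Gout// mulr0.
(* The gradient of w has A-length at most kappa + e almost everywhere. *)
pose w' := ((kappa + e)^-1 *: w : 'rV[R]_n -> R).
have dw' y : differentiable w' y by exact: differentiableZ.
have gw' y : grad w' y = (kappa + e)^-1 *: grad w y by rewrite gradZ.
have cw' i : continuous (partial i w').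
  have -> : partial i w' = ((kappa + e)^-1 \*: partial i w).
    by apply/funext => y; rewrite /partial deriveZ//; exact: diff_derivable.
  by move=> y; apply: continuousZr; exact: cw.
have qw' : {ae mu, forall z, Omega z -> qform (A z) (grad w' z) <= 1}.
  apply: (ae_mono (ae_and hA hp)) => y [h1 h2] _.
  have [yr|nyr] := pselect (`|y - x| <= r); last by rewrite gw' gout// scaler0 qform0.
  have [q0 qL] := h1 yr; have {h2} := h2 yr => qp.
  have h : Num.sqrt (qform (A y) (grad w y)) <= kappa + e.
    rewrite gw (le_trans (sqrt_qform_triangle _ _ q0))// !sqrt_qformZ lerD//.
      have : Num.sqrt (qform (A y) p) <= kappa.
        by rewrite -(ger0_norm k0) -sqrtr_sqr ler_sqrt ?sqr_ge0.
      move=> h; rewrite -[leRHS]mul1r ler_pM ?sqrtr_ge0//.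
      rewrite normrM (ger0_norm (G0 _)) -[leRHS]mulr1 ler_pM//.
      by rewrite ler_norml cos_geN1 cos_le1.
    apply: le_trans sle; rewrite ler_pM ?sqrtr_ge0//.
    rewrite -[MG](ger0_norm MG0) -sqrtr_sqr -sqrtrM// ler_sqrt ?mulr_ge0 ?sqr_ge0//.
    apply: (le_trans (qL _)); rewrite ler_wpM2l// ler_pXn2r ?nnegrE//.
  rewrite gw' qformZ exprVn mulrC ler_pdivrMr ?exprn_gt0// mul1r.
  by rewrite -[leLHS]sqr_sqrtr// ler_pXn2r ?nnegrE ?sqrtr_ge0// ltW.
have C1w : C1 setT w.
  split; first by move=> y _.
  by apply: continuous_subspaceT; exact: continuous_grad.
have gwx : grad w x = p.
  rewrite gw Gx /S /f subrr dotpC dotp0l mul0r sin0 cos0 mulr0 scale0r addr0.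
  by rewrite mul1r scale1r.
have [rho rho0 hrho] := C1_strict openT C1w (I : setT x) e0.
exists rho => // y z yr zr.
have hd := C1_competitor_dist y z oO dw' cw' qw'.
have := hrho y z yr zr; rewrite gwx => hw.
apply: (@le_trans _ _ (`|w y - w z|)%:E).
  rewrite lee_fin lerBlDr -lerBlDl; apply: le_trans hw.
  by rewrite [leRHS]distrC lerB_dist.
rewrite -lee_pdivrMl//; apply: le_trans hd.
rewrite -EFinM lee_fin -[w' y]/((kappa + e)^-1 * w y) -[w' z]/((kappa + e)^-1 * w z).
by rewrite -mulrBr normrM ger0_norm// invr_ge0 ltW.
Qed.

End intrinsic.

(** * Upper bound for the local Lipschitz constant *)

Section upper.
Context {R : realType} {n : nat}.
Notation X := (caratheodory_type (@lebesgue_outer_measure R n)).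
Notation mu := (@lebesgue_rV R n).
Implicit Types (u v w f : 'rV[R]_n -> R) (x y z p : 'rV[R]_n) (Omega : set 'rV[R]_n) (A : 'rV[R]_n -> 'M[R]_n).

(** Semicontinuity in the direction p = grad u x bounds the A-length of p near
    x, so intrinsic_dist_ge_linear bounds the distance of y and z from below
    by about |<p, y - z>| / sqrt (q_x(p)), while u increases by <p, y - z> up
    to e |y - z|. The errors proportional to |y - z| are absorbed by the
    distance itself, by the same lemma applied to the coordinate directions
    (h1). *)
Lemma local_lip_upper Omega A u x : open Omega -> scrA Omega A -> Omega x -> C1 Omega u ->
  0 <= qform (A x) (grad u x) ->
  (forall e : R, 0 < e -> exists2 r : R, 0 < r & {ae mu, forall y, `|y - x| <= r ->
     qform (A y) (grad u x) <= qform (A x) (grad u x) + e}) ->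
  (local_lip (intrinsic_dist Omega A) u x <= (Num.sqrt (qform (A x) (grad u x)))%:E)%E.
Proof.
move=> oO hA Ox C1u; set p := grad u x; set Q := qform (A x) p => Q0 hQ.
have [r0 [L [r00 L1 r0O ell]]] := elliptic_local oO hA Ox.
have L0 : 0 <= L by apply: le_trans L1.
have ell' (r : R) : r <= r0 -> {ae mu, forall y, `|y - x| <= r ->
     (forall xi : 'rV[R]_n, 0 <= qform (A y) xi) /\
     (forall xi : 'rV[R]_n, qform (A y) xi <= L * `|xi| ^+ 2)}.
  move=> rr0; apply: (ae_mono ell) => y h yr; have {}h := h (le_trans yr rr0).
  split => xi; last by have [] := h xi.
  by have [h1 _] := h xi; apply: le_trans h1; rewrite mulr_ge0 ?invr_ge0 ?sqr_ge0.
pose C0 : R := 2 * (Num.sqrt L + 2^-1).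
have C00 : 0 < C0 by rewrite mulr_gt0// ltr_wpDl ?sqrtr_ge0.
(* The distance dominates the norm: the coordinate in which y - z is largest
   serves as p, with error e = 1/2. *)
have [rho1 rho10 h1] : exists2 rho : R, 0 < rho & forall y z, `|y - x| < rho -> `|z - x| < rho ->
    ((`|y - z|)%:E <= C0%:E * intrinsic_dist Omega A y z)%E.
  have /choice[rho hrho] : forall i : 'I_n, exists rho : R, 0 < rho /\
    forall y z, `|y - x| < rho -> `|z - x| < rho ->
    ((`|dotp (delta_mx 0 i) (y - z)| - 2^-1 * `|y - z|)%:E <=
       (Num.sqrt L + 2^-1)%:E * intrinsic_dist Omega A y z)%E.
    move=> i; have [||rho rho0 h] := @intrinsic_dist_ge_linear _ _ Omega A x (delta_mx 0 i) r0 L (Num.sqrt L) 2^-1 oO r00 L0 (sqrtr_ge0 _) _ (ell' _ (lexx _)) _.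
    - by rewrite invr_gt0.
    - apply: (ae_mono (ell' _ (lexx _))) => y h yr; have [_ /(_ (delta_mx 0 i)) hi] := h yr.
      apply: (le_trans hi); rewrite sqr_sqrtr// ler_piMr// expr_le1//.
      apply: norm_rV_le => // j; rewrite mxE normr_nat lern1 leq_b1 //.
    by exists rho.
  exists (\big[Num.min/1]_i rho i).
    by apply/bigmin_gtP; split => // i _; have [] := hrho i.
  move=> y z yr zr; have [->|yz] := eqVneq y z.
    by rewrite subrr normr0 mule_ge0// ?intrinsic_dist_ge0// lee_fin ltW.
  have [i hi] : exists i, `|y - z| = `|(y - z) ord0 i|.
    have : `|y - z| != 0 by rewrite normr_eq0 subr_eq0.
    rewrite /Num.norm/= => /mx_norm_neq0[[a b]] /= ->; exists b.
    by rewrite ord1.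
  have [_ /(_ y z)] := hrho i.
  have ri : \big[Num.min/1]_i rho i <= rho i by exact: bigmin_le_cond.
  move=> /(_ (lt_le_trans yr ri) (lt_le_trans zr ri)).
  rewrite dotpC dotp_delta -hi => h.
  rewrite /C0 EFinM -muleA -lee_pdivrMl//; apply: le_trans h.
  rewrite -EFinM lee_fin; lra.
suff main e : 0 < e -> (local_lip (intrinsic_dist Omega A) u x <=
    (Num.sqrt Q + e * (2 + 2 * C0))%:E)%E.
  apply/lee_addgt0Pr => e e0; rewrite -EFinD.
  have D0 : 0 < 2 + 2 * C0 by rewrite addr_gt0// mulr_gt0.
  by have := main (e / (2 + 2 * C0)) (divr_gt0 e0 D0); rewrite divfK// gt_eqF.
move=> e0.
have [rho2 rho20 h2] := C1_strict oO C1u Ox e0.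
have [r3 r30 h3] := hQ _ (exprn_gt0 2 e0).
pose r := Num.min r0 r3.
have rr : 0 < r by rewrite lt_min r00.
have [|||rho3 rho30 h4] := @intrinsic_dist_ge_linear _ _ Omega A x p r L (Num.sqrt Q + e) e oO rr L0 _ e0 (ell' _ _) _.
- by rewrite addr_ge0 ?sqrtr_ge0// ltW.
- by rewrite ge_min lexx.
- apply: (ae_mono h3) => y h yr; apply: (le_trans (h _)).
    by rewrite (le_trans yr)// ge_min lexx orbT.
  rewrite sqrrD sqr_sqrtr// lerD2r lerDl mulrn_wge0// mulr_ge0 ?sqrtr_ge0// ltW//.
pose rho := Num.min rho1 (Num.min rho2 rho3).
have rho0 : 0 < rho by rewrite !lt_min rho10 rho20.
apply: (le_trans (local_lip_le _ _ _ rho0)).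
apply: ge_ereal_sup => _ [y [z [/eball_box yr /eball_box zr yz ->]]].
move: yr zr; rewrite !lt_min => /and3P[y1 y2 y3] /and3P[z1 z2 z3].
have {}h1 := h1 y z y1 z1; have {}h2 := h2 y z y2 z2; have {}h4 := h4 y z y3 z3.
set d := intrinsic_dist _ _ y z in h1 h4 *.
have d0 : (0 <= d)%E by exact: intrinsic_dist_ge0.
have yz0 : 0 < `|y - z| by rewrite normr_gt0 subr_eq0; apply/eqP.
have B0 : 0 <= Num.sqrt Q + e * (2 + 2 * C0).
  by rewrite addr_ge0 ?sqrtr_ge0// mulr_ge0 ?(ltW e0)// addr_ge0// mulr_ge0// ltW.
case: d d0 h1 h4 => [d| |//] d0 h1 h4; last by rewrite invey mule0 lee_fin.
rewrite -!EFinM !lee_fin in d0 h1 h4.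
have dp : 0 < d by rewrite lt_neqAle d0 andbT; apply/eqP => d00; rewrite -d00 mulr0 in h1; lra.
rewrite inver gt_eqF// -EFinM lee_fin ler_pdivrMr// distrC.
have t1 : `|u y - u z| <= `|dotp p (y - z)| + e * `|y - z|.
  rewrite -lerBlDl; apply: le_trans h2; exact: lerB_dist.
apply: (le_trans t1).
have t2 : e * `|y - z| <= e * (C0 * d) by rewrite ler_wpM2l// ltW.
have -> : (Num.sqrt Q + e * (2 + 2 * C0)) * d =
   (Num.sqrt Q + e + e) * d + 2 * (e * (C0 * d)) by ring.
lra.
Qed.

Lemma ae_countable (T : countType) (P : T -> 'rV[R]_n -> Prop) :
  (forall t, {ae mu, forall x, P t x}) -> {ae mu, forall x, forall t, P t x}.
Proof.
move=> hP; pose F (k : nat) : set X := if (pickle_inv k : option T) is Some t then ~` (P t) else set0.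
have : mu.-negligible (\bigcup_k F k).
  apply: negligible_bigcup => k; rewrite /F; case: pickle_inv => [t|]; first exact: hP.
  exact: negligible_set0.
apply: negligibleS => x /= /existsNP[t nPt]; exists (pickle t) => //.
by rewrite /F pickleK_inv.
Qed.

Lemma negligible_point x : (0 < n)%N -> mu.-negligible [set x].
Proof.
move=> n0; have E : [set x] = rect (fun i => `[x ord0 i, x ord0 i]%classic).
  apply/seteqP; split => y /=; first by move=> -> i; rewrite /= in_itv/= lexx.
  by move=> h; apply/rowP => i; have := h i; rewrite /= in_itv/= -eq_le => /eqP.
have mx : measurable ([set x] : set X) by rewrite E; apply: measurable_rect.
have m0 : mu [set x] = 0%E.
  rewrite E lebesgue_rV_rect// (bigD1 (Ordinal n0))//= lebesgue_measure_itv/= lte_fin ltxx.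
  by rewrite mul0e.
exact/(negligibleP mu mx).
Qed.

(** The upper limit is over a punctured neighbourhood; the point x itself is
    null because n > 0. *)
Lemma wusc_near Omega f x (e : R) : (0 < n)%N -> open Omega -> Omega x -> weak_usc_at Omega f x ->
  0 < e -> exists2 r : R, 0 < r & {ae mu, forall y, `|y - x| <= r -> f y <= f x + e}.
Proof.
move=> n0 oO Ox [E nE hE] e0.
have : (limf_esup (fun y => (f y)%:E) (within (Omega `\` E) x^') < (f x + e)%:E)%E.
  by apply: le_lt_trans hE _; rewrite lte_fin ltrDl.
move=> /ereal_inf_lt[_ [V /= hV <-] fV].
have [r1 r10 hr1] := open_ball_norm oO Ox.
move: hV; rewrite /within /= => /nbhs_ballP[r2 /= r20 hr2].
exists (Num.min r1 r2 / 2); first by rewrite divr_gt0// lt_min r10.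
have nN := negligibleU nE (negligible_point x n0).
apply: (negligibleS _ nN) => y /= /not_implyP[yr nf].
apply: contrapT => /not_orP[nEy yx]; apply: nf.
have m0 : 0 < Num.min r1 r2 by rewrite lt_min r10.
have : `|y - x| < Num.min r1 r2 by apply: le_lt_trans yr _; lra.
rewrite lt_min => /andP[y1 y2].
have Vy : V y.
  apply: hr2; [|by apply/eqP|by split => //; exact: hr1].
  by rewrite mx_norm_ball /ball_/= distrC.
have : ((f y)%:E <= ereal_sup [set (f y)%:E | y in V])%E by apply: ereal_sup_ubound; exists y.
by move=> /le_lt_trans/(_ fV); rewrite lte_fin => /ltW.
Qed.

Lemma rat_rV_dense p (d : R) : 0 < d -> exists q : 'rV[rat]_n,
  `|p - map_mx ratr q| <= d.
Proof.
move=> d0.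
have /choice[q hq] : forall i : 'I_n, exists q : rat, `|p ord0 i - ratr q| <= d.
  move=> i; have [|q] := @rat_in_itvoo R (p ord0 i - d) (p ord0 i + d); first lra.
  rewrite in_itv/= => /andP[q1 q2]; exists q.
  by rewrite ler_norml; apply/andP; split; lra.
exists (\row_i q i); apply: norm_rV_le => [|i]; first exact: ltW.
by rewrite !mxE; exact: hq.
Qed.

Lemma elliptic_at Omega A : open Omega -> scrA Omega A ->
  {ae mu, forall x, Omega x -> exists2 L : R, 0 <= L &
    forall xi : 'rV[R]_n, 0 <= qform (A x) xi /\ qform (A x) xi <= L * `|xi| ^+ 2}.
Proof.
move=> oO [mA [lam [clam lam1 ell]]]; apply: (ae_mono ell) => x h Ox.
have l1 := lam1 _ Ox; exists (lam x * n%:R); first by rewrite mulr_ge0//; lra.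
move=> xi; have [h1 h2] := h Ox xi; split.
  by apply: le_trans h1; rewrite mulr_ge0 ?sqr_ge0// invr_ge0; lra.
apply: (le_trans h2); rewrite -mulrA ler_wpM2l//; first lra.
exact: enorm_sqr_le.
Qed.

(** Semicontinuity holds at almost every x for each fixed direction, hence for
    all rational directions at once. An arbitrary p is approximated by a
    rational vector, and ellipticity makes both q_x and q_y, for y near x,
    uniformly continuous in the direction. *)
Lemma wusc_all Omega A : (0 < n)%N -> open Omega -> scrA_wusc Omega A ->
  {ae mu, forall x, Omega x -> forall p (e : R), 0 < e ->
    exists2 r : R, 0 < r & {ae mu, forall y, `|y - x| <= r ->
       qform (A y) p <= qform (A x) p + e}}.
Proof.
move=> n0 oO [hA wA].
pose vec (q : 'rV[rat]_n) : 'rV[R]_n := map_mx ratr q.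
pose dir q := (enorm (vec q))^-1 *: vec q.
have hq : {ae mu, forall x, forall q : 'rV[rat]_n, Omega x -> vec q != 0 ->
    weak_usc_at Omega (fun y => qform (A y) (dir q)) x}.
  apply: ae_countable => q; have [q0|q0] := eqVneq (vec q) 0.
    by apply: aeW => x _.
  have e0 : 0 < enorm (vec q) by apply: lt_le_trans (norm_le_enorm _); rewrite normr_gt0.
  have := wA (dir q) _; rewrite /dir => h.
  apply: (ae_mono (h _)) => [|x hx Ox _]; last exact: hx.
  rewrite /enorm dotpZl dotpZr mulrA sqrtrM; last by rewrite -expr2 sqr_ge0.
  by rewrite -expr2 sqrtr_sqr ger0_norm ?invr_ge0 ?(ltW e0)// mulVf// gt_eqF.
apply: (ae_mono (ae_and hq (elliptic_at oO hA))) => x [{}hq ellx] Ox p e e0.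
have [Lx Lx0 hLx] := ellx Ox.
have [r0 [L [r00 L1 r0O ell]]] := elliptic_local oO hA Ox.
pose M := Lx + L; have M0 : 0 < M by rewrite /M; lra.
(* By qform_lip, vectors within d of p change both forms by at most e / 3; the
   bound 1 on d keeps |p + q| below 2 |p| + 1. *)
pose d : R := Num.min 1 (e / 3 / (M * (2 * `|p| + 1))).
have D0 : 0 < M * (2 * `|p| + 1) by rewrite mulr_gt0// ltr_wpDl// mulr_ge0.
have d0 : 0 < d by rewrite lt_min ltr01 !divr_gt0.
have [q pq] := rat_rV_dense p d0; rewrite -/(vec q) in pq.
have dif (N : 'M[R]_n) (K : R) : 0 <= K -> K <= M -> (forall xi, 0 <= qform N xi) ->
    (forall xi, qform N xi <= K * `|xi| ^+ 2) -> `|qform N p - qform N (vec q)| <= e / 3.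
  move=> K0 KM N0 NK; apply: (le_trans (qform_lip _ _ K0 N0 NK)).
  have pq1 : `|p + vec q| <= 2 * `|p| + 1.
    have -> : p + vec q = 2 *: p - (p - vec q) by apply/rowP => i; rewrite !mxE; ring.
    apply: (le_trans (ler_normB _ _)); rewrite normrZ ger0_norm// lerD2l.
    by apply: (le_trans pq); rewrite ge_min lexx.
  apply: (@le_trans _ _ ((M * (2 * `|p| + 1)) * (e / 3 / (M * (2 * `|p| + 1))))); last first.
    by rewrite mulrC divfK// gt_eqF.
  apply: ler_pM => //; first by rewrite mulr_ge0.
    by apply: ler_pM.
  by apply: (le_trans pq); rewrite ge_min lexx orbT.
have e30 : 0 < e / 3 by rewrite divr_gt0.
have [r1 r10 h1] : exists2 r : R, 0 < r & {ae mu, forall y, `|y - x| <= r ->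
    qform (A y) (vec q) <= qform (A x) (vec q) + e / 3}.
  have [->|q0] := eqVneq (vec q) 0.
    by exists 1 => //; apply: aeW => y _; rewrite !qform0 add0r ltW.
  have en0 : 0 < enorm (vec q) by apply: lt_le_trans (norm_le_enorm _); rewrite normr_gt0.
  have e2 : 0 < e / 3 / enorm (vec q) ^+ 2 by rewrite divr_gt0// exprn_gt0.
  have [r r1 h] := wusc_near n0 oO Ox (hq q Ox q0) e2.
  exists r => //; apply: (ae_mono h) => y hy yr.
  have := hy yr; rewrite /dir !qformZ exprVn -(ler_pM2l (exprn_gt0 2 en0)).
  have E0 : enorm (vec q) ^+ 2 != 0 by rewrite gt_eqF// exprn_gt0.
  by rewrite mulrDr !(mulVKf E0) (mulrC _ (e / 3 / _)) divfK.
exists (Num.min r0 r1); first by rewrite lt_min r00.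
apply: (ae_mono (ae_and ell h1)) => y [elly hy] yr.
move: yr; rewrite le_min => /andP[yr0 yr1].
have {}hy := hy yr1; have {}elly := elly yr0.
have dy : `|qform (A y) p - qform (A y) (vec q)| <= e / 3.
  apply: (dif _ L) => [||xi|xi]; [lra|by rewrite /M; lra| |by have [] := elly xi].
  by have [h _] := elly xi; apply: le_trans h; rewrite mulr_ge0 ?sqr_ge0// invr_ge0; lra.
have dx : `|qform (A x) p - qform (A x) (vec q)| <= e / 3.
  by apply: (dif _ Lx) => [||xi|xi]; [lra|by rewrite /M; lra|have [] := hLx xi|have [] := hLx xi].
move: dx dy; rewrite !ler_norml => /andP[a1 a2] /andP[b1 b2].
lra.
Qed.

End upper.

(** * Mollified competitors and upper bounds for the intrinsic distance *)

Section lower.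
Context {R : realType} {n : nat}.
Notation X := (caratheodory_type (@lebesgue_outer_measure R n)).
Notation mu := (@lebesgue_rV R n).
Implicit Types (u v f : 'rV[R]_n -> R) (x y z p w zeta c : 'rV[R]_n) (Omega : set 'rV[R]_n) (A : 'rV[R]_n -> 'M[R]_n)
  (g : 'rV[R]_n -> 'rV[R]_n).

Notation cball x r := [set y : 'rV[R]_n | `|y - x| <= r].

Lemma bump_shift c (d : R) y : bump 0 d (y - c) = bump c d y.
Proof. by rewrite !bumpE; apply: eq_bigr => i _; rewrite !mxE subr0. Qed.

Lemma derive_shift_arg f c zeta y : 'D_zeta (fun y => f (y - c)) y = 'D_zeta f (y - c).
Proof.
rewrite /derive (_ : (fun h : R => _) =
  (fun h : R => h^-1 *: ((f \o shift (y - c)) (h *: zeta) - f (y - c)))) //.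
by apply/funext => h /=; rewrite addrA.
Qed.

Lemma derive_bump_shift c (d : R) w y : 'D_w (bump 0 d) (y - c) = 'D_w (bump c d) y.
Proof.
have <- : (fun a => bump 0 d (a - c)) = bump c d.
  by apply/funext => a; rewrite bump_shift.
by rewrite derive_shift_arg.
Qed.

Definition bump_mass (d : R) : R := \int[mu]_y bump 0 d y.

Lemma bump_differentiable c (d : R) x : differentiable (bump c d) x.
Proof. by have [h _] := @Ck_bump R n 1 c d; exact: h. Qed.

Lemma bump_continuous c (d : R) : continuous (bump c d : 'rV[R]_n -> R).
Proof. by apply: differentiable_continuousT; exact: bump_differentiable. Qed.

Lemma bump_support c (d : R) : 0 < d -> forall x, ~ cball c d x -> bump c d x = 0.
Proof. by move=> d0 x /= /negP; rewrite -ltNge => /ltW; exact: bump_out. Qed.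

Lemma integrable_bump c (d : R) : 0 < d -> mu.-integrable setT (EFin \o (bump c d : X -> R)).
Proof.
move=> d0; apply: (@integrable_compact_support _ _ (cball c d)).
- exact: bump_continuous.
- exact: compact_cube.
- exact: bump_support.
Qed.

Lemma Rintegral_bump c (d : R) (B : set X) : 0 < d -> cball c d `<=` B ->
  \int[mu]_(y in B) bump c d y = bump_mass d.
Proof.
move=> d0 cB.
have <- : \int[mu]_y bump c d y = \int[mu]_(y in B) bump c d y.
  apply: Rintegral_support; first exact: subsetT.
  by move=> x _ nB; apply: (@bump_support c d d0) => /cB.
have H : (\int[mu]_x (bump c d x)%:E = \int[mu]_x (bump 0 d x)%:E)%E.
  rewrite -(@integral_shift _ _ (- c) (bump 0 d)).
  - by apply: eq_integral => y _; rewrite bump_shift.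
  - exact: (continuous_measurable_rV measurableT (@bump_continuous 0 d)).
  - have -> : (fun x : X => (bump 0 d (x - c))%:E) = EFin \o (bump c d : X -> R).
      by apply/funext => y /=; rewrite bump_shift.
    exact: integrable_bump.
by rewrite /bump_mass /Rintegral H.
Qed.

(** The bump is bounded below on the cube of half the radius, so its mass is
    comparable with the volume of the cube. *)
Lemma bump_mass_ge (d : R) : 0 < d -> (theta 0 (3 / 4) * d) ^+ n <= bump_mass d.
Proof.
move=> d0; rewrite exprMn.
pose I := rect (fun _ : 'I_n => `[- (d / 2), d / 2]%classic).
have mI : measurable (I : set X) by apply: measurable_rect.
have muI : mu I = (d ^+ n)%:E.
  rewrite lebesgue_rV_rect// (eq_bigr (fun=> d%:E)) => [|i _].
    by rewrite prodEFin prodr_const card_ord.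
  rewrite lebesgue_measure_itv/= lte_fin ifT; last lra.
  by rewrite -EFinB; congr (_%:E); lra.
have th0 : 0 <= theta 0 (3 / 4) ^+ n :> R by rewrite exprn_ge0// theta_ge0.
rewrite -lee_fin /bump_mass -integral_EFin//; last exact: integrable_bump.
apply: (@le_trans _ _ (\int[mu]_(x in I) (theta 0 (3 / 4) ^+ n)%:E)%E).
  by rewrite integral_cst// muI -EFinM.
apply: (@le_trans _ _ (\int[mu]_(x in I) (bump 0 d x)%:E)%E).
  apply: ge0_le_integral; first exact: mI.
  - by move=> x _; rewrite lee_fin.
  - exact: measurable_cst.
  - apply/measurable_EFinP; exact: (continuous_measurable_rV mI (@bump_continuous 0 d)).
  - move=> x Ix; rewrite lee_fin; apply: bump_lb => //; rewrite subr0.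
    apply: norm_rV_le => [|i]; first by rewrite divr_ge0// ltW.
    by have := Ix i; rewrite /= in_itv/= ler_norml.
apply: ge0_subset_integral; [exact: mI|exact: measurableT|..].
- apply/measurable_EFinP; exact: (continuous_measurable_rV measurableT (@bump_continuous 0 d)).
- by move=> x _; rewrite lee_fin bump_ge0.
- by [].
Qed.

Lemma integrable_dotp Omega v g zeta (K : set X) : open Omega -> W12loc_grad Omega v g ->
  compact (K : set 'rV[R]_n) -> K `<=` Omega ->
  mu.-integrable K (EFin \o (fun y : X => dotp (g y) zeta)).
Proof.
move=> oO [_ gL _] cK KO; have mK := compact_measurable_rV cK.
have -> : EFin \o (fun y : X => dotp (g y) zeta) =
   (fun y : X => \sum_(i < n) (g y ord0 i * zeta ord0 i)%:E)%E.
  by apply/funext => y; rewrite /= sumEFin.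
apply: integrable_sum => // i _.
exact: (integrable_cst_mul _ mK (L2loc_integrable oO (gL i) cK KO)).
Qed.

(** The average of v against the bump centred at z + t zeta is differentiable
    in t. The derivative falls on the bump, and the weak gradient moves it
    back to v. *)
Lemma mollify_MVT Omega v g x z zeta (r d : R) : open Omega -> W12loc_grad Omega v g ->
  cball x r `<=` Omega -> 0 < d ->
  (forall t : R, 0 <= t <= 1 -> cball (z + t *: zeta) d `<=` cball x r) ->
  exists2 s : R, 0 <= s <= 1 &
    \int[mu]_(y in cball x r) (v y * bump (z + zeta) d y) -
    \int[mu]_(y in cball x r) (v y * bump z d y) =
    \int[mu]_(y in cball x r) (dotp (g y) zeta * bump (z + s *: zeta) d y).
Proof.
move=> oO vg BO d0 cB.
have cK := @compact_cube R n x r.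
have mB : measurable (cball x r : set X) := compact_measurable_rV cK.
have [vL _ _] := vg.
have vi := L2loc_integrable oO vL cK BO.
pose phi := bump (0 : 'rV[R]_n) d.
have [dphi cphi] := @Ck_bump R n 1 0 d.
have [M1 M10 hM1] := continuous_partials_bounded (- zeta) dphi cphi (@compact_cube R n 0 d) (@bump_support 0 d d0).
have hM0 y : `|phi y| <= 1 by rewrite ger0_norm ?bump_ge0// bump_le1.
pose V (t : R) := \int[mu]_(y in cball x r) (v y * phi (y - z + t *: - zeta)).
have E (t : R) y : y - z + t *: - zeta = y - (z + t *: zeta).
  by rewrite scalerN opprD addrA.
pose dV (t : R) := \int[mu]_(y in cball x r) (dotp (g y) zeta * bump (z + t *: zeta) d y).
have D (t : R) : t \in `[0, 1] -> is_derive t 1 V (dV t).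
  rewrite in_itv /= => t01.
  apply: (is_derive_eq (is_derive_mollify z t mB vi dphi hM0 hM1)).
  have W := @weak_directional _ _ Omega v g (bump (z + t *: zeta) d) (cball x r) (- zeta) oO vg
     (fun k => Ck_bump k _ _) cK BO _.
  transitivity (\int[mu]_(y in cball x r) (v y * 'D_(- zeta) (bump (z + t *: zeta) d) y)).
    apply: eq_Rintegral => y _; rewrite E; congr (_ * _).
    exact: derive_bump_shift.
  rewrite W; last by move=> y ny; apply: bump_support => //; apply: contra_not ny; exact: cB.
  rewrite /dV -mulN1r -RintegralZl//.
    by apply: eq_Rintegral => y _; rewrite dotpNr; ring.
  apply: (integrable_bounded_mul mB (integrable_dotp _ oO vg cK BO) (M := 1)).
    exact: (continuous_measurable_rV mB (@bump_continuous _ d)).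
  by move=> y; rewrite ger0_norm ?bump_ge0// bump_le1.
have H2 : {within `[0, 1], continuous V}.
  by apply: derivable_within_continuous => t t01; have [] := D _ t01.
have H1 (t : R) : t \in `]0, 1[ -> is_derive t 1 V (dV t).
  by move=> t01; apply: D; exact: subset_itv_oo_cc.
have [s s01] := MVT_segment ler01 H1 H2.
rewrite subr0 mulr1 => VE; exists s; first by rewrite in_itv/= in s01.
rewrite -/(dV s) -VE /V; congr (_ - _); apply: eq_Rintegral => y _; rewrite E /phi bump_shift.
  by rewrite scale1r.
by rewrite scale0r addr0.
Qed.

Lemma ae_le_Rintegral (D : set X) (f h : X -> R) : measurable D ->
  mu.-integrable D (EFin \o f) -> mu.-integrable D (EFin \o h) ->
  {ae mu, forall y, D y -> f y <= h y} ->
  \int[mu]_(y in D) f y <= \int[mu]_(y in D) h y.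
Proof.
move=> mD fi hi fh; rewrite -subr_ge0 -RintegralB//.
have bi : mu.-integrable D (EFin \o (fun y => h y - f y)).
  exact: (integrableB mD hi fi).
have mb := measurable_int _ bi.
have ae : ae_eq mu D (EFin \o (fun y => h y - f y)) (fun y => `|(h y - f y)%:E|%E).
  by apply: (ae_mono fh) => y {}fh Dy; rewrite gee0_abs// lee_fin subr_ge0; exact: fh.
have mab : measurable_fun D (fun y => `|(h y - f y)%:E|%E).
  exact: (measurableT_comp (@abse_measurable R setT) mb).
rewrite /Rintegral (ae_eq_integral _ _ mD mb mab ae).
by apply: fine_ge0; apply: integral_ge0 => y _; exact: abse_ge0.
Qed.

(** On the good set E the sharp bound a applies; on the part of Q outside E
    only the crude bound b, but there the bump is at most 1, so the cost is
    the measure of that part. *)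
Lemma Rintegral_bump_le x c (r d a b : R) (Q E : set X) (f : X -> R) : 0 < d -> 0 <= a -> 0 <= b ->
  measurable Q -> measurable E -> cball c d `<=` Q -> Q `<=` cball x r ->
  mu.-integrable (cball x r) (EFin \o f) ->
  {ae mu, forall y, cball x r y -> f y <= b /\ (E y -> f y <= a)} ->
  \int[mu]_(y in cball x r) (f y * bump c d y) <= a * bump_mass d + b * fine (mu (Q `\` E)).
Proof.
move=> d0 a0 b0 mQ mE cQ QB fi fab.
have cK := @compact_cube R n x r.
have mB : measurable (cball x r : set X) := compact_measurable_rV cK.
have mD : measurable (Q `\` E) by exact: measurableD.
have DQ : Q `\` E `<=` cball x r by apply: subset_trans QB => y [].
have i1 : mu.-integrable (cball x r) (EFin \o (fun y : X => f y * bump c d y)).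
  apply: (integrable_bounded_mul mB fi (M := 1)).
    exact: (continuous_measurable_rV mB (@bump_continuous _ d)).
  by move=> y; rewrite ger0_norm ?bump_ge0// bump_le1.
have i2 : mu.-integrable (cball x r) (EFin \o (bump c d : X -> R)).
  apply: (integrable_bounded_compact cK (M := 1)).
    exact: (continuous_measurable_rV mB (@bump_continuous _ d)).
  by move=> y _; rewrite ger0_norm ?bump_ge0// bump_le1.
have i3 : mu.-integrable (cball x r) (EFin \o (\1_(Q `\` E) : X -> R)).
  apply: (integrable_bounded_compact cK (M := 1)).
    exact: measurable_indic.
  by move=> y _; rewrite ger0_norm// indicE; case: (_ \in _).
have i4 : mu.-integrable (cball x r) (EFin \o (fun y : X => a * bump c d y)).
  have := integrable_cst_mul a mB i2.
  by apply: eq_integrable => // y _; rewrite /= mulrC.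
have i5 : mu.-integrable (cball x r) (EFin \o (fun y : X => b * \1_(Q `\` E) y)).
  have := integrable_cst_mul b mB i3.
  by apply: eq_integrable => // y _; rewrite /= mulrC.
have <- : \int[mu]_(y in cball x r) bump c d y = bump_mass d.
  by apply: Rintegral_bump => // y /cQ/QB.
have <- : \int[mu]_(y in cball x r) \1_(Q `\` E) y = fine (mu (Q `\` E)).
  rewrite /Rintegral (integral_indic mu mB mD).
  by rewrite setIidl.
rewrite -RintegralZl// -(RintegralZl _ mB i3) -(RintegralD mB i4 i5).
apply: ae_le_Rintegral.
- exact: mB.
- exact: i1.
- exact: (integrableD mB i4 i5).
apply: (ae_mono fab) => y /[swap] By /(_ By)[fb fa].
have p0 := bump_ge0 c d y; have p1 := bump_le1 c d y.
rewrite indicE; case: (boolP (y \in _)) => [_|]; rewrite ?mulr1 ?mulr0 ?addr0.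
  by rewrite ler_wpDl ?mulr_ge0// (le_trans (ler_wpM2r p0 fb))// ler_piMr.
rewrite notin_setE => nD; have [Qy|nQ] := pselect (Q y).
  rewrite ler_wpM2r//; apply: fa; apply: contrapT => nE; apply: nD; split => //.
by rewrite (bump_support d0) ?mulr0// => /cQ.
Qed.

Lemma bump_mass_gt0 (d : R) : 0 < d -> 0 < bump_mass d.
Proof.
move=> d0; apply: lt_le_trans (bump_mass_ge d0); rewrite exprn_gt0// mulr_gt0//.
by apply: theta0_gt0; lra.
Qed.

Lemma Rintegral_mollify_near Omega v x c (r d e : R) : open Omega -> L2loc Omega v -> 0 < d ->
  cball x r `<=` Omega -> cball c d `<=` cball x r ->
  (forall y, cball c d y -> `|v y - v c| <= e) ->
  `|\int[mu]_(y in cball x r) (v y * bump c d y) - v c * bump_mass d| <= e * bump_mass d.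
Proof.
move=> oO vL d0 BO cB hv.
have cK := @compact_cube R n x r.
have mB : measurable (cball x r : set X) := compact_measurable_rV cK.
have vi := L2loc_integrable oO vL cK BO.
have mb := continuous_measurable_rV mB (@bump_continuous c d).
have b1 y : `|bump c d y| <= 1 by rewrite ger0_norm ?bump_ge0// bump_le1.
have i1 : mu.-integrable (cball x r) (EFin \o (fun y : X => v y * bump c d y)).
  exact: (integrable_bounded_mul mB vi mb b1).
have i2 : mu.-integrable (cball x r) (EFin \o (bump c d : X -> R)).
  by apply: (integrable_bounded_compact cK mb (M := 1)).
have i3 (k : R) : mu.-integrable (cball x r) (EFin \o (fun y : X => k * bump c d y)).
  have := integrable_cst_mul k mB i2.
  by apply: eq_integrable => // y _; rewrite /= mulrC.
rewrite -(Rintegral_bump d0 cB) -!RintegralZl// -(RintegralB mB i1 (i3 _)).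
apply: le_trans (le_normr_Rintegral mB (integrableB mB i1 (i3 _))) _.
apply: (le_Rintegral mB (integrable_abse (integrableB mB i1 (i3 _))) (i3 e)) => y By.
rewrite -mulrBl normrM (ger0_norm (bump_ge0 _ _ _)).
have [cy|ncy] := pselect (cball c d y); last by rewrite (bump_support d0 ncy) !mulr0.
by rewrite ler_wpM2r ?bump_ge0//; exact: hv.
Qed.

(** v is within e of its averages at both ends, and the averages differ by a
    weighted mean of <g, zeta> over a small cube inside Q. *)
Lemma competitor_increment Omega v g x z zeta (r d a b e : R) (Q E : set X) : open Omega ->
  W12loc_grad Omega v g -> cball x r `<=` Omega -> 0 < d -> 0 <= a -> 0 <= b ->
  measurable Q -> measurable E -> Q `<=` cball x r ->
  (forall t : R, 0 <= t <= 1 -> cball (z + t *: zeta) d `<=` Q) ->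
  {ae mu, forall y, cball x r y -> dotp (g y) zeta <= b /\ (E y -> dotp (g y) zeta <= a)} ->
  (forall y, cball z d y -> `|v y - v z| <= e) ->
  (forall y, cball (z + zeta) d y -> `|v y - v (z + zeta)| <= e) ->
  v (z + zeta) - v z <= a + b * fine (mu (Q `\` E)) / bump_mass d + 2 * e.
Proof.
move=> oO vg BO d0 a0 b0 mQ mE QB cQ hab h0 h1.
have [vL _ _] := vg.
have cB t : 0 <= t <= 1 -> cball (z + t *: zeta) d `<=` cball x r.
  by move=> t01; apply: subset_trans QB; exact: cQ.
have [s s01 hs] := mollify_MVT oO vg BO d0 cB.
have gi := integrable_dotp zeta oO vg (@compact_cube R n x r) BO.
have := Rintegral_bump_le d0 a0 b0 mQ mE (cQ s s01) QB gi hab.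
rewrite -hs => {}hs.
have cB0 : cball z d `<=` cball x r.
  by have := cB 0; rewrite scale0r addr0; apply; rewrite lexx ler01.
have cB1 : cball (z + zeta) d `<=` cball x r.
  by have := cB 1; rewrite scale1r; apply; rewrite lexx ler01.
have := Rintegral_mollify_near oO vL d0 BO cB0 h0.
have := Rintegral_mollify_near oO vL d0 BO cB1 h1.
rewrite !ler_norml => /andP[/= k1 k2] /andP[/= k3 k4].
have I0 := bump_mass_gt0 d0.
rewrite -(ler_pM2r I0) !mulrDl divfK ?gt_eqF// mulNr.
move: hs k1 k2 k3 k4; move: (\int[mu]_(y in _) _) (\int[mu]_(y in _) _) => V1 V0.
move: (fine _) (bump_mass d) (v (z + zeta)) (v z) => m I v1 v0.
clear; rewrite -mulrA; move: (b * m) => bm; lra.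
Qed.

Lemma segment_cball x z zeta (s t : R) : 0 <= t <= 1 -> `|z - x| <= s -> `|z + zeta - x| <= s ->
  `|z + t *: zeta - x| <= s.
Proof.
move=> /andP[t0 t1] h0 h1.
have -> : z + t *: zeta - x = (1 - t) *: (z - x) + t *: (z + zeta - x).
  by apply/rowP => i; rewrite !mxE; ring.
apply: (le_trans (ler_normD _ _)); rewrite !normrZ (ger0_norm t0) ger0_norm ?subr_ge0//.
have -> : s = (1 - t) * s + t * s by ring.
by rewrite lerD// ler_wpM2l// subr_ge0.
Qed.

(** competitor_increment with no bad set, the radius d of the bump tending to
    0; continuity of v takes care of e. *)
Lemma gradient_lipschitz Omega v g x (r C : R) : open Omega -> {within Omega, continuous v} ->
  W12loc_grad Omega v g -> cball x r `<=` Omega -> 0 <= C ->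
  {ae mu, forall y, cball x r y -> forall zeta, dotp (g y) zeta <= C * `|zeta|} ->
  forall z z', `|z - x| < r -> `|z' - x| < r -> `|v z' - v z| <= C * `|z' - z|.
Proof.
move=> oO cv vg BO C0 hg.
suff H z z' : `|z - x| < r -> `|z' - x| < r -> v z' - v z <= C * `|z' - z|.
  move=> z z' zr z'r; have [h|h] := leP 0 (v z' - v z); first by rewrite ger0_norm//; exact: H.
  by rewrite ltr0_norm// opprB distrC; exact: H.
move=> zr z'r; apply/ler_addgt0Pr => e e0.
have cvx y : `|y - x| < r -> exists2 d : R, 0 < d & forall y', cball y d y' -> `|v y' - v y| <= e / 2.
  move=> yr; have Oy : Omega y by apply: BO; exact: ltW.
  have : v t @[t --> y] --> v y.
    by move: cv; rewrite continuous_open_subspace// => /(_ y); rewrite inE; exact.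
  have e20 : 0 < e / 2 by rewrite divr_gt0.
  move=> /cvgrPdist_lt /(_ _ e20) /nbhs_ballP[d /= d0 hd].
  exists (d / 2); first by rewrite divr_gt0.
  move=> y' /= yy'; rewrite distrC; apply/ltW/hd.
  rewrite mx_norm_ball /ball_/= distrC; apply: (le_lt_trans yy').
  by rewrite ltr_pdivrMr// ltr_pMr// ltr1n.
have [d1 d10 hd1] := cvx _ zr; have [d2 d20 hd2] := cvx _ z'r.
pose s := Num.max `|z - x| `|z' - x|.
have sr : s < r by rewrite gt_max zr.
pose d := Num.min (r - s) (Num.min d1 d2).
have d0 : 0 < d by rewrite !lt_min subr_gt0 sr d10.
have ds : d <= r - s by rewrite ge_min lexx.
have dd1 : d <= d1 by rewrite !ge_min lexx orbT.
have dd2 : d <= d2 by rewrite !ge_min lexx !orbT.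
have E : z' = z + (z' - z) by rewrite addrC subrK.
have mB : measurable (cball x r : set X) by apply: compact_measurable_rV; exact: compact_cube.
have hseg t : 0 <= t <= 1 -> cball (z + t *: (z' - z)) d `<=` cball x r.
  move=> t01 y /= hy.
  have h1 : `|z + t *: (z' - z) - x| <= s.
    by apply: segment_cball; rewrite -?E// le_max lexx ?orbT.
  have -> : y - x = (y - (z + t *: (z' - z))) + (z + t *: (z' - z) - x) by rewrite addrA subrK.
  apply: (le_trans (ler_normD _ _)); have := lerD (le_trans hy ds) h1.
  by rewrite subrK.
have Cz0 : 0 <= C * `|z' - z| by rewrite mulr_ge0.
have hab : {ae mu, forall y, cball x r y -> dotp (g y) (z' - z) <= C * `|z' - z| /\
    ([set: X] y -> dotp (g y) (z' - z) <= C * `|z' - z|)}.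
  by apply: (ae_mono hg) => y hy By; split => [|_]; exact: hy.
have h0 y : cball z d y -> `|v y - v z| <= e / 2.
  by move=> /= hy; apply: hd1; exact: le_trans dd1.
have h1 y : cball (z + (z' - z)) d y -> `|v y - v (z + (z' - z))| <= e / 2.
  by rewrite -E => /= hy; apply: hd2; exact: le_trans dd2.
have := competitor_increment oO vg BO d0 Cz0 Cz0 mB measurableT (@subset_refl _ _) hseg hab h0 h1.
rewrite setDT measure0 /= mulr0 mul0r addr0 -E => h; apply: (le_trans h).
by rewrite lerD2l mulrC divfK.
Qed.

(** Every competitor is Lipschitz with constant n sqrt L by ellipticity, so
    its oscillation over the bumps is controlled uniformly; the bound of
    competitor_increment is then the same for all competitors and passes to
    the supremum. *)
Lemma intrinsic_dist_le Omega A x z zeta (r L d a : R) (Q E : set X) : open Omega ->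
  cball x r `<=` Omega -> 0 < L -> 0 < d -> 0 <= a ->
  measurable Q -> measurable E -> Q `<=` [set y | `|y - x| < r] ->
  (forall t : R, 0 <= t <= 1 -> cball (z + t *: zeta) d `<=` Q) ->
  {ae mu, forall y, cball x r y -> forall xi, L^-1 * `|xi| ^+ 2 <= qform (A y) xi} ->
  {ae mu, forall y, cball x r y -> E y -> forall xi, qform (A y) xi <= 1 -> dotp xi zeta <= a} ->
  (intrinsic_dist Omega A (z + zeta) z <=
    (a + n%:R * Num.sqrt L * (`|zeta| * fine (mu (Q `\` E)) / bump_mass d + 2 * d))%:E)%E.
Proof.
move=> oO BO L0 d0 a0 mQ mE Qr cQ ell hE.
apply: ge_ereal_sup => _ [v [cv [g [vg qg]]] <-]; rewrite lee_fin.
set C := n%:R * Num.sqrt L.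
have C0 : 0 <= C by rewrite mulr_ge0// sqrtr_ge0.
have hg : {ae mu, forall y, cball x r y -> forall w, dotp (g y) w <= C * `|w|}.
  apply: (ae_mono (ae_and ell qg)) => y [{}ell {}qg] By w.
  have := le_trans (ell By (g y)) (qg (BO _ By)).
  rewrite ler_pdivrMl// mulr1 => gL.
  have {}gL : `|g y| <= Num.sqrt L by rewrite -(@ger0_norm _ `|g y|)// -sqrtr_sqr ler_sqrt// ltW.
  apply: (le_trans (ler_norm _)); apply: (le_trans (normr_dotp_le _ _)).
  by rewrite /C -mulrA ler_wpM2l// ler_wpM2r.
have lip := gradient_lipschitz oO cv vg BO C0 hg.
have QB : Q `<=` cball x r by move=> y /Qr /= /ltW.
have hc y : cball z d y -> `|v y - v z| <= C * d.
  have cz : cball z d `<=` Q.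
    by have := cQ 0; rewrite scale0r addr0; apply; rewrite lexx ler01.
  have zr : `|z - x| < r by apply/Qr/cz; rewrite /= subrr normr0 ltW.
  move=> hy; apply: (le_trans (lip z y zr (Qr _ (cz _ hy)))).
  by rewrite ler_wpM2l.
have hc1 y : cball (z + zeta) d y -> `|v y - v (z + zeta)| <= C * d.
  have cz : cball (z + zeta) d `<=` Q.
    by have := cQ 1; rewrite scale1r; apply; rewrite lexx ler01.
  have zr : `|z + zeta - x| < r by apply/Qr/cz; rewrite /= subrr normr0 ltW.
  move=> hy; apply: (le_trans (lip _ y zr (Qr _ (cz _ hy)))).
  by rewrite ler_wpM2l.
have b0 : 0 <= C * `|zeta| by rewrite mulr_ge0.
have hab : {ae mu, forall y, cball x r y -> dotp (g y) zeta <= C * `|zeta| /\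
    (E y -> dotp (g y) zeta <= a)}.
  apply: (ae_mono (ae_and hg (ae_and hE qg))) => y [h1 [h2 h3]] By; split => [|Ey].
    exact: h1.
  by apply: h2 => //; apply: h3; exact: BO.
apply: le_trans (competitor_increment oO vg BO d0 a0 b0 mQ mE QB cQ hab hc hc1) _.
have -> : C * (`|zeta| * fine (mu (Q `\` E)) / bump_mass d + 2 * d) =
   C * `|zeta| * fine (mu (Q `\` E)) / bump_mass d + 2 * (C * d).
  by rewrite mulrDr (mulrCA C 2) !mulrA.
by rewrite addrA.
Qed.

End lower.

(** * Lower bound for the local Lipschitz constant *)

Section density.
Context {R : realType} {n : nat}.
Notation X := (caratheodory_type (@lebesgue_outer_measure R n)).
Notation mu := (@lebesgue_rV R n).
Implicit Types (u v f : 'rV[R]_n -> R) (x y z p w zeta c : 'rV[R]_n) (Omega : set 'rV[R]_n) (A : 'rV[R]_n -> 'M[R]_n).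

(** Approximate continuity of A at x, measured along arbitrarily small dyadic
    cubes containing x. *)
Definition approx_cont_at A x := forall e : R, 0 < e -> exists E : set X,
  [/\ measurable E, forall y, E y -> forall i j, `|A y i j - A x i j| <= e &
      forall eta : R, 0 < eta -> forall k0, exists2 k, (k0 <= k)%N &
        (mu (dyadic_cube k (dyadic_index k x) `\` E) <=
           eta%:E * mu (dyadic_cube k (dyadic_index k x)))%E].

(** Apply ae_weak_density to the countably many sets on which A is within
    1/(j+1) of a rational matrix, entry by entry: off a null set, x has
    density in each of them that contains x. *)
Lemma ae_approx_cont Omega A : open Omega -> scrA Omega A ->
  {ae mu, forall x, Omega x -> approx_cont_at A x}.
Proof.
move=> oO [mA _].
pose E (t : 'M[rat]_n * nat) : set X := Omega `&`
  \bigcap_(ij in [set: 'I_n * 'I_n]) (Omega `&` [set y : X | `|A y ij.1 ij.2 - ratr (t.1 ij.1 ij.2)| < t.2.+1%:R^-1]).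
have mO : measurable (Omega : set X) by exact: open_measurable_rV.
have mE t : measurable (E t).
  apply: measurableI => //; apply: fin_bigcap_measurable; first exact: finite_finset.
  move=> [i j] _ /=.
  pose b : R := ratr (t.1 i j).
  have -> : [set y : X | `|A y i j - b| < t.2.+1%:R^-1] =
      (fun y : X => A y i j) @^-1` `]b - t.2.+1%:R^-1, b + t.2.+1%:R^-1[%classic.
    by apply/seteqP; split => y /=; rewrite in_itv/= ltr_distl.
  exact: (mA i j mO _ (measurable_itv _)).
have h := ae_countable (P := fun (t : 'M[rat]_n * nat) x => E t x -> forall eta : R, 0 < eta ->
   forall k0, exists2 k, (k0 <= k)%N & (mu (dyadic_cube k (dyadic_index k x) `\` E t) <=
     eta%:E * mu (dyadic_cube k (dyadic_index k x)))%E).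
apply: (ae_mono (h _)) => [t|x {}h Ox e e0].
  apply: (negligibleS _ (ae_weak_density (mE t))) => x /= /not_implyP[Ex nd].
  by split.
have [j hj] : exists j : nat, 2 * j.+1%:R^-1 <= e.
  have e20 : 0 < e / 2 by rewrite divr_gt0.
  have [k hk] := ltr_add_invr e20; exists k.
  by move: hk; rewrite add0r; move: (_^-1) => c hk; lra.
have /choice[M hM] : forall i : 'I_n, exists q : 'rV[rat]_n,
    `|row i (A x) - map_mx ratr q| <= j.+2%:R^-1.
  by move=> i; apply: rat_rV_dense; rewrite invr_gt0.
pose N : 'M[rat]_n := \matrix_(i, j) M i ord0 j.
have hN i i' : `|A x i i' - ratr (N i i')| < j.+1%:R^-1.
  apply: (@le_lt_trans _ _ j.+2%:R^-1); last by rewrite ltf_pV2 ?posrE// ltr_nat.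
  by have := le_trans (norm_coord _ i') (hM i); rewrite !mxE.
have Ex : E (N, j) x by split => // -[i i'] _ /=; split => //; exact: hN.
exists (E (N, j)); split; [exact: mE| |exact: h].
move=> y [Oy hy] i i'; have [_ /=] := hy (i, i') I.
have := hN i i'; move: (_^-1) hj => c hj.
rewrite /= !ltr_norml => /andP[a1 a2] /andP[b1 b2].
by apply: le_trans hj; rewrite ler_norml; apply/andP; split; lra.
Qed.

(** In a small cube around x, A is close to A(x) except on a small proportion.
    There Cauchy-Schwarz for A(x) bounds <g, xi>, for a competitor with
    gradient g, by about sqrt (q_x(p)), because <g, xi> is the symmetric form
    of A(x) at g and p. intrinsic_dist_le turns this into a bound for the
    distance along a segment of direction xi starting at the centre of the
    cube. *)
Lemma dense_point_dist Omega A x p : open Omega -> scrA Omega A -> Omega x ->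
  (forall xi, 0 <= qform (A x) xi) -> approx_cont_at A x -> symapp (A x) p != 0 ->
  forall eps rho : R, 0 < eps -> 0 < rho -> exists z (tau : R),
    [/\ 0 < tau, `|z - x| < rho, `|z + tau *: symapp (A x) p - x| < rho &
      (intrinsic_dist Omega A (z + tau *: symapp (A x) p) z <=
        (tau * (Num.sqrt (qform (A x) p) + eps))%:E)%E].
Proof.
move=> oO hA Ox q0 dx; set xi := symapp (A x) p => xi0 eps rho eps0 rho0.
set Q := Num.sqrt (qform (A x) p).
have Q0 : 0 <= Q by exact: sqrtr_ge0.
have [r [L [r0 L1 BO ell]]] := elliptic_local oO hA Ox.
have L0 : 0 < L by lra.
have nxi : 0 < `|xi| by rewrite normr_gt0.
pose th : R := theta 0 (3 / 4).
have th0 : 0 < th by apply: theta0_gt0; lra.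
pose K := n%:R * Num.sqrt L * `|xi| + 1.
have K0 : 0 < K by rewrite /K ltr_wpDl// !mulr_ge0// sqrtr_ge0.
(* Radius of the bump relative to the side of the cube. At most 1/8, so that
   the bump moved by a quarter of the side stays in the cube; and small enough
   for the oscillation term of intrinsic_dist_le. *)
pose kappa : R := Num.min (1 / 8) (eps / (32 * K)).
have kap0 : 0 < kappa.
  by rewrite lt_min; apply/andP; split; [lra|rewrite divr_gt0// mulr_gt0].
have kap1 : kappa <= 1 / 8 by rewrite ge_min lexx.
have kapK : K * (8 * kappa) <= eps / 4.
  have : kappa <= eps / (32 * K) by rewrite ge_min lexx orbT.
  rewrite ler_pdivlMr ?mulr_gt0// => h.
  have -> : K * (8 * kappa) = kappa * (32 * K) / 4 by field.
  by rewrite ler_pM2r// invr_gt0.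
(* How close A must be to A(x) for the sharp bound to lose at most eps / 2. *)
pose e := eps / (2 * (Q + 1) * (n%:R ^+ 2 * L + 1)).
have nL0 : 0 < n%:R ^+ 2 * L + 1 by rewrite ltr_wpDl// mulr_ge0 ?sqr_ge0// ltW.
have Q10 : 0 < Q + 1 by lra.
have e0 : 0 < e by rewrite divr_gt0// !mulr_gt0.
pose cc := n%:R ^+ 2 * e * L.
have cc0 : 0 <= cc := mulr_ge0 (mulr_ge0 (sqr_ge0 _) (ltW e0)) (ltW L0).
have ccQ : cc * Q <= eps / 2.
  have h1 : cc * Q <= (e * (n%:R ^+ 2 * L + 1)) * (Q + 1).
    apply: ler_pM => //; last by lra.
    by rewrite /cc mulrAC [leRHS]mulrC ler_wpM2r ?(ltW e0)//; lra.
  apply: (le_trans h1); rewrite /e.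
  have -> : eps / (2 * (Q + 1) * (n%:R ^+ 2 * L + 1)) * (n%:R ^+ 2 * L + 1) * (Q + 1) = eps / 2.
    by field; rewrite !gt_eqF.
  by [].
have [E [mE EA dE]] := dx _ e0.
(* Proportion of bad points: small compared with the mass (th * kappa) ^+ n of
   the bump relative to the cube. *)
pose eta := eps * (th * kappa) ^+ n / (4 * K).
have tk0 : 0 < (th * kappa) ^+ n by rewrite exprn_gt0// mulr_gt0.
have eta0 : 0 < eta by rewrite divr_gt0// mulr_gt0.
have [k1 hk1] : exists k0, forall k, (k0 <= k)%N -> (2 ^+ k)^-1 < Num.min r rho.
  by apply: pow2_archi; rewrite lt_min r0.
have [k kk hk] := dE _ eta0 k1.
have := hk1 _ kk; rewrite lt_min => /andP[lr lrho].
set l : R := (2 ^+ k)^-1 in lr lrho *.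
have l0 : 0 < l by rewrite invr_gt0 exprn_gt0.
pose m := dyadic_index k x.
set Cb := dyadic_cube k m in hk.
have Cx : Cb x by [].
(* The centre of the cube; zeta below has a quarter of the side as length. *)
pose z : 'rV[R]_n := \row_i (((m ord0 i)%:~R + 2^-1) * l).
pose tau := l / 4 / `|xi|.
have tau0 : 0 < tau by rewrite !divr_gt0.
pose zeta := tau *: xi.
have nz : `|zeta| = l / 4 by rewrite normrZ gtr0_norm// divfK// gt_eqF.
have Cin y : `|y - z| <= 3 / 8 * l -> Cb y.
  move=> hy; rewrite /Cb dyadic_cubeE => i /=; rewrite in_itv/=.
  have := le_trans (norm_coord (y - z) i) hy; rewrite !mxE ler_norml -/l => /andP[h1 h2].
  by apply/andP; split; lra.
have hseg (t : R) : 0 <= t <= 1 -> [set y | `|y - (z + t *: zeta)| <= kappa * l] `<=` Cb.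
  move=> /andP[t0 t1] y /= hy; apply: Cin.
  have -> : y - z = (y - (z + t *: zeta)) + t *: zeta by apply/rowP => i; rewrite !mxE; ring.
  apply: (le_trans (ler_normD _ _)); rewrite normrZ nz (ger0_norm t0).
  have : t * (l / 4) <= 1 * (l / 4) by rewrite ler_wpM2r// ltW// divr_gt0.
  have : kappa * l <= 1 / 8 * l by rewrite ler_wpM2r// ltW.
  lra.
have Cr y : Cb y -> `|y - x| < l by move=> Cy; exact: dyadic_cube_dist Cy Cx.
have zC : Cb z by apply: Cin; rewrite subrr normr0 mulr_ge0// ltW.
have zzC : Cb (z + zeta).
  by apply: Cin; rewrite addrC addKr nz; lra.
exists z, tau; split => //.
- exact: lt_trans (Cr _ zC) lrho.
- exact: lt_trans (Cr _ zzC) lrho.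
have d0 : 0 < kappa * l by rewrite mulr_gt0.
pose a := tau * ((1 + cc) * Q).
have a0 : 0 <= a by rewrite !mulr_ge0// ?ltW//; lra.
have Qr : Cb `<=` [set y | `|y - x| < r] by move=> y /Cr /= h; exact: lt_trans h lr.
have ell1 : {ae mu, forall y, [set y | `|y - x| <= r] y -> forall xi, L^-1 * `|xi| ^+ 2 <= qform (A y) xi}.
  by apply: (ae_mono ell) => y h yr w; have [] := h yr w.
have hE : {ae mu, forall y, [set y | `|y - x| <= r] y -> E y -> forall w, qform (A y) w <= 1 ->
    dotp w zeta <= a}.
  apply: (ae_mono ell) => y {}ell yr Ey w qw.
  have [w1 _] := ell yr w.
  have wL : `|w| ^+ 2 <= L by have := le_trans w1 qw; rewrite ler_pdivrMl// mulr1.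
  have qx : qform (A x) w <= 1 + cc.
    have := qform_entries w (ltW e0) (EA _ Ey); rewrite ler_norml => /andP[h _].
    have : n%:R ^+ 2 * e * `|w| ^+ 2 <= cc.
      by rewrite /cc ler_wpM2l// mulr_ge0 ?sqr_ge0// ltW.
    lra.
  rewrite /zeta dotpZr /a ler_pM2l// dotpC dotp_symapp.
  apply: le_trans (ler_norm _) _; apply: le_trans (sform_le _ _ q0) _.
  rewrite ler_wpM2r//.
  rewrite -[leRHS]ger0_norm ?addr_ge0// -sqrtr_sqr ler_sqrt ?sqr_ge0//.
  by apply: (le_trans qx); rewrite expr2; nra.
have mC : measurable (Cb : set X) by exact: measurable_cube.
apply: (le_trans (intrinsic_dist_le oO BO L0 d0 a0 mC mE Qr hseg ell1 hE)).
rewrite lee_fin.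
have I0 := bump_mass_gt0 (n := n) d0.
have ratio : fine (mu (Cb `\` E)) / bump_mass (n := n) (kappa * l) <= eps / (4 * K).
  rewrite ler_pdivrMr//.
  have h1 : fine (mu (Cb `\` E)) <= eta * l ^+ n.
    have := hk; rewrite lebesgue_dyadic_cube -EFinM -/l.
    have : (0 <= mu (Cb `\` E))%E by exact: measure_ge0.
    by case: (mu (Cb `\` E)).
  apply: (le_trans h1).
  have h2 := bump_mass_ge (n := n) d0.
  apply: le_trans (ler_wpM2l _ h2); last by rewrite divr_ge0// ?mulr_ge0// ltW.
  have -> : (th * (kappa * l)) ^+ n = (th * kappa) ^+ n * l ^+ n by rewrite mulrA exprMn.
  by rewrite /eta mulrA [eps * _ / _]mulrAC.
have ratio0 : 0 <= fine (mu (Cb `\` E)) / bump_mass (n := n) (kappa * l).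
  by rewrite divr_ge0 ?(ltW I0)// fine_ge0.
rewrite -[`|zeta| * _ / _]mulrA; move: ratio ratio0; move: (_ / bump_mass _) => q ratio ratio0.
have -> : `|zeta| * q + 2 * (kappa * l) = tau * `|xi| * (q + 8 * kappa).
  by rewrite nz /tau divfK ?gt_eqF//; field.
have hK : n%:R * Num.sqrt L * `|xi| <= K by rewrite /K lerDl.
have hq : K * q <= eps / 4.
  apply: (le_trans (ler_wpM2l (ltW K0) ratio)).
  have -> : K * (eps / (4 * K)) = eps / 4 by field; rewrite gt_eqF.
  by [].
have h8 : n%:R * Num.sqrt L * `|xi| * (q + 8 * kappa) <= K * (q + 8 * kappa).
  by rewrite ler_wpM2r// addr_ge0// mulr_ge0// ltW.
have -> : n%:R * Num.sqrt L * (tau * `|xi| * (q + 8 * kappa)) =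
   tau * (n%:R * Num.sqrt L * `|xi| * (q + 8 * kappa)) by ring.
rewrite /a -mulrDr ler_pM2l//; move: h8 kapK hq ccQ; rewrite mulrDr; clear; lra.
Qed.

Lemma local_lip_ge0 Omega A u x : (0 < n)%N -> open Omega ->
  (0 <= local_lip (intrinsic_dist Omega A) u x)%E.
Proof.
move=> n0 oO; apply: local_lip_ge => r r0.
pose s : R := r / n.+1%:R / 2.
have s0 : 0 < s by rewrite !divr_gt0.
pose y := x + s *: delta_mx 0 (Ordinal n0).
have yx : `|y - x| < r / n.+1%:R.
  have nd : `|delta_mx 0 (Ordinal n0) : 'rV[R]_n| <= 1.
    by apply: norm_rV_le => // j; rewrite mxE normr_nat lern1 leq_b1.
  rewrite addrC addKr normrZ gtr0_norm//; apply: (@le_lt_trans _ _ s).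
    by rewrite ler_piMr// ltW.
  by rewrite ltr_pdivrMr// ltr_pMr ?ltr1n// divr_gt0.
apply: (@le_trans _ _ (`|u x - u y|%:E / intrinsic_dist Omega A y x)%E).
  by rewrite mule_ge0// inve_ge0 intrinsic_dist_ge0.
apply: ereal_sup_ubound; exists y, x; split => //.
- exact: box_eball.
- exact: eball_center.
- rewrite -[X in _ <> X]addr0 => /addrI/rowP/(_ (Ordinal n0)).
  by rewrite !mxE !eqxx mulr1 => s00; rewrite s00 ltxx in s0.
Qed.

(** The case d = 0 rests on the convention 0^-1 = +oo. *)
Lemma quotient_ge (N M D : R) (d : \bar R) : 0 < D -> (0 <= d)%E -> (d <= D%:E)%E ->
  0 <= M -> N <= M -> ((N / D)%:E <= M%:E / d)%E.
Proof.
move=> D0; case: d => [d| |]//; rewrite !lee_fin => d0 dD M0 NM.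
have [d00|dn0] := eqVneq d 0.
  rewrite d00 inve0; have [M00|Mn0] := eqVneq M 0.
    by rewrite M00 mul0e lee_fin ler_pdivrMr// mul0r -M00.
  by rewrite gt0_muley ?leey// lte_fin lt_neqAle eq_sym Mn0.
rewrite inver (negbTE dn0) -EFinM lee_fin.
have dp : 0 < d by rewrite lt_neqAle eq_sym dn0.
apply: (@le_trans _ _ (M / D)); first by rewrite ler_wpM2r// invr_ge0 ltW.
by rewrite ler_wpM2l// lef_pV2.
Qed.

(** dense_point_dist gives points at distance at most tau (Q + eps), where Q =
    sqrt (q_x(p)), between which u increases by <p, tau xi> = tau Q ^+ 2 up to
    tau eps; the quotient tends to Q. When Q = 0 there is nothing but
    nonnegativity to prove. *)
Lemma local_lip_lower Omega A u x : (0 < n)%N -> open Omega -> scrA Omega A -> Omega x ->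
  C1 Omega u -> (forall xi, 0 <= qform (A x) xi) -> approx_cont_at A x ->
  ((Num.sqrt (qform (A x) (grad u x)))%:E <= local_lip (intrinsic_dist Omega A) u x)%E.
Proof.
move=> n0 oO hA Ox C1u q0 dx; set p := grad u x; set Q := Num.sqrt _.
have [Q00|Qn0] := eqVneq Q 0; first by rewrite Q00; exact: local_lip_ge0.
have Q0 : 0 < Q by rewrite lt_neqAle eq_sym Qn0 sqrtr_ge0.
have QE : Q ^+ 2 = dotp p (symapp (A x) p).
  by rewrite sqr_sqrtr// dotpC dotp_symapp qform_sform.
set xi := symapp (A x) p in QE.
have xi0 : xi != 0.
  by apply/eqP => x0; move: QE; rewrite x0 dotpC dotp0l => /eqP; rewrite sqrf_eq0 (negbTE Qn0).
have nxi : 0 < `|xi| by rewrite normr_gt0.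
apply/lee_addgt0Pr => s s0; rewrite -leeBlDr// -EFinB.
apply: local_lip_ge => r r0.
(* Makes (Q ^+ 2 - eps) / (Q + eps) at least Q - s. *)
pose eps := s * Q / (1 + Q).
have Q10 : 0 < 1 + Q by rewrite addr_gt0.
have eps0 : 0 < eps by rewrite divr_gt0// mulr_gt0.
have epsE : eps * (1 + Q) = s * Q by rewrite divfK// gt_eqF.
have [r1 r10 hr1] := C1_strict oO C1u Ox (divr_gt0 eps0 nxi).
pose rho := Num.min r1 (r / n.+1%:R).
have rho0 : 0 < rho by rewrite lt_min r10 divr_gt0.
have [z [tau [tau0 + + hd]]] := dense_point_dist oO hA Ox q0 dx xi0 eps0 rho0.
rewrite -/xi !lt_min => /andP[z1 z2] /andP[y1 y2].
rewrite -/xi -/Q in hd.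
set y := z + tau *: xi in y1 y2 hd.
have yz : y - z = tau *: xi by rewrite addrC addKr.
have := hr1 y z y1 z1; rewrite yz dotpZr -QE (normrZ tau xi) (gtr0_norm tau0).
have -> : eps / `|xi| * (tau * `|xi|) = tau * eps by field; rewrite gt_eqF//.
rewrite ler_norml => /andP[h _].
have D0 : 0 < tau * (Q + eps) by rewrite mulr_gt0// addr_gt0.
have h2 : tau * (Q ^+ 2 - eps) <= `|u z - u y|.
  rewrite distrC; apply: le_trans (ler_norm _); rewrite mulrBr.
  by move: h; rewrite -/p; lra.
apply: (@le_trans _ _ (`|u z - u y|%:E / intrinsic_dist Omega A y z)%E); last first.
  apply: ereal_sup_ubound; exists y, z; split => //; [exact: box_eball|exact: box_eball|].
  move=> yzE; move: yz; rewrite yzE subrr => /esym/eqP.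
  by rewrite scaler_eq0 (gt_eqF tau0) (negbTE xi0).
apply: le_trans (quotient_ge D0 (intrinsic_dist_ge0 _ _ _ oO) hd (normr_ge0 _) h2).
rewrite lee_fin ler_pdivlMr// mulrCA ler_pM2l//.
have : 0 <= s * eps by rewrite mulr_ge0// ltW.
have -> : (Q - s) * (Q + eps) = Q ^+ 2 - eps + (eps * (1 + Q) - s * Q) - s * eps by ring.
by rewrite epsE; lra.
Qed.

(** A function that agrees almost everywhere with the square of a local
    Lipschitz constant inherits its upper semicontinuity, off the null set
    where they differ. *)
Lemma weak_usc_of_local_lip Omega A u q x : (0 < n)%N -> open Omega -> Omega x ->
  let d := intrinsic_dist Omega A in
  {ae mu, forall y, Omega y -> (local_lip d u y ^+ 2)%E = (q y)%:E} ->
  (local_lip d u x ^+ 2)%E = (q x)%:E -> weak_usc_at Omega q x.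
Proof.
move=> n0 oO Ox d hq hx.
have d0 y : (0 <= local_lip d u y)%E by exact: local_lip_ge0.
have fin y : (local_lip d u y ^+ 2)%E = (q y)%:E -> exists2 l : R, 0 <= l &
    local_lip d u y = l%:E /\ q y = l ^+ 2.
  have := d0 y; case: (local_lip d u y) => [l| |]//.
    rewrite lee_fin => l0; rewrite -EFin_expe => -[<-]; by exists l.
have [l l0 [lE qE]] := fin _ hx.
exists (~` [set y | Omega y -> (local_lip d u y ^+ 2)%E = (q y)%:E]); first exact: hq.
apply/lee_addgt0Pr => e e0.
pose e' := Num.min 1 (e / (2 * l + 1)).
have l10 : 0 < 2 * l + 1 by lra.
have e'0 : 0 < e' by rewrite lt_min ltr01 divr_gt0.
have [r r0 hr] : exists2 r : R, 0 < r & (Lip d u (eball x r) < (l + e')%:E)%E.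
  have : (local_lip d u x < (l + e')%:E)%E by rewrite lE lte_fin ltrDl.
  rewrite local_lipE => /ereal_inf_lt[_ [r /= + <-] h].
  by rewrite in_itv/= andbT => r0; exists r.
pose N := ~` [set y | Omega y -> (local_lip d u y ^+ 2)%E = (q y)%:E].
pose r' : R := r / n.+1%:R / 2.
have r'0 : 0 < r' by rewrite !divr_gt0.
pose V := [set y | (Omega `\` N) y /\ `|y - x| < r'].
apply: (@le_trans _ _ (ereal_sup [set (q y)%:E | y in V])).
  apply: ereal_inf_lbound; exists V => //.
  rewrite /within /=; apply/nbhs_ballP; exists r' => //= y yx _ ONy; split => //.
  by move: yx; rewrite mx_norm_ball /ball_/= distrC.
apply: ge_ereal_sup => _ [y [[Oy Ny] yx] <-].
have {}Ny : Omega y -> (local_lip d u y ^+ 2)%E = (q y)%:E by exact: contrapT Ny.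
have [m m0 [mE ->]] := fin _ (Ny Oy).
have := le_lt_trans (local_lip_usc d u r0 yx) hr.
rewrite mE lte_fin -EFinD lee_fin qE => ml.
have : e' * (2 * l + 1) <= e by rewrite -ler_pdivlMr// ge_min lexx orbT.
have : e' <= 1 by rewrite ge_min lexx.
nra.
Qed.

End density.

(** * The characterization of weak upper semicontinuity *)

Theorem theorem2p6 (R : realType) (n : nat) (hn : (1 <= n)%N)
    (Omega : set 'rV[R]_n) (hOmega : domain Omega)
    (A : 'rV[R]_n -> 'M[R]_n) (hA : scrA Omega A) :
  scrA_wusc Omega A <->
  forall u : 'rV[R]_n -> R, C1 Omega u ->
    {ae lebesgue_rV, forall x, Omega x ->
       (local_lip (intrinsic_dist Omega A) u x ^+ 2)%E =
       (qform (A x) (grad u x))%:E}.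
Proof.
have [oO _] := hOmega; split => [wA u C1u|H].
  have h := ae_and (wusc_all hn oO wA) (ae_and (elliptic_at oO hA) (ae_approx_cont oO hA)).
  apply: (ae_mono h) => x [usc [ell dens]] Ox.
  have [L L0 hL] := ell Ox.
  have q0 xi : 0 <= qform (A x) xi by have [] := hL xi.
  have up := local_lip_upper oO hA Ox C1u (q0 _) (usc Ox (grad u x)).
  have lo := local_lip_lower hn oO hA Ox C1u q0 (dens Ox).
  have -> : local_lip (intrinsic_dist Omega A) u x = (Num.sqrt (qform (A x) (grad u x)))%:E.
    by apply/eqP; rewrite eq_le up lo.
  by rewrite -EFin_expe sqr_sqrtr.
split => // xi _.
(* The linear function of gradient xi turns the hypothesis into a formula for
   q_y(xi). *)
pose u (y : 'rV[R]_n) := dotp xi (y - 0).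
have gu y : grad u y = xi.
  by rewrite (@grad_ridge _ _ id (cst 1)) ?scale1r// => t; exact: is_derive_id.
have C1u : C1 Omega u.
  split => [y _|]; first exact: differentiable_dotp.
  apply: continuous_subspaceT; have -> : grad u = cst xi by apply/funext.
  exact: cst_continuous.
have hu : {ae lebesgue_rV, forall y, Omega y ->
    (local_lip (intrinsic_dist Omega A) u y ^+ 2)%E = (qform (A y) xi)%:E}.
  by apply: (ae_mono (H u C1u)) => y h Oy; rewrite h// gu.
apply: (ae_mono hu) => x hx Ox.
exact: (weak_usc_of_local_lip hn oO Ox hu (hx Ox)).
Qed.
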